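(* In the prescribed-archive setting described in the context, for even integers $T\ge4$, $r\in(0,1]$, and $0<\epsilon\le T/512$, $$\mathcal M_{\rm cov}^*(T,\epsilon,r)=\Theta\!\left(\frac{T^3}{r\epsilon^2}\right),$$ that is, there are universal constants $0<c\le C<\infty$ such that $cT^3/(r\epsilon^2)\le\mathcal M_{\rm cov}^*(T,\epsilon,r)\le CT^3/(r\epsilon^2)$ for all such $T,r,\epsilon$.
   Context: Lost-sales inventory model. Horizon $T$; $u^+=\max\{u,0\}$. Demands $D_1,\ldots,D_T$ are independent with laws $P_t$ supported on $[0,\bar D]$; $F_t^-(u)=\mathbb P(D_t<u)$. Holding and shortage coefficients $h_t,p_t>0$ are known, $C_c=\max_t\max\{h_t,p_t\}$; fixed and per-unit ordering costs, lead time, and terminal salvage value are zero. Starting period $t$ with inventory $x_t\ge0$, the retailer chooses a post-order level $y_t\ge x_t$ before demand and incurs $h_t(y_t-D_t)^++p_t(D_t-y_t)^+$. The next state is $(y_t-D_t)^+$; only sales $\min\{D_t,y_t\}$ are observed. Feasible policies use the information then available and may randomize; $V_1^\pi(x)$ is the expected total cost from initial inventory $x$, and $V_1^*(x)=\inf_\pi V_1^\pi(x)$. A policy $\pi$ is $\epsilon$-optimal at $x$ if $V_1^\pi(x)-V_1^*(x)\le\epsilon$. Prescribed-archive setting. Normalize $C_c=\bar D=1$ and $x_1=0$. For each positive integer $N$, the learner is supplied with $N$ raw sales logs per period, $(Z_t^j,b_t^j)$, $t=1,\ldots,T$, $j=1,\ldots,N$, where $b_t^j\ge0$ is a prescribed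 known boundary and $Z_t^j=\min\{D_t^j,b_t^j\}$, with $D_t^j$ latent. Conditional on the complete boundary array, the latent $D_t^j$ are mutually independent and $D_t^j$ has law $P_t$. The learner is also supplied with known nondecreasing caps $0\le a_t\le1$ satisfying $F_t^-(a_t)>p_t/(h_t+p_t)$ and $m_t:=|\{j:b_t^j\ge a_t\}|\ge\lceil rN\rceil$ for every $t$. The learner observes these arrays but cannot choose them; it knows the costs but not the demand laws, and may be randomized. $N_{\rm cov}^*(T,\epsilon,r)$ is the least $N$ permitting one learner to return a policy that is $\epsilon$-optimal at $x_1=0$ with probability at least $3/4$ (over data and learner randomization), uniformly over these demand laws, known costs, and arrays. Finally $\mathcal M_{\rm cov}^*(T,\epsilon,r)=T\,N_{\rm cov}^*(T,\epsilon,r)$. *)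

(* Defs.v *)
From HB Require Import structures.
From mathcomp Require Export all_boot all_order all_algebra.
From mathcomp Require Export all_classical all_reals all_analysis.

Set Implicit Arguments.
Unset Strict Implicit.
Unset Printing Implicit Defensive.

Import Order.TTheory GRing.Theory Num.Theory.

Local Open Scope classical_set_scope.
Local Open Scope ring_scope.

(* Periods are numbered from 0: period t = 0, ..., T - 1 here is period t + 1
   in the usual numbering.  Coefficient vectors of length T are tuples, read
   with h`_t. *)
Section Model.
Variable R : realType.
Local Notation RR := (measurableTypeR R).

(* What is known at the start of period t: the records
   (inventory, post-order level, sales) of the t previous periods, most recent
   first, and the current inventory. *)
Definition hist (t : nat) := (t.-tuple (RR * RR * RR) * RR)%type.

(* A decision rule gives, in each period, the law of the (randomized)
   post-order level as a function of the history; measurability in the history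
   is supplied by the kernel types used below. *)
Definition decision_rule := forall t, hist t -> {measure set RR -> \bar R}.

(* Almost surely y_t >= x_t. *)
Definition feasible (pi : decision_rule) : Prop :=
  forall t (k : hist t), pi t k [set y | k.2 <= y] = 1%E.

Definition period_cost (h p y u : R) : R :=
  h * Num.max (y - u) 0 + p * Num.max (u - y) 0.

(* Expected cost of the n periods t, ..., t + n - 1, given the history
   (past, x) at the start of period t: y is the post-order level, u the
   demand. *)
Fixpoint cost_to_go (h p : seq R) (P : nat -> probability RR R)
    (pi : decision_rule) (n t : nat) (past : t.-tuple (RR * RR * RR)) (x : R)
    {struct n} : \bar R :=
  if n is n'.+1 then
    (\int[pi t (past, x)]_(y in setT) \int[P t]_(u in setT)
      ((period_cost h`_t p`_t y u)%:E +
       cost_to_go h p P pi n'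
         [tuple of ((x, y, Num.min u y) : RR * RR * RR) :: past]
         (Num.max (y - u) 0)%R))%E
  else 0%E.

Definition value T (h p : T.-tuple R) (P : nat -> probability RR R)
    (pi : decision_rule) (x : R) : \bar R :=
  cost_to_go h p P pi T [tuple] x.

Definition opt_value T (h p : T.-tuple R) (P : nat -> probability RR R)
    (x : R) : \bar R :=
  ereal_inf [set value h p P (fun t => pi t) x |
    pi in [set pi : forall t, R.-pker (hist t) ~> RR |
           feasible (fun t => pi t)]].

Definition eps_optimal T (h p : T.-tuple R) (P : nat -> probability RR R)
    (eps : R) (pi : decision_rule) (x : R) : Prop :=
  (value h p P pi x - opt_value h p P x <= eps%:E)%E.

Definition mutually_independent d (Omega : measurableType d)
    (mu : probability Omega R) (I : finType) (X : I -> Omega -> RR) : Prop :=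
  forall (J : {set I}) (A : I -> set RR), (forall i, measurable (A i)) ->
    mu (\bigcap_(i in [set` J]) X i @^-1` A i) =
    (\prod_(i in J) mu (X i @^-1` A i))%E.

(* The table of raw sales logs (Z_t^j, b_t^j). *)
Definition logs (T N : nat) := T.-tuple (N.-tuple (RR * RR)%type).

Definition censor T N (b D : 'I_T -> 'I_N -> R) : logs T N :=
  [tuple [tuple ((Num.min (D t j) (b t j), b t j) : RR * RR) | j < N] | t < T].

Record archive_instance T N (r : R) (h p a : T.-tuple R)
    (b : 'I_T -> 'I_N -> R) (P : nat -> probability RR R) : Prop := {
  cost_gt0 : forall t : 'I_T, 0 < h`_t /\ 0 < p`_t;
  cost_norm : \big[Num.max/0]_(t < T) Num.max h`_t p`_t = 1;
  demand_supp : forall t : 'I_T, P t [set u | 0 <= u <= 1] = 1%E;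
  boundary_ge0 : forall t j, 0 <= b t j;
  cap_homo : forall s t : 'I_T, (s <= t)%N -> a`_s <= a`_t;
  cap_bound : forall t : 'I_T, 0 <= a`_t <= 1;
  cap_informative : forall t : 'I_T,
    ((p`_t / (h`_t + p`_t))%:E < P t [set u | (u < a`_t)%R])%E;
  cap_count : forall t : 'I_T,
    Num.ceil (r * N%:R) <= (#|[set j : 'I_N | a`_t <= b t j]%SET|)%:Z }.

(* N logs per period suffice: some learner, with private randomization drawn
   from a probability space (S, Q) of its choice, maps the costs, the caps and
   the logs to a feasible policy that is eps-optimal with probability at least
   3/4 for every instance and every realization (Omega, mu, D) of the latent
   demands.  For each (h, p, a), the learner is a family of probability kernels
   in (seed, logs, history) jointly; its output for given seed and logs is the
   section of that family. *)
Definition suffices (T : nat) (eps r : R) (N : nat) : Prop :=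
  exists (dS : measure_display) (S : measurableType dS) (Q : probability S R)
    (L : forall (h p a : T.-tuple R) (t : nat),
           R.-pker (S * logs T N * hist t) ~> RR),
    (forall h p a (s : S) (z : logs T N),
       feasible (fun t k => L h p a t (s, z, k))) /\
    forall (h p a : T.-tuple R) (b : 'I_T -> 'I_N -> R)
      (P : nat -> probability RR R),
    archive_instance r h p a b P ->
    forall (d : measure_display) (Omega : measurableType d)
      (mu : probability Omega R) (D : 'I_T -> 'I_N -> {RV mu >-> RR}),
    (forall t j A, measurable A -> distribution mu (D t j) A = P t A) ->
    mutually_independent mu (fun tj : 'I_T * 'I_N => D tj.1 tj.2) ->
    ((3 / 4)%:E <= (Q \x mu) [set sw : S * Omega |
       eps_optimal h p P eps
         (fun t k => L h p a t
            (sw.1, censor b (fun t j => D t j sw.2), k)) 0])%E.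

(* Least sufficient N >= 1, and +oo if there is none. *)
Definition Ncov (T : nat) (eps r : R) : \bar R :=
  ereal_inf [set N%:R%:E | N in [set N | (0 < N)%N /\ suffices T eps r N]].

Definition Mcov (T : nat) (eps r : R) : \bar R := (T%:R%:E * Ncov T eps r)%E.

End Model.

(* Main.v *)
From HB Require Import structures.
Require Import Defs.
From mathcomp Require Import ring lra zify measurable_realfun.

(* Upper bound.  The cost of a base-stock policy is a sum over units of stock of
   the marginal cost incurred by the unit until it is sold or replaced, so an
   optimal policy solves one optimal stopping problem per unit.  The learner
   discretizes demand, truncates the informative logs at the caps (the optimal
   levels lie below them) and plays the base-stock policy that is optimal for
   the empirical laws.  The regret of a unit is incurred only when the empirical
   policy orders it although its true marginal cost is positive; an exponential
   moment bound for empirical marginal costs, summed along the periods between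
   consecutive orders of the unit, bounds the total regret by a constant times
   T / sqrt (r N), and Markov's inequality concludes.

   Lower bound.  Odd periods have demand 1/2; in even periods the demand is 0 or
   1/2 with a bias of 32 eps / T towards an unknown side.  In each even period
   the policy has to guess the side, from ceil (r N) informative coin flips and a
   past that does not depend on it; by Assouad's pairing argument and a
   second-moment bound on likelihood ratios, r N has to be of order T^2 / eps^2. *)

Set Implicit Arguments.
Unset Strict Implicit.
Unset Printing Implicit Defensive.

Import Order.TTheory GRing.Theory Num.Theory.

Local Open Scope ring_scope.

(** * Marginal costs of units of stock *)

(** The rate does not involve the number $M$ of units: regret is bounded unit by unit and then
    averaged with the grid step $1/M$, so the grid may be arbitrarily fine. The obstacle is that a
    unit can stay unsold for many periods: its cost $C$ over $n$ periods ranges up to $n$, and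
    uniform concentration would lose powers of $T$. Since $C\in[-1,n]$, however, $C^2\le n(C+1)+1$,
    so the second moment is linear in $n$ when the mean is bounded. The error is then of order
    $n/\sqrt m$ and is charged to the $n$ periods until the unit is next ordered; such stretches are
    disjoint. When the mean is large, ordering the unit by mistake requires a sampled demand that
    reaches it. The probability of this carries the chance of reaching the unit as a factor, and
    this chance weighted by the positive part of the mean sums to at most $T$. The empirical policy
    depends on the data, but exponential moments are needed only for the fixed rule [copt] of the
    true law, because the empirical optimum dominates the empirical cost of that rule. *)

Section MarginalUnits.
Variables (R : realType) (M : nat) (h p : nat -> R).
Implicit Types (P : nat -> 'I_M.+1 -> R) (c : nat -> nat -> nat -> bool)
  (S : nat -> nat).

Definition pmf (I : finType) (q : I -> R) :=
  (forall i, 0 <= q i) /\ \sum_i q i = 1.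

Definition Ex (q : 'I_M.+1 -> R) (f : nat -> R) : R := \sum_d q d * f d.

Lemma eq_Ex q (f g : nat -> R) : (forall d, (d <= M)%N -> f d = g d) ->
  Ex q f = Ex q g.
Proof. by move=> fg; apply: eq_bigr => d _; rewrite fg // -ltnS. Qed.

Lemma ExD q (f g : nat -> R) : Ex q (fun d => f d + g d) = Ex q f + Ex q g.
Proof. by rewrite /Ex -big_split; apply: eq_bigr => d _; rewrite mulrDr. Qed.

Lemma ExB q (f g : nat -> R) : Ex q (fun d => f d - g d) = Ex q f - Ex q g.
Proof. by rewrite /Ex -sumrB; apply: eq_bigr => d _; rewrite mulrBr. Qed.

Lemma ExZ q a (f : nat -> R) : Ex q (fun d => a * f d) = a * Ex q f.
Proof. by rewrite /Ex mulr_sumr; apply: eq_bigr => d _; rewrite mulrCA. Qed.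

Lemma Ex_cst q a : pmf q -> Ex q (fun=> a) = a.
Proof. by case=> _ q1; rewrite /Ex -mulr_suml q1 mul1r. Qed.

Lemma le_Ex q (f g : nat -> R) : pmf q ->
  (forall d, (d <= M)%N -> f d <= g d) -> Ex q f <= Ex q g.
Proof.
by case=> q0 _ fg; apply: ler_sum => d _; rewrite ler_wpM2l// fg// -ltnS.
Qed.

(* Marginal cost of the [y]-th unit of stock in period [t], over [n] periods:
   it costs [h] while it is unsold and saves [p] when it is sold; [c] decides
   whether the unit, now at depth [y - d], is still in excess of the target
   level, otherwise it replaces a unit that would be ordered anyway. *)
Fixpoint gr c P n t y : R :=
  if n is n'.+1 then
    Ex (P t) (fun d => if (d < y)%N then
      h t + (if c n' t.+1 (y - d)%N then gr c P n' t.+1 (y - d)%N else 0)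
      else - p t)
  else 0.

(* An optimal stopping value: the least marginal cost over all rules [c]. *)
Fixpoint gq P n t y : R :=
  if n is n'.+1 then
    Ex (P t) (fun d => if (d < y)%N then
      h t + Num.max 0 (gq P n' t.+1 (y - d)%N) else - p t)
  else 0.

Lemma grS c P n t y : gr c P n.+1 t y = Ex (P t) (fun d => if (d < y)%N then
  h t + (if c n t.+1 (y - d)%N then gr c P n t.+1 (y - d)%N else 0) else - p t).
Proof. by []. Qed.

Lemma gqS P n t y : gq P n.+1 t y = Ex (P t) (fun d => if (d < y)%N then
  h t + Num.max 0 (gq P n t.+1 (y - d)%N) else - p t).
Proof. by []. Qed.

Definition copt P n t y := 0 < gq P n t y.

Lemma copt_max P n t y :
  (if copt P n t y then gq P n t y else 0) = Num.max 0 (gq P n t y).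
Proof. by rewrite /copt; case: ltP => [/ltW/max_r|/max_l]. Qed.

Lemma gr_copt P n t y : gr (copt P) P n t y = gq P n t y.
Proof.
elim: n t y => //= n IH t y; apply: eq_Ex => d _; case: ifP => // _.
by rewrite IH copt_max.
Qed.

Hypothesis h01 : forall t, 0 < h t <= 1.
Hypothesis p01 : forall t, 0 < p t <= 1.

Let h0 t : 0 < h t. Proof. by case/andP: (h01 t). Qed.
Let h1 t : h t <= 1. Proof. by case/andP: (h01 t). Qed.
Let p0 t : 0 < p t. Proof. by case/andP: (p01 t). Qed.
Let p1 t : p t <= 1. Proof. by case/andP: (p01 t). Qed.

(** At each step a rule either continues with [gr] or stops at value 0, and [gq] takes the larger of
    the two; by [gr_copt] the rule [copt] attains this bound. The comparison is used under the true
    law and under the empirical ones. *)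
Lemma gr_le_gq c P n t y : (forall t, pmf (P t)) -> gr c P n t y <= gq P n t y.
Proof.
move=> Pp; elim: n t y => //= n IH t y; apply: le_Ex => // d _.
case: ifP => // _; rewrite lerD2l; case: ifP => _; rewrite le_max ?lexx//.
by rewrite IH orbT.
Qed.

Lemma gr_le_n c P n t y : (forall t, pmf (P t)) -> gr c P n t y <= n%:R.
Proof.
move=> Pp; elim: n t y => //= n IH t y; rewrite -(Ex_cst n.+1%:R (Pp t)).
apply: le_Ex => // d _; rewrite -(natr1 n).
have := h1 t; have := p0 t; have := IH t.+1 (y - d)%N; have := ler0n R n.
by case: ifP => _; last lra; case: ifP => _; lra.
Qed.

Lemma gr_geN1 c P n t y : (forall t, pmf (P t)) ->
  (forall n' t' y', c n' t' y' -> 0 <= gr c P n' t' y') -> -1 <= gr c P n t y.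
Proof.
move=> Pp c0; case: n => [|n]; first by rewrite oppr_le0 ler01.
rewrite /= -(Ex_cst (-1) (Pp t)).
apply: le_Ex => // d _; have := h0 t; have := p1 t.
by case: ifP => _; last lra; case: ifP => [/c0|]; lra.
Qed.

Lemma gq_geN1 P n t y : (forall t, pmf (P t)) -> -1 <= gq P n t y.
Proof.
by move=> Pp; rewrite -gr_copt; apply: gr_geN1 => // *; rewrite gr_copt ltW.
Qed.

(** A deeper unit is sold no earlier, and while unsold it costs at least [h t > 0 > - p t]. Hence
    the units worth ordering form an initial segment. *)
Lemma gq_mono P n t y y' : (forall t, pmf (P t)) -> (y <= y')%N ->
  gq P n t y <= gq P n t y'.
Proof.
move=> Pp; elim: n t y y' => //= n IH t y y' yy'; apply: le_Ex => // d _.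
case: ifP => [dy|_].
  rewrite (leq_trans dy yy') lerD2l ge_max !le_max lexx /=.
  by rewrite IH ?orbT// leq_sub2r.
case: ifP => // _; have := h0 t; have := p0 t.
have : 0 <= Num.max 0 (gq P n t.+1 (y' - d)%N) by rewrite le_max lexx.
by lra.
Qed.

Lemma max_gq_monoS P n t y : (forall t, pmf (P t)) ->
  Num.max 0 (gq P n t y) <= Num.max 0 (gq P n.+1 t y).
Proof.
move=> Pp; elim: n t y => [|n IH] t y; first by rewrite maxxx le_max lexx.
rewrite ge_max !le_max lexx /=; apply/orP; right.
by apply: le_Ex => // d _; case: ifP => // _; rewrite lerD2l; exact: IH.
Qed.

Lemma max_gq_mono P n n' t y : (forall t, pmf (P t)) -> (n <= n')%N ->
  Num.max 0 (gq P n t y) <= Num.max 0 (gq P n' t y).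
Proof.
move=> Pp /subnK <-; elim: (n' - n)%N => // k IH.
by apply: (le_trans IH); rewrite addSn max_gq_monoS.
Qed.

(** This fails for [n = 0], where [gq] is 0 while one period may have negative cost; [max_gq_mono]
    avoids this by positive parts. *)
Lemma gq_mono_n P n n' t y : (forall t, pmf (P t)) -> (0 < n <= n')%N ->
  gq P n t y <= gq P n' t y.
Proof.
move=> Pp; case: n n' => [|n] [|n']; rewrite ?ltn0// ltnS => nn'.
apply: le_Ex => // d _; case: ifP => // _; rewrite lerD2l.
exact: max_gq_mono.
Qed.

(** In period [t + n] the unit has depth at most [y], so it is within the target and the rule has
    stopped it by then. The longer horizon [n'] is never reached, and [gq] over [n] periods
    dominates. Later [t + n] is the next period in which the empirical policy orders the unit. *)
Lemma gr_level_le_gq S P n n' t y : (forall t, pmf (P t)) ->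
  (0 < n <= n')%N -> (y <= S (t + n)%N)%N ->
  gr (fun _ s x => S s < x)%N P n' t y <= gq P n t y.
Proof.
move=> Pp; elim: n n' t y => // n IH [|n'] t y; rewrite ?ltn0//= ltnS.
move=> nn' yS; apply: le_Ex => // d _; case: ifP => // _; rewrite lerD2l.
case: ifP => [lt_S|_]; last by rewrite le_max lexx.
case: n => [|n] in IH nn' yS *.
  by rewrite addn1 in yS; move: (leq_ltn_trans yS lt_S); rewrite ltnNge leq_subr.
rewrite le_max IH ?orbT//= addSnnS.
by rewrite (leq_trans _ yS)// leq_subr.
Qed.

(** The continuation [Num.max 0 _] is nonnegative, so a positive one-period newsvendor derivative
    suffices. *)
Lemma gq_gt0 P n t y : (forall t, pmf (P t)) ->
  p t * Ex (P t) (fun d => (y <= d)%:R) < h t * Ex (P t) (fun d => (d < y)%:R) ->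
  0 < gq P n.+1 t y.
Proof.
move=> Pp; rewrite -subr_gt0 -!ExZ -ExB => /lt_le_trans; apply.
apply: le_Ex => // d _; case: (ltnP d y) => _.
  by rewrite mulr1 mulr0 subr0 lerDl le_max lexx.
by rewrite mulr0 mulr1 sub0r.
Qed.

Lemma gq_gtM P n t y : (forall t, pmf (P t)) -> (M < y)%N -> 0 < gq P n.+1 t y.
Proof.
move=> Pp My; apply: gq_gt0 => //.
rewrite (@eq_Ex _ _ (fun=> 0)) => [|d dM]; last by rewrite leqNgt (leq_ltn_trans dM).
rewrite (@eq_Ex _ (fun d => (d < y)%:R) (fun=> 1)) => [|d dM].
  by rewrite !Ex_cst// mulr0 mulr1.
by rewrite (leq_ltn_trans dM).
Qed.

Definition ucost t y d : R := h t * (y - d)%:R + p t * (d - y)%:R.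

(** Expected cost of the base-stock policy with levels [S] from stock [k]; in [Gv] the first
    post-order level is prescribed to be [y]. *)
Fixpoint Wv S P n t k : R :=
  if n is n'.+1 then
    Ex (P t) (fun d => ucost t (maxn k (S t)) d
                       + Wv S P n' t.+1 (maxn k (S t) - d)%N)
  else 0.

Definition Gv S P n t y : R :=
  Ex (P t) (fun d => ucost t y d + Wv S P n t.+1 (y - d)%N).

Lemma WvS S P n t k : Wv S P n.+1 t k = Gv S P n t (maxn k (S t)).
Proof. by []. Qed.

Let cS S := (fun _ s x => S s < x)%N : nat -> nat -> nat -> bool.

Lemma ucostB t y d :
  ucost t y.+1 d - ucost t y d = if (d < y.+1)%N then h t else - p t.
Proof.
rewrite /ucost; case: ltnP => dy.
  have -> : (d - y.+1)%N = 0%N by lia.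
  have -> : (d - y)%N = 0%N by lia.
  have -> : (y.+1 - d)%N = (y - d).+1 by lia.
  by rewrite -(natr1 (y - d)); ring.
have -> : (y - d)%N = 0%N by lia.
have -> : (y.+1 - d)%N = 0%N by lia.
have -> : (d - y)%N = (d - y.+1).+1 by lia.
by rewrite -(natr1 (d - y.+1)); ring.
Qed.

(** Discrete derivatives in the stock. Below the target an extra unit changes nothing, since the
    policy fills up to [S t] anyway; above it the unit is kept and its cost obeys the recursion of
    [gr]. *)
Lemma Wv_Gv_step S P n :
  (forall t k, Wv S P n t k.+1 - Wv S P n t k
     = if (S t < k.+1)%N then gr (cS S) P n t k.+1 else 0) /\
  (forall t y, Gv S P n t y.+1 - Gv S P n t y = gr (cS S) P n.+1 t y.+1).
Proof.
elim: n => [|n [IHW IHG]].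
  split=> [t k /=|t y]; first by rewrite subrr if_same.
  rewrite /Gv -ExB; apply: eq_Ex => d _; rewrite /= !addr0 ucostB if_same addr0.
  by [].
have stepW t k : Wv S P n.+1 t k.+1 - Wv S P n.+1 t k
     = if (S t < k.+1)%N then gr (cS S) P n.+1 t k.+1 else 0.
  rewrite !WvS; case: ltnP => Sk; last by rewrite !(maxn_idPr _) ?subrr// ltnW.
  by rewrite !(maxn_idPl _)// ltnW.
split=> // t y; rewrite /Gv -ExB; apply: eq_Ex => d _.
rewrite opprD addrACA ucostB; case: ltnP => dy; last first.
  have -> : (y.+1 - d)%N = 0%N by lia.
  have -> : (y - d)%N = 0%N by lia.
  by rewrite subrr addr0.
have -> : (y.+1 - d)%N = (y - d).+1 by lia.
by rewrite stepW.
Qed.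

Definition WvB S P n := (Wv_Gv_step S P n).1.
Definition GvB S P n := (Wv_Gv_step S P n).2.

Arguments gr : simpl never.
Arguments gq : simpl never.

Lemma Gv_sum S P n t y :
  Gv S P n t y = Gv S P n t 0 + \sum_(i < y) gr (cS S) P n.+1 t i.+1.
Proof.
elim: y => [|y IH]; first by rewrite big_ord0 addr0.
by rewrite big_ord_recr /= addrA -IH -GvB addrC subrK.
Qed.

(** From empty stock, filling up to [S t] adds the marginal costs of the first [S t] units to the
    cost of ordering nothing, which is [p t] times the mean demand followed by a restart from empty
    stock. Mean demands do not depend on [S] and cancel when two policies are compared under one
    law. *)
Lemma Wv_eq_sum_gr S P n t : (forall t, pmf (P t)) -> (forall t, S t <= M)%N ->
  Wv S P n t 0 = \sum_(i < n) p (t + i)%N * Ex (P (t + i)%N) (fun d => d%:R)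
    + \sum_(y < M) \sum_(i < n | (y < S (t + i))%N)
        gr (cS S) P (n - i) (t + i) y.+1.
Proof.
move=> Pp SM; elim: n t => [|n IH] t.
  by rewrite big_ord0 big1 ?addr0// => y _; rewrite big_ord0.
rewrite WvS max0n Gv_sum.
have -> : Gv S P n t 0 = p t * Ex (P t) (fun d => d%:R) + Wv S P n t.+1 0.
  rewrite /Gv ExD -ExZ -[X in _ = _ + X](Ex_cst _ (Pp t)).
  congr (_ + _); apply: eq_Ex => d _.
  by rewrite /= /ucost sub0n mulr0 add0r subn0.
rewrite IH big_ord_recl addn0 -!addrA; congr (_ + _).
under eq_bigr do rewrite addSnnS; congr (_ + _).
rewrite addrC (big_ord_widen M (fun i => gr (cS S) P n.+1 t i.+1))// big_mkcond.
rewrite -big_split /=; apply: eq_bigr => y _.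
rewrite [RHS]big_mkcond big_ord_recl /= subn0 addn0; congr (_ + _).
by rewrite [LHS]big_mkcond; apply: eq_bigr => i _; rewrite subSS addSnnS.
Qed.

Variable T : nat.

(** The optimal base-stock level: by [gq_mono] the units of nonpositive marginal cost form an
    initial segment, whose length is counted here. *)
Definition level P t : nat := (\sum_(y < M) (gq P (T - t) t y.+1 <= 0)%R)%N.

Lemma level_le P t : (level P t <= M)%N.
Proof.
rewrite /level; apply: (@leq_trans (\sum_(y < M) 1)%N).
  by apply: leq_sum => y _; case: (_ <= _).
by rewrite sum1_card card_ord.
Qed.

Lemma sum_prefix (m : nat) (b : nat -> bool) y :
  (forall i j, (i <= j)%N -> b j -> b i) -> (y < m)%N ->
  (y < \sum_(i < m) b i)%N = b y.
Proof.
move=> bmono ym; apply/idP/idP => [|by1].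
  apply: contraTT => by_.
  rewrite -leqNgt -(subnK (ltnW ym)) addnC big_split_ord /=.
  rewrite [X in (_ + X)%N]big1 => [|i _]; last first.
    by apply/eqP; rewrite eqb0; apply: contra by_; apply: bmono; lia.
  rewrite addn0 -[leqRHS](card_ord y) -sum1_card.
  by apply: leq_sum => i _; case: (b _).
rewrite -(subnK ym) addnC big_split_ord /=.
apply: (@leq_trans (\sum_(i < y.+1) b i)%N); last exact: leq_addr.
rewrite (eq_bigr (fun=> 1%N)) => [|i _]; first by rewrite sum1_card card_ord.
by rewrite (bmono _ y) // -ltnS.
Qed.

Lemma level_ltn P t y : (forall t, pmf (P t)) -> (t < T)%N ->
  (level P t < y.+1)%N = (0 < gq P (T - t) t y.+1).
Proof.
move=> Pp tT; case: (ltnP y M) => yM; last first.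
  rewrite ltnS (leq_trans (level_le _ _) yM).
  by rewrite -(subnSK tT) gq_gtM.
rewrite ltNge ltnNge; congr negb.
apply: (@sum_prefix M (fun i => gq P (T - t) t i.+1 <= 0)) => // i j ij.
by apply: le_trans; exact: gq_mono.
Qed.

Lemma gr_level P n t y : (forall t, pmf (P t)) -> (n + t = T)%N ->
  gr (cS (level P)) P n t y = gq P n t y.
Proof.
move=> Pp; elim: n t y => // n IH t y ntT; rewrite grS gqS; apply: eq_Ex => d _.
case: ifP => // dy; rewrite -copt_max /copt; congr (_ + _).
have ->: (y - d = (y - d).-1.+1)%N by lia.
(* With no period left, continuing and stopping are both worth 0, so the level of period [T] is
   irrelevant. *)
case: n => [|n] in IH ntT *; first by rewrite /= ltxx if_same.
have tT : (t.+1 < T)%N by lia.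
rewrite {1}/cS level_ltn// (_ : (T - t.+1 = n.+1)%N); last by lia.
by rewrite IH//; lia.
Qed.

Section OptimalLevels.
Variable P : nat -> 'I_M.+1 -> R.
Hypothesis Pp : forall t, pmf (P t).
Let L := level P.

Lemma Wv_level_mono n t k k' : (n + t = T)%N -> (k <= k')%N ->
  Wv L P n t k <= Wv L P n t k'.
Proof.
move=> ntT /subnK <-; elim: (k' - k)%N => // j IH; apply: (le_trans IH).
rewrite addSn -subr_ge0 WvB; case: n => [|n] in IH ntT *; first by rewrite /= if_same.
rewrite gr_level// level_ltn//; last by lia.
by rewrite (_ : (T - t = n.+1)%N); [case: ifP => // /ltW|lia].
Qed.

Lemma Gv_level_le n t y y' : (n.+1 + t = T)%N -> (y' <= y <= L t)%N ->
  Gv L P n t y <= Gv L P n t y'.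
Proof.
move=> ntT /andP[/subnK <-]; elim: (y - y')%N => // j IH jL.
rewrite (le_trans _ (IH _))//; last exact: ltnW.
rewrite -subr_le0 addSn GvB gr_level// leNgt.
rewrite (_ : (n.+1 = T - t)%N); last by lia.
by rewrite -level_ltn// -?leqNgt//; lia.
Qed.

Lemma Gv_level_ge n t y y' : (n.+1 + t = T)%N -> (L t <= y <= y')%N ->
  Gv L P n t y <= Gv L P n t y'.
Proof.
move=> ntT /andP[Ly /subnK <-]; elim: (y' - y)%N => // j IH.
rewrite (le_trans IH)// -subr_ge0 addSn GvB gr_level// ltW//.
rewrite (_ : (n.+1 = T - t)%N); last by lia.
by rewrite -level_ltn//; rewrite -/L; lia.
Qed.

(** [Gv] decreases up to [L t] and increases afterwards, so the best post-order level above [k] is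
    [maxn k (L t)]. *)
Lemma Wv_level_le_Gv n t k y : (n.+1 + t = T)%N -> (k <= y)%N ->
  Wv L P n.+1 t k <= Gv L P n t y.
Proof.
move=> ntT ky; rewrite WvS; case: (leqP (L t) y) => Ly.
  by apply: Gv_level_ge => //; rewrite leq_maxr geq_max ky Ly.
have kL : (k <= L t)%N by lia.
by rewrite (maxn_idPr kL); apply: Gv_level_le => //; rewrite leqnn ltnW.
Qed.

Lemma Wv_level_opt S n t k : (n + t = T)%N -> Wv L P n t k <= Wv S P n t k.
Proof.
elim: n t k => // n IH t k ntT; rewrite [leRHS]WvS.
apply: (le_trans (Wv_level_le_Gv ntT (leq_maxl k (S t)))).
by apply: le_Ex => // d _; rewrite lerD2l IH//; lia.
Qed.

End OptimalLevels.

End MarginalUnits.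

Arguments gr : simpl never.
Arguments gq : simpl never.
Arguments Wv : simpl never.

(** * Empirical laws *)

Section ProductWeight.
Variables (R : realType) (I V : finType).
Implicit Types (w : I -> V -> R) (x : {ffun I -> V}).

Definition pw w x : R := \prod_i w i (x i).
Definition EE w (f : {ffun I -> V} -> R) : R := \sum_x pw w x * f x.
Definition upd x i v : {ffun I -> V} := [ffun k => if k == i then v else x k].
Definition updw w i (u : V -> R) : I -> V -> R :=
  fun k => if k == i then u else w k.

Lemma pw_ge0 w x : (forall i, pmf (w i)) -> 0 <= pw w x.
Proof. by move=> wp; apply: prodr_ge0 => i _; case: (wp i). Qed.

Lemma eq_EE w f g : f =1 g -> EE w f = EE w g.
Proof. by move=> fg; apply: eq_bigr => x _; rewrite fg. Qed.

Lemma le_EE w f g : (forall i, pmf (w i)) -> (forall x, f x <= g x) ->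
  EE w f <= EE w g.
Proof. by move=> wp fg; apply: ler_sum => x _; rewrite ler_wpM2l ?pw_ge0. Qed.

Lemma EED w f g : EE w (fun x => f x + g x) = EE w f + EE w g.
Proof. by rewrite /EE -big_split; apply: eq_bigr => x _; rewrite mulrDr. Qed.

Lemma EEB w f g : EE w (fun x => f x - g x) = EE w f - EE w g.
Proof. by rewrite /EE -sumrB; apply: eq_bigr => x _; rewrite mulrBr. Qed.

Lemma EEZ w a f : EE w (fun x => a * f x) = a * EE w f.
Proof. by rewrite /EE mulr_sumr; apply: eq_bigr => x _; rewrite mulrCA. Qed.

Lemma EE_sum (J : Type) (r : seq J) (Q : pred J) w (f : J -> {ffun I -> V} -> R) :
  EE w (fun x => \sum_(j <- r | Q j) f j x) = \sum_(j <- r | Q j) EE w (f j).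
Proof.
rewrite /EE exchange_big /=; apply: eq_bigr => x _.
by rewrite mulr_sumr.
Qed.

Lemma EE_prod w (phi : I -> V -> R) :
  EE w (fun x => \prod_i phi i (x i)) = \prod_i \sum_v w i v * phi i v.
Proof.
rewrite bigA_distr_bigA /=; apply: eq_bigr => x _.
by rewrite /pw -big_split.
Qed.

Lemma EE_cst w a : (forall i, pmf (w i)) -> EE w (fun=> a) = a.
Proof.
move=> wp; have := EE_prod w (fun _ _ => 1).
rewrite [RHS]big1 => [|i _]; last by rewrite -mulr_suml (wp i).2 mul1r.
under eq_EE do rewrite big1_eq.
by move=> E1; rewrite -[RHS]mulr1 -E1 -EEZ; under [RHS]eq_EE do rewrite mulr1.
Qed.

Lemma pw_pmf w : (forall i, pmf (w i)) -> pmf (pw w).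
Proof.
move=> wp; split=> [x|]; first exact: pw_ge0.
by have := EE_cst 1 wp; rewrite /EE => <-; under [RHS]eq_bigr do rewrite mulr1.
Qed.

Lemma upd_same x i v : upd x i v i = v.
Proof. by rewrite ffunE eqxx. Qed.

Lemma upd_other x i v k : k != i -> upd x i v k = x k.
Proof. by rewrite ffunE => /negbTE ->. Qed.

(* Integrating out the [i]-th coordinate; the identity is a change of variables
   exchanging [x i] and [v]. *)
Lemma EE_upd w i u f : \sum_v w i v = 1 ->
  EE w (fun x => \sum_v u v * f (upd x i v)) = EE (updw w i u) f.
Proof.
move=> wi1; rewrite /EE.
under eq_bigr do rewrite mulr_sumr.
rewrite (pair_bigA _ (fun x v => pw w x * (u v * f (upd x i v)))) /=.
pose sw (z : {ffun I -> V} * V) := (upd z.1 i z.2, z.1 i).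
have swK : involutive sw.
  move=> [x v]; rewrite /sw /= upd_same; congr (_, _).
  by apply/ffunP => k; rewrite !ffunE; case: eqP => // ->.
rewrite (reindex_inj (inv_inj swK)) /=.
transitivity (\sum_x \sum_v pw (updw w i u) x * f x * w i v); last first.
  by apply: eq_bigr => x _; rewrite -mulr_sumr wi1 mulr1.
rewrite [RHS](pair_bigA _ (fun x v => pw (updw w i u) x * f x * w i v)).
apply: eq_bigr => -[x v] _ /=.
rewrite [X in f X](_ : _ = x); last first.
  by apply/ffunP => k; rewrite !ffunE; case: eqP => // ->.
rewrite /pw (bigD1 i)//= [in RHS](bigD1 i)//= upd_same /updw eqxx.
rewrite (eq_bigr (fun k => w k (x k))); last first.
  by move=> k ki; rewrite upd_other.
rewrite [in RHS](eq_bigr (fun k => w k (x k))); first by ring.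
by move=> k /negbTE ->.
Qed.

Lemma EE_resample w i f : pmf (w i) ->
  EE w (fun x => \sum_v w i v * f (upd x i v)) = EE w f.
Proof.
move=> [_ wi1]; rewrite EE_upd//; apply: eq_bigr => x _; congr (_ * _).
by apply: eq_bigr => k _; rewrite /updw; case: eqP => // ->.
Qed.

Lemma EE_updw w i u f : pmf (w i) -> \sum_v u v = 1 ->
  (forall x v, f (upd x i v) = f x) -> EE (updw w i u) f = EE w f.
Proof.
move=> [_ wi1] u1 fi; rewrite -EE_upd//; apply: eq_EE => x.
by under eq_bigr do rewrite fi; rewrite -mulr_suml u1 mul1r.
Qed.

End ProductWeight.

Lemma jensen_expn (R : realType) (I : finType) (q f : I -> R) (m : nat) :
  pmf q -> (forall i, 0 <= f i) ->
  (\sum_i q i * f i) ^+ m <= \sum_i q i * f i ^+ m.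
Proof.
move=> [q0 q1] f0; case: m => [|m].
  by rewrite expr0; under eq_bigr do rewrite expr0 mulr1; rewrite q1.
set a := \sum_i _; have a0 : 0 <= a by apply: sumr_ge0 => i _; rewrite mulr_ge0.
(* tangent line of x ^+ m.+1 at the mean a *)
have tangent x : 0 <= x -> a ^+ m.+1 + m.+1%:R * a ^+ m * (x - a) <= x ^+ m.+1.
  move=> x0; elim: m => [|k IH]; first by rewrite !expr1 expr0; lra.
  have {IH} := ler_wpM2l x0 IH; rewrite -exprS => /(le_trans _); apply.
  have -> : x * (a ^+ k.+1 + k.+1%:R * a ^+ k * (x - a)) =
     a ^+ k.+2 + k.+2%:R * a ^+ k.+1 * (x - a)
     + k.+1%:R * a ^+ k * (x - a) ^+ 2.
    by rewrite -(natr1 k.+1) !exprS; ring.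
  by rewrite lerDl mulr_ge0 ?sqr_ge0// mulr_ge0// exprn_ge0.
rewrite (le_trans _ (ler_sum _ (fun i _ => ler_wpM2l (q0 i) (tangent _ (f0 i)))))//.
under eq_bigr do rewrite mulrDr mulrBr mulrBr.
rewrite big_split sumrB /= -mulr_suml q1 mul1r -mulr_suml q1 mul1r.
under eq_bigr do rewrite mulrCA.
by rewrite -mulr_sumr subrr addr0.
Qed.

(** * Empirical marginal costs and their exponential moments *)

Section EmpiricalModel.
Variables (R : realType) (M N T' m : nat) (h p : nat -> R).
Variables (P : nat -> 'I_M.+1 -> R) (I : nat -> {set 'I_N}).
Let T := T'.+1.
Hypothesis h01 : forall t, 0 < h t <= 1.
Hypothesis p01 : forall t, 0 < p t <= 1.
Hypothesis Pp : forall t, pmf (P t).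
Hypothesis m_gt0 : (0 < m)%N.
Hypothesis Im : forall t, #|I t| = m.

Definition sample := {ffun 'I_N -> 'I_M.+1}.
Definition data := {ffun 'I_T -> sample}.
Implicit Types (x : data) (c : nat -> nat -> nat -> bool).

Definition sw (t : nat) : sample -> R := pw (fun=> P t).
Definition dw (i : 'I_T) : sample -> R := sw i.

Lemma sw_pmf t : pmf (sw t). Proof. exact: pw_pmf. Qed.

Lemma dw_pmf (i : 'I_T) : pmf (dw i). Proof. exact: sw_pmf. Qed.

Definition Phat x (t : nat) (d : 'I_M.+1) : R :=
  m%:R^-1 * \sum_(j in I t) (x (inord t) j == d)%:R.

Lemma m_neq0 : m%:R != 0 :> R. Proof. by rewrite pnatr_eq0 -lt0n. Qed.

Lemma Ex_Phat x t f :
  Ex (Phat x t) f = m%:R^-1 * \sum_(j in I t) f (x (inord t) j).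
Proof.
rewrite /Ex; under eq_bigr do rewrite -mulrA mulr_suml.
rewrite -mulr_sumr exchange_big /=; congr (_ * _); apply: eq_bigr => j _.
rewrite (bigD1 (x (inord t) j))//= eqxx mul1r big1 ?addr0// => d dx.
by rewrite eq_sym (negbTE dx) mul0r.
Qed.

Lemma Phat_pmf x t : pmf (Phat x t).
Proof.
split=> [d|]; first by rewrite mulr_ge0 ?invr_ge0// sumr_ge0.
have := Ex_Phat x t (fun=> 1); rewrite /Ex; under eq_bigr do rewrite mulr1.
by move=> ->; rewrite sumr_const Im mulVf// m_neq0.
Qed.

Lemma Phat_upd x (i : 'I_T) xi t : (t < T)%N -> t != i ->
  Phat (upd x i xi) t = Phat x t.
Proof.
move=> tT ti; apply/funext => d; rewrite /Phat upd_other//.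
by apply: contra ti => /eqP <-; rewrite inordK.
Qed.

Lemma gr_upd c x (i : 'I_T) xi n t y : (n + t <= T)%N -> (i < t)%N ->
  gr h p c (Phat (upd x i xi)) n t y = gr h p c (Phat x) n t y.
Proof.
elim: n t y => // n IH t y ntT it; rewrite !grS Phat_upd; try lia.
by apply: eq_Ex => d _; rewrite !IH//; lia.
Qed.

(* The contribution of a demand [d] in period [t] to the empirical marginal
   cost of unit [y]. *)
Let psi c x n t y (d : nat) : R := if (d < y)%N then
  h t + (if c n t.+1 (y - d)%N then gr h p c (Phat x) n t.+1 (y - d)%N else 0)
  else - p t.

Lemma psi_upd c x n t y d xi (i : 'I_T) : (n + t.+1 <= T)%N -> (i < t.+1)%N ->
  psi c (upd x i xi) n t y d = psi c x n t y d.
Proof. by move=> nT it; rewrite /psi !gr_upd. Qed.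

Lemma grE c x n t y :
  gr h p c (Phat x) n.+1 t y =
  m%:R^-1 * \sum_(j in I t) psi c x n t y (x (inord t) j).
Proof. by rewrite grS Ex_Phat. Qed.

Lemma gr_upd_same c x n t y xi : (n.+1 + t <= T)%N ->
  gr h p c (Phat (upd x (inord t) xi)) n.+1 t y =
  m%:R^-1 * \sum_(j in I t) psi c x n t y (xi j).
Proof.
move=> nT; rewrite grE upd_same; congr (_ * _); apply: eq_bigr => j _.
by rewrite psi_upd// ?inordK//; lia.
Qed.

Lemma EE_period t (F : data -> R) : (t < T)%N ->
  EE dw F = EE dw (fun x => \sum_xi sw t xi * F (upd x (inord t) xi)).
Proof.
move=> tT; rewrite -(EE_resample (i := inord t) F (dw_pmf _)).
by rewrite /dw inordK.
Qed.

Lemma sum_sw_coord t j (f : 'I_M.+1 -> R) :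
  \sum_xi sw t xi * f (xi j) = \sum_d P t d * f d.
Proof.
transitivity (EE (fun=> P t) (fun xi : sample =>
    \prod_k (if k == j then f (xi k) else 1))).
  apply: eq_bigr => xi _; rewrite (bigD1 j)//= eqxx big1 ?mulr1//.
  by move=> k /negbTE ->.
rewrite (EE_prod (fun=> P t) (fun k d => if k == j then f d else 1)).
rewrite (bigD1 j)//= [X in _ * X]big1 ?mulr1 => [|k /negbTE kj].
  by rewrite eqxx.
by rewrite kj -mulr_suml (Pp t).2 mul1r.
Qed.

(** For a fixed rule the empirical marginal cost is unbiased: [psi] in period [t] involves the
    samples of later periods only, so expectations can be taken one period at a time along the
    recursion. *)
Lemma EE_gr c n t y : (n + t <= T)%N ->
  EE dw (fun x => gr h p c (Phat x) n t y) = gr h p c P n t y.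
Proof.
elim: n t y => [|n IH] t y ntT; first exact: EE_cst dw_pmf.
rewrite (@EE_period t)//; last by lia.
under eq_EE => x.
  under eq_bigr do rewrite gr_upd_same// mulrCA mulr_sumr.
  rewrite -mulr_sumr exchange_big /=.
  under eq_bigr do rewrite (sum_sw_coord t _ (fun d => psi c x n t y d)).
  rewrite sumr_const Im -[X in _ * X]mulr_natl mulrA mulVf ?m_neq0// mul1r.
  over.
rewrite EE_sum grS; apply: eq_bigr => d _; rewrite EEZ; congr (_ * _).
rewrite /psi; case: ifP => _; last exact: EE_cst dw_pmf.
rewrite EED EE_cst; last exact: dw_pmf.
congr (_ + _); case: ifP => _; last exact: EE_cst dw_pmf.
by rewrite IH//; lia.
Qed.

(** The exponential moment $\mathbb E\exp(-lC)$ of the random cost $C$ of a unit under the true law,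
    each unsold period adding [h], the sale adding [- p], and [c] deciding when to stop. *)
Fixpoint mgf c (l : R) n t y : R :=
  if n is n'.+1 then
    Ex (P t) (fun d => if (d < y)%N then
      expR (- (l * h t)) * (if c n' t.+1 (y - d)%N then mgf c l n' t.+1 (y - d)%N
                          else 1)
      else expR (l * p t))
  else 1.

Lemma mgf_gt0 c l n t y : 0 < mgf c l n t y.
Proof.
elim: n t y => // n IH t y /=; rewrite lt_neqAle eq_sym; apply/andP; split.
  apply/eqP => Q0; have [P0 P1] := Pp t.
  have : \sum_d P t d = 0.
    apply: big1 => d _; move/eqP: Q0; rewrite /Ex psumr_eq0 => [/allP|d' _].
      move=> /(_ d); rewrite mem_index_enum => /(_ isT) /=; rewrite mulf_eq0.
      case/orP => /eqP //; case: ifP => _ /eqP; last by rewrite gt_eqF ?expR_gt0.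
      by rewrite gt_eqF// mulr_gt0 ?expR_gt0//; case: ifP.
    rewrite mulr_ge0//; case: ifP => _; rewrite ?expR_ge0// mulr_ge0 ?expR_ge0//.
    by case: ifP => // _; exact: ltW.
  by rewrite P1 => /eqP; rewrite oner_eq0.
rewrite -(Ex_cst 0 (Pp t)); apply: le_Ex => // d _.
case: ifP => _; rewrite ?expR_ge0// mulr_ge0 ?expR_ge0//.
by case: ifP => // _; exact: ltW.
Qed.

(* The conditional expectation of [expR (- (l * psi))] given the later
   periods. *)
Let Q c l x n t y : R := Ex (P t) (fun d => expR (- (l * psi c x n t y d))).

Lemma expR_gr c l x n t y xi : (n.+1 + t <= T)%N ->
  expR (- (m%:R * l * gr h p c (Phat (upd x (inord t) xi)) n.+1 t y)) =
  \prod_j (if j \in I t then expR (- (l * psi c x n t y (xi j))) else 1).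
Proof.
move=> ntT; rewrite gr_upd_same//; set X := (X in _^-1 * X).
have -> : m%:R * l * (m%:R^-1 * X) = l * X by have := m_neq0; move=> ?; field.
by rewrite mulr_sumr -sumrN expR_sum big_mkcond.
Qed.

Lemma EE_expR_gr c l n t y : (n.+1 + t <= T)%N ->
  EE dw (fun x => expR (- (m%:R * l * gr h p c (Phat x) n.+1 t y))) =
  EE dw (fun x => Q c l x n t y ^+ m).
Proof.
move=> ntT; rewrite (@EE_period t)//; last by lia.
apply: eq_EE => x; under eq_bigr do rewrite expR_gr//.
rewrite [LHS](EE_prod (fun=> P t) (fun j d =>
  if j \in I t then expR (- (l * psi c x n t y d)) else 1)).
rewrite (bigID (mem (I t)))/= [X in _ * X]big1 ?mulr1 => [|j /negbTE ->]; last first.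
  by rewrite -mulr_suml (Pp t).2 mul1r.
rewrite (eq_bigr (fun=> Q c l x n t y)) => [|j ->//].
by rewrite prodr_const Im.
Qed.

(** Jensen's inequality under the law of the demand tilted by the weights [K]: with respect to it
    [Q] is [B] times the average of the ratios [e]. The power [m] moves inside this average, and the
    induction hypothesis bounds the mean of each [e ^+ m] by 1. *)
Lemma EE_Q_le c l n t y : (n.+1 + t <= T)%N ->
  (forall y, EE dw (fun x => expR (- (m%:R * l * gr h p c (Phat x) n t.+1 y)))
     <= mgf c l n t.+1 y ^+ m) ->
  EE dw (fun x => Q c l x n t y ^+ m) <= mgf c l n.+1 t y ^+ m.
Proof.
move=> ntT IH; set B := mgf c l n.+1 t y; have B0 : 0 < B := mgf_gt0 _ _ _ _ _.
pose K (d : nat) : R := if (d < y)%N then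
  expR (- (l * h t)) * (if c n t.+1 (y - d)%N then mgf c l n t.+1 (y - d)%N
                        else 1) else expR (l * p t).
have K0 d : 0 < K d.
  rewrite /K; case: ifP => _; rewrite ?mulr_gt0 ?expR_gt0//.
  by case: ifP => // _; exact: mgf_gt0.
pose q (d : 'I_M.+1) := P t d * K d / B.
have qp : pmf q.
  split=> [d|]; last by rewrite -mulr_suml divff// gt_eqF.
  by rewrite divr_ge0 ?mulr_ge0 ?(ltW (K0 _)) ?(ltW B0)//; case: (Pp t).
pose e x (d : 'I_M.+1) := expR (- (l * psi c x n t y d)) / K d.
apply: (@le_trans _ _ (EE dw (fun x => B ^+ m * \sum_d q d * e x d ^+ m))).
  apply: le_EE => [|x]; first exact: dw_pmf.
  have -> : Q c l x n t y = B * \sum_d q d * e x d.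
    rewrite mulr_sumr; apply: eq_bigr => d _; rewrite /q /e.
    have := gt_eqF B0; have := gt_eqF (K0 d) => Kd Bd.
    by field; rewrite Kd Bd.
  rewrite exprMn; apply: ler_wpM2l; first by rewrite exprn_ge0// ltW.
  apply: jensen_expn => // d.
  by rewrite divr_ge0 ?expR_ge0// ltW.
rewrite EEZ EE_sum ler_piMr ?exprn_ge0 ?(ltW B0)//.
rewrite -[leRHS](qp.2); apply: ler_sum => d _; rewrite EEZ.
rewrite ler_piMr ?qp.1// /e.
under eq_EE do rewrite expr_div_n mulrC.
rewrite EEZ mulrC ler_pdivrMr ?exprn_gt0// mul1r.
under eq_EE do rewrite -expRM_natl mulrN mulrA.
rewrite /psi /K; case: ifP => dy; last first.
  by rewrite EE_cst; [rewrite -expRM_natl mulrN opprK mulrA|exact: dw_pmf].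
case: ifP => cy; last first.
  by rewrite EE_cst; [rewrite mulr1 -expRM_natl mulrN mulrA addr0|exact: dw_pmf].
under eq_EE do rewrite mulrDr opprD expRD.
by rewrite EEZ exprMn -expRM_natl mulrN mulrA ler_wpM2l ?expR_ge0.
Qed.

(** The empirical cost multiplies averages of different periods, yet its lower tail is controlled as
    if it were the mean of [m] independent copies of the random cost of the unit. *)
Lemma EE_expR_gr_le c l n t y : (n + t <= T)%N ->
  EE dw (fun x => expR (- (m%:R * l * gr h p c (Phat x) n t y)))
    <= mgf c l n t y ^+ m.
Proof.
elim: n t y => [|n IH] t y ntT.
  under eq_EE do rewrite /gr mulr0 oppr0 expR0.
  by rewrite EE_cst ?expr1n//; exact: dw_pmf.
by rewrite EE_expR_gr// EE_Q_le// => y'; apply: IH; lia.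
Qed.

(** A sample that reaches the unit contributes [expR (l * p t)] times the probability of reaching
    it, in place of one of the [m] factors [Q]. As [psi] is at most [n.+1], the condition on [l]
    gives [Q >= 1 / 2], and restoring the missing factor costs at most 2. *)
Lemma EE_reach_expR_gr_le c l n t y : (n.+1 + t <= T)%N -> 0 <= l <= 1 ->
  l * n.+1%:R <= 2^-1 ->
  EE dw (fun x => (\sum_(j in I t) (y <= x (inord t) j)%N%:R) *
                  expR (- (m%:R * l * gr h p c (Phat x) n.+1 t y)))
    <= 2 * expR 1 * m%:R * Ex (P t) (fun d => (y <= d)%N%:R)
       * mgf c l n.+1 t y ^+ m.
Proof.
move=> ntT /andP[l0 l1] ln; have tT : (t < T)%N by lia.
set kap := Ex _ _.
have kap0 : 0 <= kap.
  by rewrite -(Ex_cst 0 (Pp t)); apply: le_Ex.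
have Qge x : 2^-1 <= Q c l x n t y.
  rewrite -(Ex_cst 2^-1 (Pp t)); apply: le_Ex => // d _.
  apply: le_trans (expR_ge1Dx _).
  suff : l * psi c x n t y d <= l * n.+1%:R by lra.
  apply: ler_wpM2l => //; rewrite /psi -(natr1 n).
  have := h01 t; have := p01 t; have := ler0n R n.
  case: ifP => _; last by lra.
  case: ifP => _; last by lra.
  have := @gr_le_n _ _ h p h01 p01 c (Phat x) n t.+1 (y - d)%N (Phat_pmf x).
  by lra.
rewrite (@EE_period t)//.
apply: (@le_trans _ _ (EE dw (fun x =>
   2 * expR 1 * m%:R * kap * Q c l x n t y ^+ m))); last first.
  rewrite EEZ; apply: ler_wpM2l; first by rewrite !mulr_ge0// expR_ge0.
  by apply: EE_Q_le => // y'; apply: EE_expR_gr_le; lia.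
apply: le_EE => [|x]; first exact: dw_pmf.
have Q0 : 0 < Q c l x n t y by apply: lt_le_trans (Qge x).
under eq_bigr do rewrite upd_same expR_gr// mulr_suml mulr_sumr.
rewrite exchange_big /=.
suff HJ j : j \in I t -> \sum_xi sw t xi * ((y <= xi j)%N%:R *
    \prod_k (if k \in I t then expR (- (l * psi c x n t y (xi k))) else 1))
    <= 2 * expR 1 * kap * Q c l x n t y ^+ m.
  rewrite (le_trans (ler_sum _ HJ))// sumr_const Im -[leLHS]mulr_natl.
  by rewrite le_eqVlt; apply/orP; left; apply/eqP; ring.
move=> jI.
pose phi k (d : 'I_M.+1) := (if k == j then (y <= d)%N%:R else 1) *
  (if k \in I t then expR (- (l * psi c x n t y d)) else 1).
rewrite (eq_bigr (fun xi : sample => sw t xi * \prod_k phi k (xi k))); last first.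
  move=> xi _; congr (_ * _); rewrite /phi big_split /=; congr (_ * _).
  rewrite (bigD1 j)//= eqxx big1 ?mulr1// => k /negbTE -> //.
rewrite [leLHS](EE_prod (fun=> P t) phi) (bigD1 j)//= /phi eqxx jI.
have -> : \sum_d P t d * ((y <= d)%N%:R * expR (- (l * psi c x n t y d)))
    = expR (l * p t) * kap.
  rewrite -ExZ; apply: eq_bigr => d _; congr (_ * _).
  rewrite /psi ltnNge; case: leqP => yd; rewrite /= ?mul0r ?mulr0 ?mul1r ?mulr1//.
  by rewrite mulrN opprK.
rewrite (bigID (mem (I t)))/= [X in _ * (_ * X)]big1 ?mulr1; last first.
  move=> k /andP[/negbTE -> /negbTE ->]; rewrite mul1r -mulr_suml (Pp t).2.
  by rewrite mul1r.
rewrite (eq_bigr (fun=> Q c l x n t y)) => [|k /andP[/negbTE -> ->]]; last first.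
  by apply: eq_bigr => d _; rewrite mul1r.
rewrite prodr_const (_ : #|_| = m.-1); last first.
  rewrite -(Im t) (cardD1 j) jI /=; apply: eq_card => k.
  by rewrite !inE unfold_in /=.
rewrite -{2}(prednK m_gt0) exprS.
have Qm0 : 0 <= Q c l x n t y ^+ m.-1 by rewrite exprn_ge0// ltW.
have e1 : expR (l * p t) <= expR 1.
  rewrite ler_expR; have /andP[/ltW p0 p1] := p01 t.
  by rewrite -[leRHS]mulr1 ler_pM.
have -> : 2 * expR 1 * kap * (Q c l x n t y * Q c l x n t y ^+ m.-1) =
  (expR 1 * kap * Q c l x n t y ^+ m.-1) * (2 * Q c l x n t y) by ring.
apply: (@le_trans _ _ (expR 1 * kap * Q c l x n t y ^+ m.-1)).
  by rewrite ler_wpM2r// ler_wpM2r.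
rewrite ler_peMr ?mulr_ge0 ?expR_ge0//.
by have := Qge x; lra.
Qed.

End EmpiricalModel.

(** * Regret of the empirically optimal policy *)

Section ExpBounds.
Variable R : realType.
Implicit Type x : R.

Lemma expRN_le_quad x : 0 <= x -> expR (- x) <= 1 - x + x ^+ 2.
Proof.
move=> x0; rewrite expRN invf_ple ?posrE ?expR_gt0//; last by nra.
apply: le_trans (expR_ge1Dx x); rewrite -[leLHS]mul1r ler_pdivrMr; nra.
Qed.

Lemma expR_le_quad x : 0 <= x <= 2^-1 -> expR x <= 1 + x + 2 * x ^+ 2.
Proof.
move=> /andP[x0 x2]; rewrite -[x in leLHS]opprK expRN.
have e1 := expR_ge1Dx (- x); have e0 := expR_gt0 (- x).
rewrite invf_ple ?posrE//; last by nra.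
apply: le_trans e1; rewrite -[leLHS]mul1r ler_pdivrMr; nra.
Qed.

Lemma expR1_le4 : expR 1 <= 4 :> R.
Proof.
have -> : (1 : R) = 2^-1 + 2^-1 by field.
rewrite expRD; have := @expR_le_quad 2^-1; have := expR_ge0 (2^-1 : R).
by move=> ? /(_ _); rewrite lexx invr_ge0 ler0n => /(_ isT) ?; nra.
Qed.

Lemma expRN_nat_le n : expR (- n%:R) <= 2^-1 ^+ n :> R.
Proof.
rewrite -[n%:R]mulr1 -mulrN expRM_natl lerXn2r ?nnegrE ?expR_ge0//.
rewrite expRN lef_pV2 ?posrE ?expR_gt0//.
by apply: le_trans (expR_ge1Dx 1); rewrite lexx.
Qed.

(** Applied in [EE_ind_le] with $x$ of order $\sqrt m$, where cubic decay turns a factor $m$ into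
    $1/\sqrt m$. The 27 is $3^3$, from $\exp(x/3)\ge x/3$. *)
Lemma expRN_cube_le x : 0 < x -> expR (- x) <= 27 / x ^+ 3.
Proof.
move=> x0; have y0 : 0 < x / 3 by rewrite divr_gt0.
have -> : expR (- x) = (expR (x / 3) ^+ 3)^-1.
  by rewrite expRN -expRM_natl; congr ((expR _)^-1); field.
have -> : 27 / x ^+ 3 = ((x / 3) ^+ 3)^-1 by field; rewrite gt_eqF.
rewrite lef_pV2 ?posrE ?exprn_gt0 ?expR_gt0// lerXn2r ?nnegrE ?expR_ge0 ?ltW//.
by apply: lt_le_trans (expR_ge1Dx _); lra.
Qed.

Lemma sum_half_le n : \sum_(i < n) 2^-1 ^+ i.+1 <= 1 :> R.
Proof.
have -> : \sum_(i < n) 2^-1 ^+ i.+1 = 1 - 2^-1 ^+ n :> R.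
  elim: n => [|n IH]; first by rewrite big_ord0 expr0 subrr.
  by rewrite big_ord_recr /= IH exprS; field.
by rewrite gerBl exprn_ge0.
Qed.

End ExpBounds.

(** Distance from [t] to the next later period in which [a] holds, cut off at [k]. *)
Fixpoint gap (a : nat -> bool) (k t : nat) : nat :=
  if k is k'.+1 then if a t.+1 then 1 else (gap a k' t.+1).+1 else 0.

Lemma gap_bound a k t : (gap a k t <= k)%N.
Proof. by elim: k t => //= k IH t; case: ifP => // _; apply: IH. Qed.

Lemma gap_gt0 a k t : (0 < k)%N -> (0 < gap a k t)%N.
Proof. by case: k => //= k _; case: ifP. Qed.

Lemma gap_end a k t : gap a k t = k \/ a (t + gap a k t)%N.
Proof.
elim: k t => [|k IH] t /=; first by left.
case: ifP => [at1|_]; first by right; rewrite addn1.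
by case: (IH t.+1) => [->|]; [left|right; rewrite -addSnnS].
Qed.

Lemma gap_sum (a : nat -> bool) k t :
  (\sum_(i < k) a (t + i) * gap a (k - i) (t + i) <= k)%N.
Proof.
(* The induction also counts the stretch in progress, which starts at [t']; the stretches are
   disjoint. *)
have key k' t' : (\sum_(i < k') a (t'.+1 + i) * gap a (k' - i) (t'.+1 + i)
    + gap a k'.+1 t' <= k'.+1)%N.
  elim: k' t' => [|k' IH] t'; first by rewrite big_ord0 /= if_same.
  rewrite big_ord_recl subn0 addn0.
  under eq_bigr do rewrite -addSnnS subSS.
  have := IH t'.+1; rewrite [gap a k'.+2 t']/= -/(gap a k'.+1 t'.+1).
  by case: (a t'.+1) => /=; lia.
case: k => [|k]; first by rewrite big_ord0.
rewrite big_ord_recl subn0 addn0; under eq_bigr do rewrite -addSnnS subSS.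
by have := key k t; case: (a t) => /=; lia.
Qed.

Section Generalization.
Variables (R : realType) (M N T' m : nat) (h p : nat -> R).
Variables (P : nat -> 'I_M.+1 -> R) (I : nat -> {set 'I_N}).
Let T := T'.+1.
Hypothesis h01 : forall t, 0 < h t <= 1.
Hypothesis p01 : forall t, 0 < p t <= 1.
Hypothesis Pp : forall t, pmf (P t).
Hypothesis m_gt0 : (0 < m)%N.
Hypothesis Im : forall t, #|I t| = m.
Notation data := (data M N T').
Notation EE := (EE (dw (T' := T') P)).
Notation Phat := (Phat R m I).
Implicit Types x : data.

(** Second-order expansion of $\mathbb E\exp(-lC)$ for a random cost $C\in[-1,n]$ with mean [gq]:
    the quadratic term comes from $C^2\le n(C+1)+1$, and the factor 2 from [expR_le_quad], needed
    when $C$ is negative. The proof runs along the recursion without introducing $C$. *)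
Lemma mgf_le l n t y : 0 <= l <= 2^-1 ->
  mgf h p P (copt h p P) l n t y <=
  1 - l * gq h p P n t y + 2 * l ^+ 2 * (n%:R * (gq h p P n t y + 1) + 1).
Proof.
move=> /andP[l0 l2]; elim: n t y => [|n IH] t y.
  by rewrite /= /gq mulr0 subr0 mul0r add0r mulr1 lerDl mulr_ge0// sqr_ge0.
rewrite gqS /=; set z := (X in 1 - l * Ex _ X).
pose A := 1 + 2 * l ^+ 2 * n.+2%:R; pose B := 2 * l ^+ 2 * n.+1%:R - l.
have -> : 1 - l * Ex (P t) z + 2 * l ^+ 2 * (n.+1%:R * (Ex (P t) z + 1) + 1)
    = Ex (P t) (fun d => A + B * z d).
  rewrite ExD Ex_cst// ExZ /A /B -(natr1 n.+1); ring.
apply: le_Ex => // d _; rewrite /A /B /z -(natr1 n.+1) -(natr1 n).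
have /andP[h0 h1] := h01 t; have /andP[p0 p1] := p01 t.
have n0 : 0 <= n%:R :> R by [].
case: ifP => _; last first.
  have lp0 : 0 <= l * p t by rewrite mulr_ge0// ltW.
  apply: le_trans (expR_le_quad _) _; first by apply/andP; split=> //; nra.
  have -> : 1 + 2 * l ^+ 2 * (n%:R + 1 + 1) +
    (2 * l ^+ 2 * (n%:R + 1) - l) * - p t = 1 + l * p t
    + 2 * (l ^+ 2 * ((n%:R + 1) * (1 - p t) + 1)) by ring.
  rewrite lerD2l ler_pM2l// exprMn ler_wpM2l ?sqr_ge0//.
  by have : 0 <= n%:R * (1 - p t); nra.
rewrite -copt_max; set g := if _ then gq _ _ _ _ _ _ else _.
set K := if _ then mgf _ _ _ _ _ _ _ _ else _.
have g0 : 0 <= g by rewrite /g copt_max le_max lexx.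
have KE : K <= 1 - l * g + 2 * l ^+ 2 * (n%:R * (g + 1) + 1).
  rewrite /K /g; case: ifP => _; first exact: IH.
  by rewrite mulr0 subr0 add0r mulr1 lerDl !mulr_ge0// addr_ge0.
have lh0 : 0 <= l * h t by rewrite mulr_ge0// ltW.
have lh1 : l * h t <= 1 by nra.
have e1 := expRN_le_quad lh0.
have K0 : 0 <= K.
  by rewrite /K; case: ifP => // _; apply/ltW/mgf_gt0.
set q := 2 * l ^+ 2 * (n%:R * (g + 1) + 1) in KE *.
have q0 : 0 <= q.
  by rewrite /q mulr_ge0 ?mulr_ge0 ?sqr_ge0// addr_ge0// mulr_ge0// addr_ge0.
apply: (@le_trans _ _ ((1 - l * h t + (l * h t) ^+ 2) * K)).
  exact: ler_wpM2r.
apply: (@le_trans _ _ ((1 - l * h t + (l * h t) ^+ 2) * (1 - l * g + q))).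
  apply: ler_wpM2l => //; nra.
have step1 : (1 - l * h t + (l * h t) ^+ 2) * q <= q.
  by rewrite ler_piMl//; nra.
have lg0 : 0 <= l * g by rewrite mulr_ge0.
have step2 : 0 <= (l * h t) ^+ 2 * (l * g) by rewrite mulr_ge0 ?sqr_ge0.
have -> : 1 + 2 * l ^+ 2 * (n%:R + 1 + 1) + (2 * l ^+ 2 * (n%:R + 1) - l) * (h t + g)
   = 1 - l * h t - l * g + q + l ^+ 2 * (2 * ((n%:R + 1) * h t + g + 1)).
  by rewrite /q; ring.
have step3 : l ^+ 2 * (h t ^+ 2 + h t * g) <= l ^+ 2 * (2 * ((n%:R + 1) * h t + g + 1)).
  rewrite ler_wpM2l ?sqr_ge0//.
  have nh0 : 0 <= n%:R * h t by rewrite mulr_ge0// ltW.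
  have hg0 : 0 <= (1 - h t) * g by rewrite mulr_ge0// subr_ge0.
  by nra.
by nra.
Qed.

Lemma mgf_expn_le l n t y : 0 <= l <= 2^-1 ->
  mgf h p P (copt h p P) l n t y ^+ m <=
  expR (m%:R * (2 * l ^+ 2 * (n%:R * (gq h p P n t y + 1) + 1)
                - l * gq h p P n t y)).
Proof.
move=> l01; rewrite expRM_natl lerXn2r ?nnegrE ?expR_ge0 ?(ltW (mgf_gt0 _ _ _ _ _ _ _ _))//.
apply: le_trans (mgf_le _ _ _ l01) _; apply: le_trans (expR_ge1Dx _).
by rewrite le_eqVlt; apply/orP; left; apply/eqP; ring.
Qed.

(* Amortization: a unit whose marginal cost is large in period [t] can rarely
   be sold in the periods after [t]. *)
Lemma sum_reach_gq_le n t y :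
  \sum_(i < n) Ex (P (t + i)%N) (fun d => (y <= d)%N%:R)
     * Num.max 0 (gq h p P (n - i) (t + i) y) <= n%:R.
Proof.
(* The current positive part [v] is added as a potential. If [k] is the probability of reaching the
   unit, then [v <= (1 - k) * (1 + v')], so that [k * v + v <= 1 + v']. *)
suff : \sum_(i < n) Ex (P (t + i)%N) (fun d => (y <= d)%N%:R)
     * Num.max 0 (gq h p P (n - i) (t + i) y) + Num.max 0 (gq h p P n t y) <= n%:R.
  by apply: le_trans; rewrite lerDl le_max lexx.
elim: n t => [|n IH] t; first by rewrite big_ord0 add0r /gq maxxx.
rewrite big_ord_recl subn0 addn0.
under eq_bigr do rewrite -addSnnS subSS.
have {IH} := IH t.+1; set W := \sum_(i < n) _.
set v' := Num.max 0 (gq h p P n t.+1 y); set v := Num.max 0 (gq _ _ _ n.+1 _ _).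
set k := Ex _ _ => IH.
have k0 : 0 <= k by rewrite /k -(Ex_cst 0 (Pp t)); apply: le_Ex.
have k1 : k <= 1.
  by rewrite /k -[leRHS](Ex_cst 1 (Pp t)); apply: le_Ex => // d _; case: leqP.
have v'0 : 0 <= v' by rewrite le_max lexx.
have v0 : 0 <= v by rewrite le_max lexx.
have vle : v <= (1 - k) * (1 + v').
  rewrite ge_max mulr_ge0 ?subr_ge0 ?addr_ge0//= mulrC.
  have -> : 1 - k = Ex (P t) (fun d => 1 - (y <= d)%N%:R) by rewrite ExB Ex_cst.
  rewrite -ExZ gqS; apply: le_Ex => // d _; case: (ltnP d y) => _.
    rewrite subr0 mulr1 lerD ?(andP (h01 t)).2//.
    by rewrite ge_max v'0 le_max gq_mono ?orbT// leq_subr.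
  by rewrite subrr mulr0 oppr_le0; case/andP: (p01 t) => /ltW.
rewrite -(natr1 n); nra.
Qed.

Variable y : nat.
Let s : R := Num.sqrt m%:R.

Let s2 : s ^+ 2 = m%:R. Proof. by rewrite sqr_sqrtr. Qed.

Let s1 : 1 <= s. Proof. by rewrite -sqrtr1 ler_wsqrtr// ler1n. Qed.

Let s0 : 0 < s. Proof. exact: lt_le_trans s1. Qed.

Let ind x t := gq h p (Phat x) (T - t) t y <= 0.
Let lev x := level h p T (Phat x).

(* Excess of the true over the empirical marginal cost of a unit that the
   empirically optimal policy orders. *)
Definition excess x (t : nat) : R :=
  if ind x t then gr h p (fun _ r z => lev x r < z)%N P (T - t) t y
                  - gq h p (Phat x) (T - t) t y else 0.

Let g n t := gq h p P n t y.
(** Empirical cost of the rule that is optimal for the true law; as this rule does not depend on the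
    data, [EE_expR_gr_le] applies to it. *)
Let e x n t := gr h p (copt h p P) (Phat x) n t y.

(** Majorant, by [1 + z <= expR z], of the part of [g - e] beyond [5 * n / s]. The slope [s / 2] is
    [m * l] for [l = 1 / (2 * s)]; of the discount [5 / 2 * n], the moment bound uses up
    [3 / 2 * n], and the remaining [expR (- n)] is summable over [n]. *)
Let K x n t : R :=
  2 / s * expR (s / 2 * (g n t - e x n t) - 5 / 2 * n%:R).

(** Some horizon makes the true cost too large to be charged at rate [1 / s] per period. *)
Let bad t := [exists n : 'I_(T - t), (1 < g n.+1 t) && (n.+1%:R / s < g n.+1 t)].

Let Phat_pmf x t : pmf (Phat x t). Proof. exact: Phat_pmf. Qed.

Lemma ind_e_le0 x n t : ind x t -> (0 < n <= T - t)%N -> e x n t <= 0.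
Proof.
move=> xt nT; apply: le_trans xt.
apply: le_trans (gq_mono_n h p t y (Phat_pmf x) nT); exact: gr_le_gq.
Qed.

(** Let [n] be the gap until the empirical policy orders the unit again. The true cost is at most
    [g n t] and the empirical one at least [e x n t]. If [g n t <= 1], the difference is at most
    [5 * n / s] plus [K]; if [1 < g n t <= n / s], it is at most [2 * n / s], the empirical cost
    being at least [- 1]; otherwise [t] is [bad]. As [n] depends on the data, [K] is summed over all
    horizons. *)
Lemma excess_le x t : (0 < y)%N -> (t < T)%N -> excess x t <=
  (ind x t * gap (ind x) (T - t) t)%N%:R * (7 / s)
  + \sum_(n < T - t) (if g n.+1 t <= 1 then K x n.+1 t else 0)
  + (if bad t then 2 * Num.max 0 (g (T - t) t) * (ind x t)%:R else 0).
Proof.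
move=> y0 tT; rewrite /excess.
have K0 n : 0 <= K x n t.
  by rewrite /K mulr_ge0 ?expR_ge0// divr_ge0// ltW.
have S0 : 0 <= \sum_(n < T - t) (if g n.+1 t <= 1 then K x n.+1 t else 0).
  by apply: sumr_ge0 => n _; case: ifP.
have m0 : 0 <= Num.max 0 (g (T - t) t) by rewrite le_max lexx.
case: ifPn => xt; last first.
  by rewrite !addr_ge0 ?mul0n ?mul0r// mulr0 if_same.
rewrite mul1n mulr1; set n := gap _ _ _.
have n0 : (0 < n)%N by rewrite gap_gt0// subn_gt0.
have nT : (n <= T - t)%N := gap_bound _ _ _.
have n0T : (0 < n <= T - t)%N by rewrite n0.
have nT' : (n.-1 < T - t)%N by rewrite prednK.
have nr0 : 0 < n%:R :> R by rewrite ltr0n.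
have gle : gr h p (fun _ r z => lev x r < z)%N P (T - t) t y <= g n t.
  have [nE|] := gap_end (ind x) (T - t) t; rewrite -/n.
    by rewrite /n nE gr_le_gq.
  case: (ltnP (t + n) T) => tnT xtn; last first.
    by rewrite (_ : n = (T - t)%N) ?gr_le_gq//; lia.
  apply: gr_level_le_gq => //; rewrite leqNgt -(prednK y0).
  by rewrite /lev level_ltn// (prednK y0) -leNgt.
have ge : e x n t <= gq h p (Phat x) (T - t) t y.
  apply: le_trans (gq_mono_n h p t y (Phat_pmf x) n0T); exact: gr_le_gq.
have gN1 : -1 <= gq h p (Phat x) (T - t) t y by exact: gq_geN1.
have ns0 : 0 < n%:R / s by rewrite divr_gt0.
have [g1|g1] := leP (g n t) 1.
  apply: (@le_trans _ _ (n%:R * (7 / s) + K x n t)); last first.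
    rewrite -addrA lerD2l -(prednK n0) /=.
    rewrite (bigD1 (Ordinal nT'))//= (prednK n0) g1 -addrA lerDl addr_ge0//.
      by apply: sumr_ge0 => i _; case: ifP.
    by case: ifP => // _; rewrite mulr_ge0.
  apply: (@le_trans _ _ (g n t - e x n t)); first by lra.
  have := expR_ge1Dx (s / 2 * (g n t - e x n t) - 5 / 2 * n%:R).
  rewrite /K; set E := expR _ => HE.
  rewrite -subr_ge0 in HE; have := mulr_ge0 (divr_ge0 (ler0n R 2) (ltW s0)) HE.
  have -> : 2 / s * (E - (1 + (s / 2 * (g n t - e x n t) - 5 / 2 * n%:R)))
     = 2 / s * E - 2 / s - (g n t - e x n t) + 5 * (n%:R / s).
    by field; rewrite gt_eqF.
  have : 0 < s^-1 by rewrite invr_gt0.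
  by lra.
have [gn|gn] := leP (g n t) (n%:R / s).
  apply: (@le_trans _ _ (n%:R * (7 / s))).
    by rewrite mulrCA; lra.
  by rewrite -addrA lerDl addr_ge0//; case: ifP => // _; rewrite mulr_ge0.
have -> : bad t.
  by apply/existsP; exists (Ordinal nT'); rewrite /= (prednK n0) g1.
apply: (@le_trans _ _ (2 * Num.max 0 (g (T - t) t))); last first.
  by rewrite lerDr addr_ge0// mulr_ge0// ?divr_ge0// ltW.
have : g n t <= Num.max 0 (g (T - t) t).
  by rewrite le_max (gq_mono_n h p) ?orbT.
by lra.
Qed.

Lemma EE_K_le n t : (n + t <= T)%N -> (0 < n)%N -> g n t <= 1 ->
  EE (fun x => K x n t) <= 2 / s * 2^-1 ^+ n.
Proof.
move=> ntT n0 g1; rewrite /K EEZ; apply: ler_wpM2l.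
  by rewrite divr_ge0// ltW.
apply: le_trans (expRN_nat_le R n).
have ss : s != 0 by rewrite gt_eqF.
under eq_EE => x.
  have -> : s / 2 * (g n t - e x n t) - 5 / 2 * n%:R =
    (s / 2 * g n t - 5 / 2 * n%:R) + - (m%:R * (2 * s)^-1 * e x n t).
    by rewrite -s2; field.
  rewrite expRD; over.
rewrite EEZ.
have l01 : 0 <= (2 * s)^-1 <= 2^-1.
  rewrite invr_ge0 mulr_ge0 ?(ltW s0)//= lef_pV2 ?posrE ?mulr_gt0//.
  by rewrite ler_peMr.
have := EE_expR_gr_le h p Pp m_gt0 Im (copt h p P) (2 * s)^-1 y ntT.
move=> /le_trans /(_ (mgf_expn_le _ _ _ l01)) H.
apply: le_trans (ler_wpM2l (expR_ge0 _) H) _.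
rewrite -expRD ler_expR -/(g n t) -s2.
have -> : s ^+ 2 * (2 * (2 * s)^-1 ^+ 2 * (n%:R * (g n t + 1) + 1)
     - (2 * s)^-1 * g n t) = 2^-1 * (n%:R * (g n t + 1) + 1) - s / 2 * g n t.
  by field.
have n1 : 1 <= n%:R :> R by rewrite ler1n.
have ng : n%:R * g n t <= n%:R * 1 :> R by rewrite ler_wpM2l.
by lra.
Qed.

(** The indicator is at most the number of samples reaching the unit times an exponential of the
    empirical cost [e], which is nonpositive whenever the unit is ordered. Counting samples yields
    the probability of reaching the unit as a factor, as [sum_reach_gq_le] requires. *)
Lemma EE_ind_le t : (t < T)%N -> bad t ->
  EE (fun x => (ind x t)%:R) <=
  216 * 24 ^+ 3 / s * Ex (P t) (fun d => (y <= d)%N%:R).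
Proof.
move=> tT /existsP[[n' n'T] /= /andP[g1 gs]].
set n := n'.+1 in g1 gs; set k := Ex _ _.
have k0 : 0 <= k by rewrite /k -(Ex_cst 0 (Pp t)); apply: le_Ex.
have nr1 : 1 <= n%:R :> R by rewrite ler1n.
(* With [l * n = 1 / 12] and [n * (g + 1) + 1 <= 3 * n * g], the quadratic term of [mgf_le] is at
   most [l * g / 2]. The exponent is then at most [- m * l * g / 2], and [g > n / s] bounds it by
   [- s / 24]. *)
pose l : R := (12 * n%:R)^-1.
have l0 : 0 < l by rewrite invr_gt0 mulr_gt0//; lra.
have ln : l * n%:R = 12^-1 by rewrite /l; field; rewrite gt_eqF//; lra.
have l12 : l <= 12^-1 by rewrite -ln ler_peMr// ltW.
apply: (@le_trans _ _ (EE (fun x =>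
   (\sum_(j in I t) (y <= x (inord t) j)%N%:R) *
      expR (- (m%:R * l * e x n t))))).
  apply: le_EE => [i|x]; first exact: dw_pmf.
  have S0 : 0 <= \sum_(j in I t) (y <= x (inord t) j)%N%:R :> R by exact: sumr_ge0.
  case: (boolP (ind x t)) => [xt|_] /=; last by rewrite mulr_ge0 ?expR_ge0.
  have en : e x n t <= 0 by apply: ind_e_le0.
  rewrite -[leLHS]mulr1; apply: ler_pM => //.
    case: (boolP [exists j in I t, (y <= x (inord t) j)%N]).
      case/existsP => j /andP[jI yj]; rewrite (bigD1 j)//= yj lerDl.
      exact: sumr_ge0.
    (* If no sample reaches the unit, it is never sold in period [t] under the empirical law, and
       its empirical cost is positive. *)
    move=> /existsPn none; exfalso; move: xt; rewrite /ind leNgt => /negP; apply.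
    rewrite -(subnSK tT); apply: gq_gt0 => //.
    rewrite !Ex_Phat (eq_bigr (fun=> 0)) => [|j jI]; last first.
      by have := none j; rewrite jI /= => /negbTE ->.
    rewrite big1_eq mulr0 mulr0 mulr_gt0 ?(andP (h01 t)).1//.
    rewrite mulr_gt0 ?invr_gt0 ?ltr0n// (eq_bigr (fun=> 1)) => [|j jI].
      by rewrite sumr_const Im ltr0n.
    by have := none j; rewrite jI /= ltnNge => ->.
  by rewrite -expR0 ler_expR oppr_ge0 mulr_ge0_le0// mulr_ge0// ltW.
have nt : (n'.+1 + t <= T)%N by lia.
have l01 : 0 <= l <= 1 by rewrite ltW//=; lra.
have l02 : 0 <= l <= 2^-1 by rewrite ltW//=; lra.
have ln2 : l * n'.+1%:R <= 2^-1 by rewrite ln; lra.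
apply: le_trans (EE_reach_expR_gr_le h01 p01 Pp m_gt0 Im _ y nt l01 ln2) _.
rewrite -/n -/k.
have C0 : 0 <= 2 * expR 1 * m%:R * k by rewrite !mulr_ge0 ?expR_ge0.
apply: le_trans (ler_wpM2l C0 (mgf_expn_le _ _ _ l02)) _.
rewrite -/(g n t).
have mE : m%:R * (2 * l ^+ 2 * (n%:R * (g n t + 1) + 1) - l * g n t) <= - (s / 24).
  have -> : 2 * l ^+ 2 * (n%:R * (g n t + 1) + 1) - l * g n t =
    - (l * g n t / 2) + 2 * l ^+ 2 * (n%:R * (g n t + 1) + 1 - 3 * (n%:R * g n t)).
    by rewrite expr2; have := ln; rewrite /l => _; rewrite -/l;
       rewrite (_ : 2 * (l * l) * (n%:R * (g n t + 1) + 1 - 3 * (n%:R * g n t)) =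
         2 * (l * l) * (n%:R * (g n t + 1) + 1) - 6 * l * (l * n%:R) * g n t);
       [rewrite ln; field | ring].
  have neg : n%:R * (g n t + 1) + 1 - 3 * (n%:R * g n t) <= 0 by nra.
  have lg : (12 * s)^-1 <= l * g n t.
    have -> : (12 * s)^-1 = l * (n%:R / s).
      by rewrite mulrA ln invfM.
    by rewrite ler_wpM2l// ltW.
  apply: (@le_trans _ _ (m%:R * - ((12 * s)^-1 / 2))).
    rewrite ler_wpM2l//.
    have : 2 * l ^+ 2 * (n%:R * (g n t + 1) + 1 - 3 * (n%:R * g n t)) <= 0.
      by rewrite mulr_ge0_le0// mulr_ge0// sqr_ge0.
    lra.
  rewrite -s2 le_eqVlt; apply/orP; left; apply/eqP; field; rewrite gt_eqF//.
apply: (@le_trans _ _ (2 * 4 * m%:R * k * (27 / (s / 24) ^+ 3))).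
  apply: ler_pM => //; rewrite ?expR_ge0//.
    by rewrite ler_wpM2r// ler_wpM2r// ler_wpM2l// expR1_le4.
  by apply: le_trans (expRN_cube_le _); rewrite ?ler_expR// divr_gt0.
rewrite -s2 le_eqVlt; apply/orP; left; apply/eqP; field; rewrite gt_eqF//.
Qed.

(** The constant collects 7 from the disjoint gaps, 2 from the geometric sums of [K], and
    [2 * 216 * 24 ^+ 3] from the bad periods. *)
Lemma EE_excess_le : (0 < y)%N ->
  EE (fun x => \sum_(t < T) excess x t) <= (432 * 24 ^+ 3 + 9) * T%:R / s.
Proof.
move=> y0.
pose B1 x (t : nat) : R := (ind x t * gap (ind x) (T - t) t)%N%:R * (7 / s).
pose B2 x (t : nat) : R :=
  \sum_(n < T - t) (if g n.+1 t <= 1 then K x n.+1 t else 0).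
pose B3 x (t : nat) : R :=
  if bad t then 2 * Num.max 0 (g (T - t) t) * (ind x t)%:R else 0.
apply: (@le_trans _ _ (EE (fun x =>
    \sum_(t < T) B1 x t + \sum_(t < T) B2 x t + \sum_(t < T) B3 x t))).
  apply: le_EE => [i|x]; first exact: dw_pmf.
  by rewrite -!big_split; apply: ler_sum => t _; exact: excess_le.
rewrite !EED.
have si0 : 0 < s^-1 by rewrite invr_gt0.
have E1 : EE (fun x => \sum_(t < T) B1 x t) <= 7 * (T%:R / s).
  rewrite -[leRHS](EE_cst _ (@dw_pmf _ _ N T' _ Pp)); apply: le_EE => [i|x].
    exact: dw_pmf.
  rewrite -mulr_suml -natr_sum mulrCA ler_wpM2l ?ler_wpM2r// ?(ltW si0)//.
  by rewrite ler_nat; exact: (gap_sum (ind x) T 0).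
have E2 : EE (fun x => \sum_(t < T) B2 x t) <= 2 * (T%:R / s).
  rewrite EE_sum (_ : 2 * _ = \sum_(t < T) 2 / s); last first.
    by rewrite sumr_const card_ord -[RHS]mulr_natl; ring.
  apply: ler_sum => t _; rewrite EE_sum.
  apply: (@le_trans _ _ (\sum_(n < T - t) 2 / s * 2^-1 ^+ n.+1)); last first.
    by rewrite -mulr_sumr ler_piMr ?sum_half_le// divr_ge0// ltW.
  apply: ler_sum => n _; case: (boolP (g n.+1 t <= 1)) => gn.
    by apply: EE_K_le => //; have := ltn_ord n; lia.
  rewrite EE_cst; last exact: dw_pmf.
  by rewrite mulr_ge0 ?exprn_ge0// divr_ge0// ltW.
have C0 : 0 <= 432 * 24 ^+ 3 / s :> R.
  apply: mulr_ge0; last by rewrite invr_ge0 ltW.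
  by apply: mulr_ge0; [exact: ler0n|apply: exprn_ge0; exact: ler0n].
have E3 : EE (fun x => \sum_(t < T) B3 x t) <= 432 * 24 ^+ 3 * (T%:R / s).
  rewrite EE_sum.
  apply: (@le_trans _ _ (\sum_(t < T) 432 * 24 ^+ 3 / s *
     (Ex (P (0 + t)%N) (fun d => (y <= d)%N%:R)
     * Num.max 0 (gq h p P (T - t) (0 + t) y)))); last first.
    have -> : 432 * 24 ^+ 3 * (T%:R / s) = 432 * 24 ^+ 3 / s * T%:R by ring.
    by rewrite -mulr_sumr; apply: ler_wpM2l C0 _ _ _; exact: sum_reach_gq_le.
  apply: ler_sum => t _; rewrite add0n.
  have k0 : 0 <= Ex (P t) (fun d => (y <= d)%N%:R).
    by rewrite -(Ex_cst 0 (Pp t)); apply: le_Ex.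
  have v0 : 0 <= Num.max 0 (gq h p P (T - t) t y) by rewrite le_max lexx.
  rewrite /B3; case: (boolP (bad t)) => bt; last first.
    rewrite EE_cst; last exact: dw_pmf.
    by apply: mulr_ge0; [exact: C0|exact: mulr_ge0].
  rewrite EEZ -/(g _ _) -/(g _ _).
  have H := EE_ind_le (ltn_ord t) bt.
  apply: le_trans (ler_wpM2l _ H) _; first by rewrite mulr_ge0.
  rewrite le_eqVlt; apply/orP; left; apply/eqP; field; exact: lt0r_neq0.
have : 0 <= T%:R / s by rewrite divr_ge0// ltW.
by rewrite mulrA in E1 E2 E3 *; rewrite -!mulrA in E1 E2 E3 *; lra.
Qed.

End Generalization.

(** * Regret in the gridded model *)

Section DiscreteRegret.
Variables (R : realType) (M N T' m : nat) (h p : nat -> R).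
Variables (P : nat -> 'I_M.+1 -> R) (I : nat -> {set 'I_N}).
Let T := T'.+1.
Hypothesis h01 : forall t, 0 < h t <= 1.
Hypothesis p01 : forall t, 0 < p t <= 1.
Hypothesis Pp : forall t, pmf (P t).
Hypothesis m_gt0 : (0 < m)%N.
Hypothesis Im : forall t, #|I t| = m.
Notation data := (data M N T').
Notation EE := (EE (dw (T' := T') P)).
Notation Phat := (Phat R m I).
Notation lev := (level h p T).

Let Phat_pmf (x : data) t : pmf (Phat x t). Proof. exact: Phat_pmf. Qed.

(** Adding the empirical optimality of the empirical levels leaves, for each of the two policies, a
    difference between true and empirical costs. The second sum concerns the fixed levels [lev P]
    and has mean zero by [EE_gr]. *)
Lemma regret_le_excess (x : data) :
  Wv h p (lev (Phat x)) P T 0 0 - Wv h p (lev P) P T 0 0 <=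
  \sum_(y < M) \sum_(t < T) excess m h p P I y.+1 x t
  + \sum_(y < M) \sum_(t < T | (y < lev P t)%N)
      (gr h p (fun _ s z => lev P s < z)%N (Phat x) (T - t) t y.+1
       - gr h p (fun _ s z => lev P s < z)%N P (T - t) t y.+1).
Proof.
have opt := Wv_level_opt h01 p01 (Phat_pmf x) (lev P) 0 (addn0 T).
have levM Q t : (lev Q t <= M)%N := level_le h p T Q t.
rewrite !Wv_eq_sum_gr//; rewrite !Wv_eq_sum_gr// lerD2l in opt.
rewrite opprD addrACA subrr add0r.
have -> : \sum_(y < M) \sum_(t < T) excess m h p P I y.+1 x t =
  \sum_(y < M) \sum_(t < T | (y < lev (Phat x) t)%N)
    gr h p (fun _ s z => lev (Phat x) s < z)%N P (T - t) t y.+1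
  - \sum_(y < M) \sum_(t < T | (y < lev (Phat x) t)%N)
      gr h p (fun _ s z => lev (Phat x) s < z)%N (Phat x) (T - t) t y.+1.
  rewrite -sumrB; apply: eq_bigr => y _; rewrite -sumrB [RHS]big_mkcond.
  apply: eq_bigr => t _; rewrite /excess [in RHS]leqNgt level_ltn// -leNgt.
  by case: ifP => // _; rewrite gr_level// subnK// ltnW.
have -> : \sum_(y < M) \sum_(t < T | (y < lev P t)%N)
      (gr h p (fun _ s z => lev P s < z)%N (Phat x) (T - t) t y.+1
       - gr h p (fun _ s z => lev P s < z)%N P (T - t) t y.+1) =
  \sum_(y < M) \sum_(t < T | (y < lev P t)%N)
      gr h p (fun _ s z => lev P s < z)%N (Phat x) (T - t) t y.+1
  - \sum_(y < M) \sum_(t < T | (y < lev P t)%N)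
      gr h p (fun _ s z => lev P s < z)%N P (T - t) t y.+1.
  by rewrite -sumrB; apply: eq_bigr => y _; rewrite -sumrB.
move: opt; lra.
Qed.

Lemma EE_regret_le :
  EE (fun x => Wv h p (lev (Phat x)) P T 0 0 - Wv h p (lev P) P T 0 0) <=
  M%:R * ((432 * 24 ^+ 3 + 9) * T%:R / Num.sqrt m%:R).
Proof.
apply: le_trans (le_EE _ regret_le_excess) _; first by move=> i; exact: dw_pmf.
rewrite EED !EE_sum [X in _ + X]big1 ?addr0 => [|y _]; last first.
  rewrite EE_sum; apply: big1 => t _; rewrite EEB EE_gr//; last first.
    by rewrite subnK// ltnW.
  by rewrite EE_cst ?subrr// => i; exact: dw_pmf.
set C := (X in _ <= _ * X); have -> : M%:R * C = \sum_(y < M) C.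
  by rewrite sumr_const card_ord mulr_natl.
by apply: ler_sum => y _; exact: EE_excess_le.
Qed.

End DiscreteRegret.

(** * Assouad's lemma *)

Lemma EE_local (R : realType) (I V : finType) (w w' : I -> V -> R) (W : {set I}) f :
  (forall i, pmf (w i)) -> (forall i, pmf (w' i)) ->
  (forall i, i \notin W -> w i = w' i) ->
  (forall i x v, i \in W -> f (upd x i v) = f x) ->
  EE w f = EE w' f.
Proof.
move=> wp wp' ww' fW.
pose ws (s : seq I) i := if i \in s then w' i else w i.
have wsp s i : pmf (ws s i) by rewrite /ws; case: ifP.
suff H s : {subset s <= W} -> EE (ws s) f = EE w f.
  have <- : ws (enum W) = w'; last by rewrite H// => i; rewrite mem_enum.
  by apply/funext => i; rewrite /ws mem_enum; case: ifPn => // /ww'.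
elim: s => [//|i s IH] sW.
rewrite -IH; last by move=> j js; apply: sW; rewrite inE js orbT.
have -> : ws (i :: s) = updw (ws s) i (w' i).
  apply/funext => j; rewrite /ws /updw inE; have [->|] //= := eqVneq j i.
apply: EE_updw => //; first by case: (wp' i).
by move=> x v; apply: fW; apply: sW; rewrite mem_head.
Qed.

(** Bernoulli's inequality: the powers are at most [18 / 17] and at least [17 / 18], and
    [18 / 17 - 17 / 18 = 35 / 306 < 1 / 8]. *)
Lemma pow_gap (R : realFieldType) (v : R) m : 0 <= v -> m%:R * v <= 18^-1 ->
  (1 + v) ^+ m - (1 - v) ^+ m <= 8^-1.
Proof.
move=> v0 mv.
have v1 : (0 < m)%N -> v <= 18^-1.
  by move=> m0; apply: le_trans mv; rewrite ler_peMl// ler1n.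
have up k : (k <= m)%N -> (1 + v) ^+ k * (1 - k%:R * v) <= 1.
  elim: k => [|k IH] km; first by rewrite expr0 mul0r subr0 mulr1.
  apply: le_trans (IH (ltnW km)); rewrite exprS -(natr1 k) (mulrC (1 + v)) -mulrA.
  apply: ler_wpM2l; first by rewrite exprn_ge0// addr_ge0.
  have : 0 <= k%:R * v ^+ 2 by rewrite mulr_ge0// sqr_ge0.
  have := sqr_ge0 v; nra.
have low k : (k <= m)%N -> 1 - k%:R * v <= (1 - v) ^+ k.
  elim: k => [|k IH] km; first by rewrite expr0 mul0r subr0.
  have vle := v1 (leq_ltn_trans (leq0n k) km).
  rewrite exprS; apply: (@le_trans _ _ ((1 - v) * (1 - k%:R * v))).
    rewrite -(natr1 k).
    have : 0 <= k%:R * v ^+ 2 by rewrite mulr_ge0// sqr_ge0.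
    nra.
  by apply: ler_wpM2l (IH (ltnW km)); lra.
have := up m (leqnn m); have := low m (leqnn m).
have : 1 <= (1 + v) ^+ m by apply: exprn_ege1; lra.
move: (m%:R * v) ((1 + v) ^+ m) ((1 - v) ^+ m) mv => y a b mv a1 lo hi.
have : a * 17 <= 18 by nra.
lra.
Qed.

Section Tilt.
Variables (R : realType) (I : finType) (W S : {set I}) (w0 : I -> bool -> R).
Variable s : R.
Hypothesis w0p : forall i, pmf (w0 i).
Hypothesis SW : S \subset W.
Hypothesis s01 : 0 <= s <= 1.
Hypothesis Ss : #|S|%:R * s ^+ 2 <= 18^-1.

Definition sgnb (b : bool) : R := if b then 1 else -1.
(** In the application [W] consists of the coins of one even period and [S] of those among them that
    the logs reveal. *)
Definition tilt (c : R) (i : I) (b : bool) : R :=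
  if i \in W then (1 + c * sgnb b) / 2 else w0 i b.

Lemma tilt_pmf c i : -1 <= c <= 1 -> pmf (tilt c i).
Proof.
move=> /andP[c0 c1]; rewrite /tilt; case: (i \in W); last exact: w0p.
split=> [[]|]; rewrite ?big_bool /sgnb /=; lra.
Qed.

Let base := tilt 0.
Let basep i : pmf (base i). Proof. by apply: tilt_pmf; rewrite lerN10 ler01. Qed.

Let density (c : R) (x : {ffun I -> bool}) : R := \prod_(i in S) (1 + c * sgnb (x i)).

Variable f : {ffun I -> bool} -> R.
Hypothesis fS : forall i x b, i \in W -> i \notin S -> f (upd x i b) = f x.
Hypothesis f01 : forall x, 0 <= f x <= 2^-1.

Let EE_density c g : -1 <= c <= 1 ->
  (forall i x b, i \in W -> i \notin S -> g (upd x i b) = g x) ->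
  EE (tilt c) g = EE base (fun x => density c x * g x).
Proof.
move=> c1 gS; pose wc i b := if i \in S then tilt c i b else base i b.
have wcp i : pmf (wc i).
  by rewrite /wc; case: (i \in S); [exact: tilt_pmf|exact: basep].
rewrite (@EE_local _ _ _ _ wc (W :\: S)%SET)//; last 3 first.
- by move=> i; exact: tilt_pmf.
- move=> i; rewrite inE negb_and negbK => iWS; apply/funext => b; rewrite /wc.
  case: (boolP (i \in S)) iWS => //= iS iW.
  by rewrite /base /tilt (negbTE iW).
- by move=> i x v; rewrite inE => /andP[iS iW]; exact: gS.
apply: eq_bigr => x _; rewrite mulrA; congr (_ * _).
rewrite /density big_mkcond /pw -big_split /=; apply: eq_bigr => i _.
rewrite /wc /base /tilt; case: (boolP (i \in S)) => iS; last by rewrite mulr1.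
by rewrite (fintype.subsetP SW _ iS) mul0r addr0 mulrAC mul1r mulrC.
Qed.

Let EE_density_prod c c' : -1 <= c <= 1 -> -1 <= c' <= 1 ->
  EE base (fun x => density c x * density c' x) = (1 + c * c') ^+ #|S|.
Proof.
move=> c1 c1'.
pose phi i b := if i \in S then (1 + c * sgnb b) * (1 + c' * sgnb b) else 1.
transitivity (EE base (fun x => \prod_i phi i (x i))).
  apply: eq_EE => x; rewrite /density -big_split /= big_mkcond /=.
  by apply: eq_bigr => i _; rewrite /phi; case: ifP.
rewrite EE_prod -prodr_const [RHS]big_mkcond; apply: eq_bigr => i _.
rewrite /phi; case: (boolP (i \in S)) => iS.
  by rewrite big_bool /base /tilt (fintype.subsetP SW _ iS) /sgnb /=; lra.
by rewrite -mulr_suml (basep i).2 mul1r.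
Qed.

(* Second-moment comparison of the two likelihood ratios with respect to the
   untilted law; centring [f] at [1 / 4] uses that both densities have mean 1. *)
Lemma tilt_diff : EE (tilt (- s)) f - EE (tilt s) f <= 8^-1.
Proof.
have /andP[s0 s1] := s01.
have p1 : -1 <= s <= 1 by rewrite s1 (le_trans _ s0)// lerN10.
have m1 : -1 <= - s <= 1 by rewrite lerN2 s1 (le_trans _ ler01)// oppr_le0.
pose a x := density (- s) x - density s x.
have Ea : EE base (fun x => a x * 4^-1) = 0.
  have E1 c : -1 <= c <= 1 -> EE base (fun x => density c x * 4^-1) = 4^-1.
    by move=> c1; rewrite -(EE_density (g := fun=> 4^-1))// EE_cst// => i; exact: tilt_pmf.
  rewrite /a; under eq_EE do rewrite mulrBl.
  by rewrite EEB !E1// subrr.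
have -> : EE (tilt (- s)) f - EE (tilt s) f = EE base (fun x => a x * (f x - 4^-1)).
  rewrite (EE_density (c := s))// (EE_density (c := - s))// -EEB.
  under [RHS]eq_EE do rewrite mulrBr.
  by rewrite [RHS]EEB Ea subr0; apply: eq_EE => x; rewrite /a mulrBl.
have Ea2 : EE base (fun x => a x ^+ 2) <= 4^-1.
  pose A x := density (- s) x * density (- s) x.
  pose B x := density s x * density s x.
  pose C x := density s x * density (- s) x.
  have aE : EE base (fun x => a x ^+ 2) = EE base (fun x => A x + B x - 2 * C x).
    by apply: eq_EE => x; rewrite /a /A /B /C; ring.
  rewrite aE EEB EED EEZ /A /B /C !EE_density_prod// mulrNN mulrN -!expr2.
  have := pow_gap (sqr_ge0 s) Ss.
  by move: ((1 + s ^+ 2) ^+ _) ((1 - s ^+ 2) ^+ _) => y z; lra.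
(* This combines [|f x - 1 / 4| <= 1 / 4] with [|a x| <= a x ^+ 2 + 1 / 4]. *)
apply: (@le_trans _ _ (EE base (fun x => 4^-1 * (a x ^+ 2 + 4^-1)))).
  apply: le_EE => // x; have /andP[f0 f1] := f01 x.
  have : 0 <= (a x - 2^-1) ^+ 2 by exact: sqr_ge0.
  have : 0 <= (a x + 2^-1) ^+ 2 by exact: sqr_ge0.
  have [a0|a0] := leP 0 (a x); nra.
rewrite EEZ EED EE_cst//; lra.
Qed.

End Tilt.

Section Assouad.
Variables (R : realType) (n : nat) (I : finType).
Let Theta := {ffun 'I_n -> bool}.
Let X := {ffun I -> bool}.
Variables (w : Theta -> I -> bool -> R) (good : Theta -> X -> bool).
Variable Y : Theta -> X -> 'I_n -> R.
Hypothesis n_gt0 : (0 < n)%N.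
Hypothesis wp : forall theta i, pmf (w theta i).
Hypothesis Y_flip : forall theta x i b, Y (upd theta i b) x i = Y theta x i.
Hypothesis Y01 : forall theta x i, 0 <= Y theta x i <= 2^-1.
Hypothesis Y_good : forall theta x, good theta x ->
  \sum_i (if theta i then Y theta x i else 2^-1 - Y theta x i) <= n%:R / 32.
Hypothesis Y_pair : forall theta i,
  EE (w (upd theta i false)) (fun x => Y theta x i) -
  EE (w (upd theta i true)) (fun x => Y theta x i) <= 8^-1.

Definition fair (I' : Type) (i : I') (b : bool) : R := 2^-1.

Lemma fair_pmf I' i : pmf (@fair I' i).
Proof.
split=> [b|]; first by rewrite /fair invr_ge0.
by rewrite big_bool /fair /=; lra.
Qed.

(** Success forces a total gain of at least [15 / 32 * n]. Averaging over [theta i], on which [Y] at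
    [i] does not depend, bounds each expected gain by [(1 / 2 + 1 / 8) / 2 = 5 / 16]; the quotient
    is [2 / 3]. *)
Lemma assouad :
  EE (@fair 'I_n) (fun theta => EE (w theta) (fun x => (good theta x)%:R)) <= 2 / 3.
Proof.
pose gain (theta : Theta) x i := if theta i then 2^-1 - Y theta x i else Y theta x i.
have gain_good theta x :
    15 / 32 * n%:R * (good theta x)%:R <= \sum_i gain theta x i.
  have g0 : 0 <= \sum_i gain theta x i.
    apply: sumr_ge0 => i _; rewrite /gain; have /andP[y0 y1] := Y01 theta x i.
    by case: ifP => // _; rewrite subr_ge0.
  have [gd|_] := boolP (good theta x); last by rewrite mulr0.
  have := Y_good gd; rewrite mulr1.
  have -> : \sum_i gain theta x i = n%:R / 2 -
      \sum_i (if theta i then Y theta x i else 2^-1 - Y theta x i).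
    have -> : n%:R / 2 = \sum_(i < n) (2^-1 : R) by rewrite sumr_const card_ord mulr_natl.
    by rewrite -sumrB; apply: eq_bigr => i _; rewrite /gain; case: ifP => _; ring.
  lra.
have gain_mean i : EE (@fair 'I_n) (fun theta =>
    EE (w theta) (fun x => gain theta x i)) <= 5 / 16.
  rewrite -(EE_resample (i := i)); last exact: fair_pmf.
  rewrite -[leRHS](EE_cst _ (@fair_pmf 'I_n)); apply: le_EE => [j|theta].
    exact: fair_pmf.
  rewrite big_bool /= /fair /gain !upd_same.
  under eq_EE do rewrite Y_flip.
  rewrite [X in 2^-1 * _ + 2^-1 * X](_ : _ = EE (w (upd theta i false)) (Y theta ^~ i)).
    rewrite EEB EE_cst//; have := Y_pair theta i; lra.
  by apply: eq_EE => x; rewrite Y_flip.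
have n0 : 0 < n%:R :> R by rewrite ltr0n.
rewrite -(ler_pM2l (_ : 0 < 15 / 32 * n%:R)) ?mulr_gt0//.
rewrite -EEZ; apply: (@le_trans _ _ (EE (@fair 'I_n) (fun theta =>
    \sum_i EE (w theta) (fun x => gain theta x i)))).
  apply: le_EE => [j|theta]; first exact: fair_pmf.
  by rewrite -EE_sum -EEZ; apply: le_EE.
rewrite EE_sum; apply: (@le_trans _ _ (\sum_(i < n) (5 / 16 : R))).
  by apply: ler_sum => i _; exact: gain_mean.
by rewrite sumr_const card_ord -[leLHS]mulr_natl; lra.
Qed.

End Assouad.

Local Open Scope classical_set_scope.
Local Open Scope ring_scope.

(** * Real-valued demand *)

Section NonmeasurableIntegrands.
Context d (T : measurableType d) (R : realType).
Variable mu : {measure set T -> \bar R}.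
Local Open Scope ereal_scope.

(* The integral of a nonnegative function is a supremum of integrals of simple
   functions, hence monotone without any measurability assumption. *)
Lemma le_ge0_integral (f g : T -> \bar R) :
  (forall x, 0 <= f x) -> (forall x, f x <= g x) ->
  \int[mu]_x f x <= \int[mu]_x g x.
Proof.
move=> f0 fg; have g0 x : 0 <= g x by apply: le_trans (fg x).
rewrite !ge0_integralTE//; apply: le_ereal_sup => _ [s sf <-].
by exists s => // x; apply: le_trans (fg x).
Qed.

Lemma integral_fin_valued (I : finType) (F : T -> I) (phi : I -> \bar R) :
  (forall i, measurable (F @^-1` [set i])) -> (forall i, 0 <= phi i) ->
  \int[mu]_x phi (F x) = \sum_(i : I) phi i * mu (F @^-1` [set i]).
Proof.
move=> mF phi0.
have mI i : measurable_fun setT (EFin \o (\1_(F @^-1` [set i]) : T -> R)).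
  by apply/measurable_EFinP; exact: measurable_indic.
have I0 i x : 0 <= (\1_(F @^-1` [set i]) x)%:E :> \bar R by rewrite lee_fin.
transitivity (\int[mu]_x \sum_(i : I) phi i * (\1_(F @^-1` [set i]) x)%:E).
  apply: eq_integral => x _; rewrite (bigD1 (F x))//= indicE mem_set// mule1.
  rewrite big1 ?adde0// => i iF; rewrite indicE memNset ?mule0//=.
  by move=> Fi; move: iF; rewrite Fi eqxx.
rewrite ge0_integral_sum//; last 2 first.
- by move=> i; apply: measurable_funeM; exact: mI.
- by move=> i x _; rewrite mule_ge0.
apply: eq_bigr => i _; rewrite ge0_integralZl//; last exact: mI.
by rewrite integral_indic// setIT.
Qed.

Variable E : set T.
Hypothesis mE : measurable E.

Lemma integral_ge_cst (f : T -> \bar R) (c : \bar R) :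
  (forall x, 0 <= f x) -> 0 <= c -> (forall x, E x -> c <= f x) ->
  c * mu E <= \int[mu]_x f x.
Proof.
move=> f0 c0 cf.
have -> : c * mu E = \int[mu]_x (c * (\1_E x)%:E).
  rewrite ge0_integralZl//; last first.
    by apply/measurable_EFinP; exact: measurable_indic.
  by rewrite integral_indic// setIT.
apply: le_ge0_integral => x; first by rewrite mule_ge0// lee_fin.
rewrite indicE; have [/set_mem/cf xE|_] := boolP (x \in E); first by rewrite mule1.
by rewrite mule0.
Qed.

Variables (I : finType) (F : T -> I) (phi : I -> \bar R).
Hypothesis mF : forall i, measurable (F @^-1` [set i]).
Hypothesis phi0 : forall i, 0 <= phi i.
Hypothesis E0 : mu (~` E) = 0.

(** Recording membership in [E] allows bounds that hold only on a set of full measure: off [E] the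
    step function is 0 in the lower bound and [+oo] in the upper one. *)
Let FE x := (F x, x \in E).

Let mFE ib : measurable (FE @^-1` [set ib]).
Proof.
case: ib => i b; have -> : FE @^-1` [set (i, b)] =
    F @^-1` [set i] `&` (if b then E else ~` E).
  apply/seteqP; split=> x; rewrite /FE /=.
    by move=> [<- <-]; split=> //; case: ifPn => [/set_mem|/negP xE /mem_set].
  by move=> [<-]; case: b => [/mem_set ->//|xE]; rewrite memNset.
by apply: measurableI => //; case: b => //; exact: measurableC.
Qed.

Let mu_true i : mu (FE @^-1` [set (i, true)]) = mu (F @^-1` [set i]).
Proof.
have D0 : mu (F @^-1` [set i] `\` E) = 0.
  apply: (subset_measure0 _ _ _ E0); last by move=> x [].
    exact: measurableD.
  exact: measurableC.
have -> : mu (F @^-1` [set i]) =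
    mu (F @^-1` [set i] `\` E) + mu (F @^-1` [set i] `&` E) by exact: measureDI.
rewrite D0 add0e; congr (mu _); apply/seteqP; split=> x; rewrite /FE /=.
  by move=> [<- /set_mem].
by move=> [<- /mem_set ->].
Qed.

Let mu_false i : mu (FE @^-1` [set (i, false)]) = 0.
Proof.
apply: (subset_measure0 _ _ _ E0) => //; first exact: measurableC.
by move=> x; rewrite /FE /= => -[_ xE] /mem_set; rewrite xE.
Qed.

Lemma integral_fin_ge (f : T -> \bar R) : (forall x, 0 <= f x) ->
  (forall x, E x -> phi (F x) <= f x) ->
  \sum_(i : I) phi i * mu (F @^-1` [set i]) <= \int[mu]_x f x.
Proof.
move=> f0 phif.
pose psi (ib : I * bool) := if ib.2 then phi ib.1 else 0.
have psi0 ib : 0 <= psi ib by rewrite /psi; case: ifP.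
have <- : \int[mu]_x psi (FE x) = \sum_(i : I) phi i * mu (F @^-1` [set i]).
  rewrite integral_fin_valued//.
  transitivity (\sum_(i : I) \sum_(b : bool) psi (i, b) * mu (FE @^-1` [set (i, b)])).
    by rewrite pair_bigA /=; apply: eq_bigr => -[].
  by apply: eq_bigr => i _; rewrite big_bool /psi /= mu_true mul0e adde0.
apply: le_ge0_integral => x; rewrite /psi /FE /=; first by case: ifP.
by case: ifPn => // /set_mem; exact: phif.
Qed.

Lemma integral_fin_le (f : T -> \bar R) : (forall x, 0 <= f x) ->
  (forall x, E x -> f x <= phi (F x)) ->
  \int[mu]_x f x <= \sum_(i : I) phi i * mu (F @^-1` [set i]).
Proof.
move=> f0 fphi.
pose psi (ib : I * bool) := if ib.2 then phi ib.1 else +oo.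
have psi0 ib : 0 <= psi ib by rewrite /psi; case: ifP.
have <- : \int[mu]_x psi (FE x) = \sum_(i : I) phi i * mu (F @^-1` [set i]).
  rewrite integral_fin_valued//.
  transitivity (\sum_(i : I) \sum_(b : bool) psi (i, b) * mu (FE @^-1` [set (i, b)])).
    by rewrite pair_bigA /=; apply: eq_bigr => -[].
  apply: eq_bigr => i _; rewrite big_bool /psi /= mu_true.
  by rewrite mu_false mule0 adde0.
apply: le_ge0_integral => x; rewrite /psi /FE /=; first exact: f0.
by case: ifPn => [/set_mem|_]; [exact: fphi | rewrite leey].
Qed.

End NonmeasurableIntegrands.

Lemma integral_dirac_le (R : realType) (a : measurableTypeR R)
  (f : measurableTypeR R -> \bar R) : (forall x, (0 <= f x)%E) ->
  (\int[\d_a]_x f x <= f a)%E.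
Proof.
move=> f0.
have pre (i : unit) : (fun=> tt) @^-1` [set i] = [set: measurableTypeR R].
  by apply/seteqP; split=> // x _; case: i.
have : (\int[\d_a]_x f x <=
    \sum_(i : unit) f a * \d_a ((fun=> tt) @^-1` [set i] : set (measurableTypeR R)))%E.
  apply: (@integral_fin_le _ _ R \d_a [set a] (measurable_set1 a) unit
    (fun=> tt) (fun=> f a)) => //.
  - by move=> i; rewrite pre.
  - by rewrite /= /dirac indicE memNset//=; apply.
  by move=> x ->.
rewrite (bigD1 tt)//= big1 => [|[]//]; rewrite adde0.
by rewrite (pre tt) diracT mule1.
Qed.

(** * Rounding demand to a grid *)

Section Grid.
Variables (R : realType) (M : nat).
Hypothesis M_gt0 : (0 < M)%N.
Local Notation RR := (measurableTypeR R).
Let M0 : 0 < M%:R :> R. Proof. by rewrite ltr0n. Qed.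

Lemma ltn_celln (u : R) :
  ((\sum_(i < M) (i%:R < u * M%:R)%R)%N < M.+1)%N.
Proof.
rewrite ltnS -[leqRHS](card_ord M) -sum1_card.
by apply: leq_sum => i _; case: (_ < _).
Qed.

(* Demand rounded up to the grid of step [1 / M]. *)
Definition cell (u : R) : 'I_M.+1 :=
  inord (\sum_(i < M) (i%:R < u * M%:R)%R)%N.

Lemma cell_le u : (cell u <= M)%N. Proof. by rewrite -ltnS ltn_ord. Qed.

Lemma ltn_cell k u : (k < M)%N -> (k < cell u)%N = (k%:R < u * M%:R).
Proof.
move=> kM; rewrite /cell inordK ?ltn_celln//
  (@sum_prefix M (fun i => i%:R < u * M%:R))// => i j ij.
by apply: le_lt_trans; rewrite ler_nat.
Qed.

Lemma cell_ge u : u <= 1 -> u * M%:R <= (cell u)%:R.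
Proof.
move=> u1; case: (ltnP (cell u) M) => cM.
  by rewrite leNgt -ltn_cell// ltnn.
have -> : (cell u : nat) = M by apply/eqP; rewrite eqn_leq cM -ltnS ltn_ord.
by rewrite ler_piMl// ltW.
Qed.

Lemma cell_lt u : 0 <= u -> (cell u)%:R < u * M%:R + 1.
Proof.
move=> u0; case E : (cell u : nat) => [|k].
  by rewrite ltr_wpDl// mulr_ge0// ltW.
rewrite -natr1 ltrD2r -ltn_cell; first by rewrite E.
by rewrite -ltnS -E ltn_ord.
Qed.

Lemma cell_homo u v : u <= v -> (cell u <= cell v)%N.
Proof.
move=> uv; rewrite leqNgt; apply/negP => vu.
have vM : (cell v < M)%N by apply: leq_trans vu (cell_le u).
have := vu; rewrite ltn_cell// => lt1; have := ltnn (cell v).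
by rewrite ltn_cell// (lt_le_trans lt1)// ler_wpM2r// ltW.
Qed.

Lemma measurable_ltn_cell k : measurable [set u : RR | (k < cell u)%N].
Proof.
have [kM|Mk] := ltnP k M.
  rewrite (_ : [set _ | _] = [set` `](k%:R / M%:R), +oo[%R]) => [|].
    exact: measurable_itv.
  apply/seteqP; split=> u /=; rewrite in_itv /= andbT ltn_cell// ltr_pdivrMr//.
rewrite (_ : [set _ | _] = set0)//; apply/seteqP; split=> u //=.
by rewrite ltnNge (leq_trans (cell_le u)).
Qed.

Lemma measurable_cell (i : 'I_M.+1) : measurable (cell @^-1` [set i] : set RR).
Proof.
have -> : cell @^-1` [set i] = [set u : RR | (i.-1 < cell u)%N || (i == 0%N :> nat)]
    `\` [set u : RR | (i < cell u)%N].
  apply/seteqP; split=> u /=.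
    by move=> <-; split; [case: (cell u : nat) => //= n; rewrite ltnSn
                         |rewrite ltnn].
  move=> [ui /negP iu]; apply/val_inj => /=.
  by move: ui iu; case: (i : nat) => [|n] /=; rewrite ?orbF ?orbT => *; lia.
apply: measurableD; last exact: measurable_ltn_cell.
case: (i == 0%N :> nat).
  by rewrite (_ : [set _ | _] = setT)//; apply/seteqP; split=> // u _ /=; rewrite orbT.
rewrite (_ : [set _ | _] = [set u : RR | (i.-1 < cell u)%N]).
  exact: measurable_ltn_cell.
by apply/seteqP; split=> u /=; rewrite orbF.
Qed.

Definition lawc (P : nat -> probability RR R) (t : nat) (d : 'I_M.+1) : R :=
  fine (P t (cell @^-1` [set d])).

Implicit Type P : nat -> probability RR R.

Lemma lawcE P t d : (lawc P t d)%:E = P t (cell @^-1` [set d]).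
Proof.
by rewrite /lawc fineK//; apply: fin_num_measure; exact: measurable_cell.
Qed.

Lemma sum_lawc P t (phi : nat -> R) :
  (\sum_(d : 'I_M.+1) (phi d)%:E * P t (cell @^-1` [set d]))%E
  = (Ex (lawc P t) phi)%:E.
Proof.
rewrite /Ex -sumEFin; apply: eq_bigr => d _.
by rewrite -lawcE -EFinM mulrC.
Qed.

Lemma lawc_pmf P t : pmf (lawc P t).
Proof.
split=> [d|]; first by rewrite fine_ge0.
apply: EFin_inj; transitivity (\int[P t]_x (1%:E : \bar R))%E.
  rewrite (@integral_fin_valued _ RR R (P t) _ cell (fun=> 1%:E) measurable_cell)//.
  rewrite [RHS](sum_lawc P t (fun=> 1)) /Ex.
  by under [in RHS]eq_bigr do rewrite mulr1.
by rewrite integral_cst// mul1e; exact: probability_setT.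
Qed.

End Grid.

Lemma Wv_ge0 (R : realType) (M : nat) (h p : nat -> R) S
    (P : nat -> 'I_M.+1 -> R) n t k :
  (forall t, 0 < h t <= 1) -> (forall t, 0 < p t <= 1) ->
  (forall t, pmf (P t)) -> 0 <= Wv h p S P n t k.
Proof.
move=> h01 p01 Pp; elim: n t k => [|n IH] t k; first by rewrite /Wv.
rewrite WvS /Gv -(Ex_cst 0 (Pp t)); apply: le_Ex => // d _; rewrite addr_ge0//.
have /andP[/ltW h0 _] := h01 t; have /andP[/ltW p0 _] := p01 t.
by rewrite /ucost addr_ge0// mulr_ge0.
Qed.

Lemma natrB_max (R : realType) (a b : nat) :
  (a - b)%N%:R = Num.max (a%:R - b%:R) 0 :> R.
Proof.
have [ab|ba] := leqP a b.
  rewrite max_r ?subr_le0 ?ler_nat//.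
  by move: ab; rewrite -subn_eq0 => /eqP ->.
by rewrite natrB ?max_l ?subr_ge0 ?ler_nat// ltnW.
Qed.

Section NewsvendorCost.
Variables (R : realType) (h p : R).
Hypotheses (h01 : 0 <= h <= 1) (p01 : 0 <= p <= 1).

Lemma period_cost_ge0 y u : 0 <= period_cost h p y u.
Proof.
have /andP[h0 _] := h01; have /andP[p0 _] := p01.
by rewrite addr_ge0// mulr_ge0// le_max lexx orbT.
Qed.

Lemma period_cost_lip y u y' u' :
  period_cost h p y u <= period_cost h p y' u' + `|(y - u) - (y' - u')|.
Proof.
have /andP[h0 h1] := h01; have /andP[p0 p1] := p01.
rewrite /period_cost -(opprB y u) -(opprB y' u').
move: (y - u) (y' - u') => w w'.
have n0 : 0 <= `|w - w'| by [].
have n1 : w - w' <= `|w - w'| by exact: ler_norm.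
have n2 : w' - w <= `|w - w'| by rewrite distrC; exact: ler_norm.
have mN (v : R) : Num.max (- v) 0 = Num.max v 0 - v.
  have [v0|v0] := leP 0 v; first by rewrite max_r ?oppr_le0// subrr.
  by rewrite max_l ?oppr_ge0 ?ltW// sub0r.
by rewrite !mN; have [w0|w0] := leP 0 w; have [w'0|w'0] := leP 0 w'; nra.
Qed.

End NewsvendorCost.

Lemma max0_lip (R : realType) (w w' : R) :
  `|Num.max w 0 - Num.max w' 0| <= `|w - w'|.
Proof.
have [w0|w0] := leP 0 w; have [w'0|w'0] := leP 0 w' => //.
- by rewrite subr0 ger0_norm//; apply: le_trans (ler_norm _); lra.
- rewrite sub0r normrN ger0_norm// distrC; apply: le_trans (ler_norm _); lra.
- by rewrite subrr normr0.
Qed.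

(** * Comparison of the real model with the gridded one *)

Section Discretization.
Variables (R : realType) (M T : nat) (h p : T.-tuple R).
Variable P : nat -> probability (measurableTypeR R) R.
Hypothesis M_gt0 : (0 < M)%N.
Hypothesis h01 : forall t : 'I_T, 0 < h`_t <= 1.
Hypothesis p01 : forall t : 'I_T, 0 < p`_t <= 1.
Hypothesis supp : forall t : 'I_T, P t [set u | 0 <= u <= 1] = 1%E.
Local Notation RR := (measurableTypeR R).

(** The value 1 beyond the horizon keeps every coefficient in $(0,1]$. *)
Definition coef (s : T.-tuple R) (t : nat) : R := if (t < T)%N then s`_t else 1.

Lemma coefE s t : (t < T)%N -> coef s t = s`_t.
Proof. by rewrite /coef => ->. Qed.

Lemma coef01 (s : T.-tuple R) : (forall t : 'I_T, 0 < s`_t <= 1) ->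
  forall t, 0 < coef s t <= 1.
Proof.
move=> s01 t; rewrite /coef; case: ifPn => [tT|_]; last by rewrite ltr01 lexx.
exact: (s01 (Ordinal tT)).
Qed.

Let hc := coef h.
Let pc := coef p.
Let hc01 := coef01 h01.
Let pc01 := coef01 p01.
Let law := lawc (M := M) P.
Let law_pmf : forall t, pmf (law t) := lawc_pmf M_gt0 P.
Let g : R := M%:R^-1.

Let M0 : 0 < M%:R :> R. Proof. by rewrite ltr0n. Qed.
Let g0 : 0 < g. Proof. by rewrite invr_gt0. Qed.

Lemma ucost_period t k d : (t < T)%N ->
  g * ucost hc pc t k d = period_cost h`_t p`_t (g * k%:R) (g * d%:R).
Proof.
move=> tT; rewrite /ucost /period_cost /hc /pc !coefE// !natrB_max -!mulrBr.
have maxg (v : R) : Num.max (g * v) 0 = g * Num.max v 0.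
  by rewrite maxr_pMr ?mulr0// ltW.
by rewrite !maxg; ring.
Qed.

Lemma cost_to_go_ge0 pi n t (past : t.-tuple (RR * RR * RR)) x :
  (n + t = T)%N -> (0 <= cost_to_go h p P pi n past x)%E.
Proof.
elim: n t past x => [|n IH] t past x ntT //=.
have tT : (t < T)%N by lia.
have nT : (n + t.+1 = T)%N by rewrite addnS.
apply: integral_ge0 => y _; apply: integral_ge0 => u _.
rewrite adde_ge0 ?IH//.
rewrite lee_fin period_cost_ge0//.
  by have /andP[/ltW -> ->] := h01 (Ordinal tT).
by have /andP[/ltW -> ->] := p01 (Ordinal tT).
Qed.

Lemma measurable_unit_itv : measurable [set u : RR | 0 <= u <= 1].
Proof.
rewrite (_ : [set _ | _] = [set` `[0, 1]]); first exact: measurable_itv.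
by apply/seteqP; split=> u /=; rewrite in_itv.
Qed.

Lemma supp_setC t : (t < T)%N -> P t (~` [set u | 0 <= u <= 1]) = 0%E.
Proof.
move=> tT; rewrite probability_setC ?(supp (Ordinal tT)) ?subee//.
exact: measurable_unit_itv.
Qed.

Let cell_err u : 0 <= u <= 1 -> u <= g * (cell M u)%:R < u + g.
Proof.
move=> /andP[u0 u1]; rewrite mulrC ler_pdivlMr// cell_ge//= ltr_pdivrMr//.
by rewrite mulrDl mulVf ?gt_eqF// cell_lt.
Qed.

Section LowerBound.
Variable pi : decision_rule R.
Hypothesis feas : feasible pi.
Let L := level hc pc T law.

(** Stock is rounded down and demand up, so the rounded leftover stock never exceeds the true one,
    and the optimal gridded cost is monotone in the stock. The period cost is 1-Lipschitz, so each
    period loses at most one grid step for the stock and one for the demand. The positive part keeps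
    integrands nonnegative, so that [le_ge0_integral] applies. *)
Lemma cost_to_go_ge n t (past : t.-tuple (RR * RR * RR)) x :
  (n + t = T)%N -> 0 <= x ->
  ((Num.max 0 (g * Wv hc pc L law n t (Num.truncn (x * M%:R)) - 2 * n%:R * g))%:E
     <= cost_to_go h p P pi n past x)%E.
Proof.
elim: n t past x => [|n IH] t past x ntT x0.
  by rewrite /= /Wv mulr0 mulr0 mul0r subr0 maxxx.
have tT : (t < T)%N by lia.
have nT : (n + t.+1 = T)%N by rewrite addnS.
have h01t : 0 <= h`_t <= 1 by have /andP[/ltW -> ->] := h01 (Ordinal tT).
have p01t : 0 <= p`_t <= 1 by have /andP[/ltW -> ->] := p01 (Ordinal tT).
set c := Num.max 0 _; have c0 : 0 <= c by rewrite le_max lexx.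
have mE : measurable [set y : RR | x <= y].
  rewrite (_ : [set _ | _] = [set` `[x, +oo[]); first exact: measurable_itv.
  by apply/seteqP; split=> u /=; rewrite in_itv /= andbT.
have c2g0 y u : (0 <= (period_cost h`_t p`_t y u)%:E +
    cost_to_go h p P pi n [tuple of ((x, y, Num.min u y) : RR * RR * RR) :: past]
      (Num.max (y - u) 0)%R)%E.
  rewrite adde_ge0//; first by rewrite lee_fin period_cost_ge0.
  exact: cost_to_go_ge0.
rewrite -[leLHS]mule1 -(feas (past, x)).
apply: integral_ge_cst => // [y|y /= xy]; first exact: integral_ge0.
have y0 : 0 <= y := le_trans x0 xy.
set k := Num.truncn (y * M%:R).
have /andP[ky yk] : k%:R <= y * M%:R < k.+1%:R.
  by apply: truncn_itv; rewrite mulr_ge0// ltW.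
have gk : g * k%:R <= y < g * k%:R + g.
  rewrite mulrC ler_pdivrMr// ky /= -[X in _ + X]mul1r -mulrDl natr1.
  by rewrite ltr_pdivlMr.
pose phi (d : nat) : R := Num.max 0 (g * ucost hc pc t k d - 2 * g) +
  Num.max 0 (g * Wv hc pc L law n t.+1 (k - d) - 2 * n%:R * g).
have phi0 d : 0 <= phi d by rewrite addr_ge0// le_max lexx.
apply: (@le_trans _ _ (Ex (law t) phi)%:E).
  rewrite lee_fin ge_max; apply/andP; split.
    by rewrite -(Ex_cst 0 (law_pmf t)); apply: le_Ex.
  have kk : (Num.truncn (x * M%:R) <= k)%N by rewrite le_truncn// ler_wpM2r.
  apply: (@le_trans _ _ (g * Gv hc pc L law n t k - 2 * n.+1%:R * g)).
    rewrite lerD2r ler_wpM2l ?(ltW g0)//.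
    exact: (Wv_level_le_Gv hc01 pc01 law_pmf ntT kk).
  rewrite /Gv -ExZ -[X in _ - X](Ex_cst _ (law_pmf t)) -ExB.
  apply: le_Ex => // d _; rewrite /phi -(natr1 n).
  have m1 : g * ucost hc pc t k d - 2 * g
     <= Num.max 0 (g * ucost hc pc t k d - 2 * g) by rewrite le_max lexx orbT.
  have m2 : g * Wv hc pc L law n t.+1 (k - d) - 2 * n%:R * g
    <= Num.max 0 (g * Wv hc pc L law n t.+1 (k - d) - 2 * n%:R * g).
    by rewrite le_max lexx orbT.
  by rewrite mulrDr; lra.
rewrite -(sum_lawc M_gt0 P t phi).
apply: (@integral_fin_ge _ RR R (P t) _ measurable_unit_itv _ (cell M)
  (fun d => (phi d)%:E)) => //.
- exact: measurable_cell.
- by move=> d; rewrite lee_fin.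
- exact: supp_setC.
move=> u u01; have /andP[u1 u2] := cell_err u01; have /andP[k1 k2] := gk.
rewrite /phi EFinD leeD//.
  rewrite lee_fin ge_max period_cost_ge0//= ucost_period//.
  rewrite lerBlDr; apply: le_trans (period_cost_lip h01t p01t _ _ y u) _.
  by rewrite lerD2l ler_norml; apply/andP; split; lra.
have x'0 : 0 <= Num.max (y - u) 0 by rewrite le_max lexx orbT.
apply: (le_trans _ (IH t.+1 _ (Num.max (y - u) 0) nT x'0)).
rewrite lee_fin ge_max !le_max lexx /=; apply/orP; right.
rewrite lerD2r ler_wpM2l ?(ltW g0)//.
apply: (Wv_level_mono hc01 pc01 law_pmf nT).
rewrite truncn_ge_nat; last by rewrite mulr_ge0 ?(ltW M0)// le_max lexx orbT.
have le0 : 0 <= Num.max (y - u) 0 * M%:R.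
  by rewrite mulr_ge0 ?(ltW M0)// le_max lexx orbT.
rewrite natrB_max ge_max le0 andbT.
apply: (@le_trans _ _ ((y - u) * M%:R)); last first.
  by rewrite ler_wpM2r ?(ltW M0)// le_max lexx.
have : u * M%:R <= (cell M u)%:R by apply: cell_ge => //; case/andP: u01.
by rewrite mulrBl; lra.
Qed.

End LowerBound.

Section UpperBound.
Variables (pi : decision_rule R) (S : nat -> nat).
Hypothesis piE : forall t (k : hist R t),
  pi k = (\d_(Num.max k.2 (g * (S t)%:R) : RR) : {measure set RR -> \bar R}).

(** Ordering up to a level and removing demand are 1-Lipschitz in the stock, so the distance to the
    grid stock grows by at most [g] per period; summing these errors gives the quadratic term. *)
Lemma cost_to_go_le n t (past : t.-tuple (RR * RR * RR)) x k :
  (n + t = T)%N -> 0 <= x ->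
  (cost_to_go h p P pi n past x <=
   (g * Wv hc pc S law n t k + n%:R * `|x - g * k%:R| + n%:R ^+ 2 * g)%:E)%E.
Proof.
elim: n t past x k => [|n IH] t past x k ntT x0.
  by rewrite /= /Wv mulr0 mul0r expr0n mul0r !addr0.
have tT : (t < T)%N by lia.
have nT : (n + t.+1 = T)%N by rewrite addnS.
have h01t : 0 <= h`_t <= 1 by have /andP[/ltW -> ->] := h01 (Ordinal tT).
have p01t : 0 <= p`_t <= 1 by have /andP[/ltW -> ->] := p01 (Ordinal tT).
rewrite [cost_to_go _ _ _ _ _ _ _]/= piE /=.
have c2g0 y u : (0 <= (period_cost h`_t p`_t y u)%:E +
    cost_to_go h p P pi n [tuple of ((x, y, Num.min u y) : RR * RR * RR) :: past]
      (Num.max (y - u) 0)%R)%E.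
  rewrite adde_ge0//; first by rewrite lee_fin period_cost_ge0.
  exact: cost_to_go_ge0.
apply: le_trans (integral_dirac_le _ _) _ => [y|]; first exact: integral_ge0.
set y := Num.max x _; set K := maxn k (S t); set del := `|x - g * k%:R|.
have del0 : 0 <= del by rewrite normr_ge0.
have yK : `|y - g * K%:R| <= del.
  have -> : g * K%:R = Num.max (g * k%:R) (g * (S t)%:R).
    by rewrite /K natr_max maxr_pMr// ltW.
  rewrite /y; set s := g * (S t)%:R.
  have mx v : Num.max v s = Num.max (v - s) 0 + s by rewrite addr_maxl subrK add0r.
  rewrite !mx opprD addrACA subrr addr0; apply: le_trans (max0_lip _ _) _.
  by rewrite opprB addrA subrK.
pose phi (d : nat) : R := g * (ucost hc pc t K d + Wv hc pc S law n t.+1 (K - d))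
  + (n.+1%:R * (del + g) + n%:R ^+ 2 * g).
have phi0 d : 0 <= phi d.
  rewrite /phi addr_ge0//; last first.
    by rewrite addr_ge0// mulr_ge0// ?addr_ge0 ?exprn_ge0// ltW.
  rewrite mulr_ge0 ?(ltW g0)// addr_ge0//; last exact: Wv_ge0.
  have /andP[/ltW a0 _] := hc01 t; have /andP[/ltW b0 _] := pc01 t.
  by rewrite /ucost addr_ge0// mulr_ge0.
apply: (@le_trans _ _ (Ex (law t) phi)%:E); last first.
  rewrite lee_fin /phi ExD Ex_cst// ExZ WvS /Gv -/K -(natr1 n).
  have : 0 <= n%:R * g by rewrite mulr_ge0// ltW.
  by lra.
rewrite -(sum_lawc M_gt0 P t phi).
apply: (@integral_fin_le _ RR R (P t) _ measurable_unit_itv _ (cell M)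
  (fun d => (phi d)%:E)) => //.
- exact: measurable_cell.
- by move=> d; rewrite lee_fin.
- exact: supp_setC.
move=> u u01; have /andP[u1 u2] := cell_err u01.
have x'0 : 0 <= Num.max (y - u) 0 by rewrite le_max lexx orbT.
have dist : `|(y - u) - (g * K%:R - g * (cell M u)%:R)| <= del + g.
  have -> : (y - u) - (g * K%:R - g * (cell M u)%:R) =
    (y - g * K%:R) + (g * (cell M u)%:R - u) by ring.
  apply: le_trans (ler_normD _ _) _; rewrite lerD//.
  by rewrite ger0_norm ?subr_ge0//; lra.
apply: (le_trans (leeD2l _ (IH t.+1 _ _ (K - cell M u)%N nT x'0))).
rewrite -EFinD lee_fin /phi mulrDr ucost_period//.
have c1 := period_cost_lip h01t p01t y u (g * K%:R) (g * (cell M u)%:R).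
have c2 : `|Num.max (y - u) 0 - g * (K - cell M u)%N%:R| <= del + g.
  rewrite natrB_max maxr_pMr ?(ltW g0)// mulr0 mulrBr.
  exact: le_trans (max0_lip _ _) dist.
have c3 := ler_wpM2l (ler0n R n) c2.
by rewrite -(natr1 n); lra.
Qed.

End UpperBound.

End Discretization.

(** * Truncation of demand at the caps *)

Section Truncation.
Variables (R : realType) (M T : nat) (h p : nat -> R) (A : nat -> nat).
Variable P : nat -> 'I_M.+1 -> R.
Hypothesis h01 : forall t, 0 < h t <= 1.
Hypothesis p01 : forall t, 0 < p t <= 1.
Hypothesis Pp : forall t, pmf (P t).
Hypothesis A_homo : forall s t, (s <= t)%N -> (A s <= A t)%N.

Definition tr (a : nat) (d : 'I_M.+1) : 'I_M.+1 := inord (minn d a).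

Lemma trE a d : tr a d = minn d a :> nat.
Proof. by rewrite inordK// ltnS geq_min -ltnS ltn_ord. Qed.

Definition trlaw (t : nat) (d' : 'I_M.+1) : R := \sum_(d | tr (A t) d == d') P t d.

Lemma Ex_trlaw t f : Ex (trlaw t) f = Ex (P t) (fun d => f (minn d (A t))).
Proof.
rewrite /Ex; under eq_bigr do rewrite mulr_suml big_mkcond.
rewrite exchange_big /=; apply: eq_bigr => d _.
rewrite (bigD1 (tr (A t) d))//= eqxx trE big1 ?addr0// => d' dd'.
by rewrite eq_sym (negbTE dd').
Qed.

Lemma trlaw_pmf t : pmf (trlaw t).
Proof.
split=> [d|]; first by apply: sumr_ge0 => i _; case: (Pp t).
have := Ex_trlaw t (fun=> 1); rewrite (Ex_cst _ (Pp t)) /Ex.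
by under eq_bigr do rewrite mulr1.
Qed.

(** A unit within the cap does not distinguish demands beyond it, and nondecreasing caps keep it
    there: [y - d <= A t <= A t.+1]. *)
Lemma gr_trlaw c n t y : (y <= A t)%N -> gr h p c trlaw n t y = gr h p c P n t y.
Proof.
elim: n t y => // n IH t y yA; rewrite !grS Ex_trlaw; apply: eq_Ex => d _.
have -> : (minn d (A t) < y)%N = (d < y)%N by apply/idP/idP; lia.
case: ltnP => // dy; rewrite (minn_idPl _) ?IH//; last by lia.
by have := A_homo (leqnSn t); lia.
Qed.

Lemma level_le_cap Q t : (forall t, pmf (Q t)) -> (t < T)%N ->
  0 < gq h p Q (T - t) t (A t).+1 -> (level (M := M) h p T Q t <= A t)%N.
Proof. by move=> Qp tT g0; rewrite -ltnS level_ltn. Qed.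

Lemma Wv_trlaw S1 S2 :
  (forall t, (t < T)%N -> (S1 t <= A t)%N) ->
  (forall t, (t < T)%N -> (S2 t <= A t)%N) ->
  (forall t, (S1 t <= M)%N) -> (forall t, (S2 t <= M)%N) ->
  Wv h p S1 P T 0 0 - Wv h p S2 P T 0 0
  = Wv h p S1 trlaw T 0 0 - Wv h p S2 trlaw T 0 0.
Proof.
move=> S1A S2A S1M S2M; rewrite !Wv_eq_sum_gr//; try exact: trlaw_pmf.
have addBK (a b c : R) : (a + b) - (a + c) = b - c by ring.
rewrite !addBK; congr (_ - _).
  apply: eq_bigr => y _; apply: eq_bigr => i yS; rewrite gr_trlaw//.
  exact: leq_trans yS (S1A _ (ltn_ord i)).
apply: eq_bigr => y _; apply: eq_bigr => i yS; rewrite gr_trlaw//.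
exact: leq_trans yS (S2A _ (ltn_ord i)).
Qed.

(** All levels lie within the caps, so the difference of costs is the same under the truncated law,
    whose own optimum is a stronger comparator. *)
Lemma regret_trlaw S :
  (forall t, (t < T)%N -> 0 < gq h p P (T - t) t (A t).+1) ->
  (forall t, (t < T)%N -> (S t <= A t)%N) -> (forall t, (S t <= M)%N) ->
  Wv h p S P T 0 0 - Wv h p (level h p T P) P T 0 0
  <= Wv h p S trlaw T 0 0 - Wv h p (level h p T trlaw) trlaw T 0 0.
Proof.
move=> gA SA SM; rewrite Wv_trlaw//; last 2 first.
- by move=> t tT; apply: level_le_cap => //; exact: gA.
- by move=> t; exact: level_le.
rewrite lerD2l lerN2; apply: Wv_level_opt => //; [exact: trlaw_pmf|exact: addn0].
Qed.

End Truncation.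

Section FiniteFeatures.
Context d (Om : measurableType d) (R : realType).

Lemma measurable_fin_preimage (V : finType) (F : Om -> V) (Y : set V) :
  (forall v, measurable (F @^-1` [set v])) -> measurable (F @^-1` Y).
Proof.
move=> mF; rewrite (_ : _ @^-1` _ = \bigcup_(v in Y) F @^-1` [set v]).
  by apply: fin_bigcup_measurable => // v _.
apply/seteqP; split=> w /=; first by exists (F w).
by move=> [v Yv ->].
Qed.

Lemma measurable_fin_comp (V : finType) (F : Om -> V) (f : V -> R) :
  (forall v, measurable (F @^-1` [set v])) ->
  measurable_fun setT (fun w => f (F w) : measurableTypeR R).
Proof.
move=> mF _ Y mY; rewrite setTI.
exact: (@measurable_fin_preimage _ F (f @^-1` Y)).
Qed.

Lemma measurable_ffun (I V : finType) (F : Om -> {ffun I -> V}) (f : {ffun I -> V}) :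
  (forall i, measurable ((fun w => F w i) @^-1` [set f i])) ->
  measurable (F @^-1` [set f]).
Proof.
move=> mF; rewrite (_ : _ @^-1` _ =
    \bigcap_(i in [set: I]) ((fun w => F w i) @^-1` [set f i])).
  by apply: fin_bigcap_measurable => //; exact: finite_finset.
apply/seteqP; split=> w /=; first by move=> Fw i _ /=; rewrite Fw.
by move=> H; apply/ffunP => i; exact: (H i).
Qed.

Lemma probability_fin (mu : probability Om R) (V : finType) (F : Om -> V)
    (Y : pred V) : (forall v, measurable (F @^-1` [set v])) ->
  mu (F @^-1` [set v | Y v]) = (\sum_(v | Y v) mu (F @^-1` [set v]))%E.
Proof.
move=> mF; rewrite -[LHS]mul1e.
transitivity (\int[mu]_w (if Y (F w) then 1 else 0 : \bar R))%E.
  rewrite -integral_cst; last exact: measurable_fin_preimage.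
  rewrite integral_mkcond; apply: eq_integral => w _; rewrite patchE.
  by rewrite mem_setE /= ; congr (if _ then _ else _); apply/idP/idP; rewrite inE.
rewrite (@integral_fin_valued _ _ R mu V F (fun v => if Y v then 1 else 0)%E)//.
  rewrite [RHS]big_mkcond; apply: eq_bigr => v _.
  by case: ifP => _; rewrite ?mul1e ?mul0e.
by move=> v; case: ifP.
Qed.

End FiniteFeatures.

(** * The learner *)

Section Learner.
Variables (R : realType) (M N T' m : nat).
Hypothesis M_gt0 : (0 < M)%N.
Let T := T'.+1.
Local Notation RR := (measurableTypeR R).
Implicit Types (h p a : T.-tuple R) (X : 'I_T -> 'I_N -> RR * RR).

Definition features := {ffun 'I_T -> {ffun 'I_N -> 'I_M.+1 * bool}}.

(* All the learner uses of the logs: sales truncated at the cap and rounded up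
   to the grid, and whether the boundary reaches the cap. *)
Definition feat a X : features :=
  [ffun t : 'I_T => [ffun j : 'I_N =>
    (tr (cell M a`_t) (cell M (X t j).1), a`_t <= (X t j).2)]].

Definition selected (f : features) (t : nat) : {set 'I_N} :=
  [set j in take m (enum [pred j | (f (inord t) j).2])]%SET.

Definition fdata (f : features) : data M N T' :=
  [ffun t : 'I_T => [ffun j : 'I_N => (f t j).1]].

Definition flevel h p (f : features) : nat -> nat :=
  level (coef h) (coef p) T (Phat R m (selected f) (fdata f)).

Definition target h p (f : features) (t : nat) : R :=
  M%:R^-1 * (flevel h p f t)%:R.

Definition coords (z : logs R T N) : 'I_T -> 'I_N -> RR * RR :=
  fun t j => tnth (tnth z t) j.

Lemma measurable_feat d (Om : measurableType d) a (X : Om -> 'I_T -> 'I_N -> RR * RR) f :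
  (forall t j, measurable_fun setT (fun w => X w t j)) ->
  measurable ((fun w => feat a (X w)) @^-1` [set f]).
Proof.
move=> mX; apply: (@measurable_ffun _ _ _ _ (fun w => feat a (X w))) => t.
rewrite (_ : _ @^-1` _ = (fun w => feat a (X w) t) @^-1` [set f t])//.
apply: (@measurable_ffun _ _ _ _ (fun w => feat a (X w) t)) => j.
have -> : (fun w => feat a (X w) t j) @^-1` [set f t j] =
  (fun w => X w t j) @^-1`
    ((fst @^-1` (cell M @^-1` [set d | tr (cell M a`_t) d = (f t j).1]) : set (RR * RR))
     `&` (snd @^-1` [set y : RR | (a`_t <= y) = (f t j).2])).
  apply/seteqP; split=> w /=; rewrite !ffunE; first by move=> <-.
  by case: (f t j) => d' b' /= [-> ->].
rewrite -[X in measurable X]setTI; apply: mX => //; apply: measurableI.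
  rewrite -[X in measurable X]setTI; apply: measurable_fst => //.
  by apply: measurable_fin_preimage => v; exact: measurable_cell.
rewrite -[X in measurable X]setTI; apply: measurable_snd => //.
case: (f t j).2.
  rewrite (_ : [set _ | _] = [set` `[a`_t, +oo[]); first exact: measurable_itv.
  by apply/seteqP; split=> y /=; rewrite in_itv /= andbT.
rewrite (_ : [set _ | _] = [set` `]-oo, a`_t[]); first exact: measurable_itv.
apply/seteqP; split=> y /=; rewrite in_itv /= ltNge; first by move=> ->.
by move/negbTE.
Qed.

Lemma measurable_coords t j : measurable_fun setT (fun z : logs R T N => coords z t j).
Proof.
apply: (measurableT_comp (measurable_tnth j)); exact: measurable_tnth.
Qed.

(** The logs enter only through finitely many features with measurable level sets. *)
Lemma measurable_target dS (S : measurableType dS) h p a t :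
  measurable_fun setT (fun w : S * logs R T N * hist R t =>
    Num.max w.2.2 (target h p (feat a (coords w.1.2)) t) : RR).
Proof.
apply: measurable_maxr; first exact: measurableT_comp.
apply: (@measurable_fin_comp _ _ _ _ (fun w : S * logs R T N * hist R t =>
   feat a (coords w.1.2)) (fun f => target h p f t)) => f.
apply: measurable_feat => t' j.
apply: (measurableT_comp (measurable_coords t' j)).
exact: measurableT_comp.
Qed.

Lemma card_selected (f : features) t :
  (m <= #|[set j | (f (inord t) j).2]%SET|)%N -> #|selected f t| = m.
Proof.
rewrite cardsE => mf; rewrite cardsE.
have /card_uniqP -> : uniq (take m (enum [pred j | (f (inord t) j).2])).
  by rewrite take_uniq// enum_uniq.
by rewrite size_takel// -cardE.
Qed.

End Learner.

Lemma Phat_ext (R : realType) M N T' m (I : nat -> {set 'I_N}) (x x' : data M N T') :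
  (forall t j, j \in I t -> x (inord t) j = x' (inord t) j) ->
  Phat R m I x = Phat R m I x'.
Proof.
move=> xx'; apply/funext => t; apply/funext => d; rewrite /Phat; congr (_ * _).
by apply: eq_bigr => j jI; rewrite xx'.
Qed.

(** * Success probability of the learner *)

Section Success.
Variables (R : realType) (M N T' m : nat) (r eps : R).
Let T := T'.+1.
Local Notation RR := (measurableTypeR R).
Variables (h p a : T.-tuple R) (b : 'I_T -> 'I_N -> R) (P : nat -> probability RR R).
Hypothesis inst : archive_instance r h p a b P.
Context d (Om : measurableType d) (mu : probability Om R).
Variable D : 'I_T -> 'I_N -> {RV mu >-> RR}.
Hypothesis law_D : forall t j A, measurable A -> distribution mu (D t j) A = P t A.
Hypothesis indep : mutually_independent mu (fun tj : 'I_T * 'I_N => D tj.1 tj.2).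
Hypothesis M_gt0 : (0 < M)%N.
Hypothesis m_gt0 : (0 < m)%N.
Hypothesis mE : Num.ceil (r * N%:R) = m%:Z.
Hypothesis eps_gt0 : 0 < eps.

Let C0 : R := 432 * 24 ^+ 3 + 9.
Hypothesis M_large : M%:R^-1 * (T%:R ^+ 2 + 2 * T%:R) <= eps / 2.
Hypothesis m_large : C0 * T%:R / Num.sqrt m%:R <= eps / 8.

Let h01 (t : 'I_T) : 0 < h`_t <= 1.
Proof.
have [-> _] := cost_gt0 inst t; rewrite -(cost_norm inst) /=.
by apply: le_trans (le_bigmax _ _ t); rewrite le_max lexx.
Qed.

Let p01 (t : 'I_T) : 0 < p`_t <= 1.
Proof.
have [_ ->] := cost_gt0 inst t; rewrite -(cost_norm inst) /=.
by apply: le_trans (le_bigmax _ _ t); rewrite le_max lexx orbT.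
Qed.

Let hc := coef h.
Let pc := coef p.
Let hc01 : forall t, 0 < hc t <= 1 := coef01 h01.
Let pc01 : forall t, 0 < pc t <= 1 := coef01 p01.
Let Pf := lawc (M := M) P.
Let Pf_pmf : forall t, pmf (Pf t) := lawc_pmf M_gt0 P.

Let A (t : nat) : nat := if (t < T)%N then (cell M a`_t : nat) else M.

Let AE (t : 'I_T) : A t = cell M a`_t.
Proof. by rewrite /A ltn_ord. Qed.

Let A_homo s t : (s <= t)%N -> (A s <= A t)%N.
Proof.
rewrite /A; case: (ltnP t T) => [tT st|_ _]; last by case: ifP => // _; exact: cell_le.
have sT := leq_ltn_trans st tT; rewrite sT; apply: cell_homo.
exact: (cap_homo inst (s := Ordinal sT) (t := Ordinal tT)).
Qed.

Let Pt := trlaw A Pf.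
Let Pt_pmf : forall t, pmf (Pt t) := trlaw_pmf A Pf_pmf.

(** Demands below the cap fall into cells up to [A t], so [cap_informative] makes the newsvendor
    derivative of the next unit positive. *)
Let cap_gq t : (t < T)%N -> 0 < gq hc pc Pf (T - t) t (A t).+1.
Proof.
move=> tT; rewrite -(subnSK tT); apply: gq_gt0 => //.
set F := Ex _ (fun d => (d < _)%N%:R).
have -> : Ex (Pf t) (fun d => ((A t).+1 <= d)%N%:R) = 1 - F.
  rewrite -[X in X - F](Ex_cst 1 (Pf_pmf t)) /F -ExB; apply: eq_Ex => k _.
  by rewrite ltnS; case: leqP => _; rewrite ?subr0 ?subrr.
have F_gt : p`_t / (h`_t + p`_t) < F.
  rewrite -lte_fin; apply: lt_le_trans (cap_informative inst (Ordinal tT)) _ => /=.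
  rewrite /F -(sum_lawc M_gt0) -[leLHS]mul1e.
  have mA : measurable [set u : RR | u < a`_t].
    rewrite (_ : [set _ | _] = [set` `]-oo, a`_t[]); first exact: measurable_itv.
    by apply/seteqP; split=> y /=; rewrite in_itv.
  rewrite -(@integral_fin_valued _ RR R (P t) _ (cell M)
    (fun k => ((k < (A t).+1)%N%:R)%:E)) => [|i|i]; last 2 first.
  - exact: measurable_cell.
  - by rewrite lee_fin.
  apply: (@integral_ge_cst _ RR R (P t) _ mA
    (fun u => ((cell M u < (A t).+1)%N%:R)%:E) 1%E) => [u| |u /= ua].
  - by rewrite lee_fin.
  - by rewrite lee_fin.
  rewrite ltnS (_ : (_ <= _)%N)// /A tT; apply: cell_homo; exact: ltW.
have [h0 p0] := cost_gt0 inst (Ordinal tT); move: h0 p0 => /= h0 p0.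
have hp0 : 0 < h`_t + p`_t by rewrite addr_gt0.
rewrite /hc /pc !coefE//; move: F_gt; rewrite ltr_pdivrMr//; nra.
Qed.

Let Z w : logs R T N := censor b (fun t j => D t j w).
Let f w := feat M a (coords (Z w)).

Let xs w : data M N T' :=
  [ffun t : 'I_T => [ffun j : 'I_N => tr (cell M a`_t) (cell M (D t j w))]].

Let I0 (t : nat) : {set 'I_N} :=
  [set j in take m (enum [pred j | a`_(inord t : 'I_T) <= b (inord t) j])]%SET.

Let coordsZ w t j : coords (Z w) t j = (Num.min (D t j w) (b t j), b t j).
Proof. by rewrite /coords /Z /censor !tnth_mktuple. Qed.

Let selectedE w : selected m (f w) = I0.
Proof.
apply/funext => t; rewrite /selected /I0.
rewrite (@eq_enum _ _ [pred j | a`_(inord t : 'I_T) <= b (inord t) j])// => j.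
by rewrite !inE !ffunE coordsZ.
Qed.

Let card_I0 t : #|I0 t| = m.
Proof.
have [w _] : exists w : Om, True.
  by exists (point : Om).
rewrite -(selectedE w); apply: card_selected.
have := cap_count inst (inord t).
rewrite (_ : [set j | ((f w) (inord t) j).2]%SET
  = [set j | a`_(inord t : 'I_T) <= b (inord t) j]%SET); last first.
  by apply/setP => j; rewrite !inE !ffunE coordsZ.
apply: contraTT; rewrite -ltnNge -ltNge => lt_m.
by rewrite mE ltz_nat.
Qed.

(** Truncation hides the censoring: $\min(\min(D,b),a)=\min(D,a)$ if $a\le b$, and [cell] is
    monotone. *)
Let Phat_f w : Phat R m (selected m (f w)) (fdata (f w)) = Phat R m I0 (xs w).
Proof.
rewrite selectedE; apply: Phat_ext => t j; rewrite inE => /mem_take.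
rewrite mem_enum inE !ffunE coordsZ /= => ab.
apply/val_inj; rewrite /= !trE.
rewrite minElt; case: ifP => // Db; have bD : b (inord t) j <= D (inord t) j w.
  by rewrite leNgt Db.
rewrite (minn_idPr (cell_homo M ab)).
by rewrite (minn_idPr (cell_homo M (le_trans ab bD))).
Qed.

Let lev (x : data M N T') := level hc pc T (Phat R m I0 x).

Let flevelE w : flevel m h p (f w) = lev (xs w).
Proof. by rewrite /flevel Phat_f. Qed.

Let lev_le_cap w t : (t < T)%N -> (lev (xs w) t <= A t)%N.
Proof.
move=> tT; apply: level_le_cap => //; first exact: Phat_pmf.
rewrite -(subnSK tT); apply: gq_gt0; first exact: Phat_pmf.
have out : (cell M a`_(inord t : 'I_T) < (A t).+1)%N.
  by rewrite -AE inordK.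
have xA j : (xs w (inord t) j < (A t).+1)%N.
  by rewrite !ffunE trE; exact: (leq_ltn_trans (geq_minr _ _) out).
rewrite !Ex_Phat (eq_bigr (fun=> 0)) => [|j _]; last by rewrite leqNgt xA.
rewrite big1_eq mulr0 mulr0 mulr_gt0 ?(andP (hc01 t)).1//.
rewrite mulr_gt0 ?invr_gt0 ?ltr0n// (eq_bigr (fun=> 1)) => [|j _].
  by rewrite sumr_const card_I0 ltr0n.
by rewrite xA.
Qed.

Let reg (x : data M N T') :=
  M%:R^-1 * (Wv hc pc (lev x) Pt T 0 0 - Wv hc pc (level hc pc T Pt) Pt T 0 0).

Let good := [pred x : data M N T' | reg x <= eps / 2].

Let reg_ge0 x : 0 <= reg x.
Proof.
rewrite mulr_ge0 ?invr_ge0// subr_ge0.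
by apply: Wv_level_opt => //; exact: addn0.
Qed.

Let EE_reg : EE (dw (T' := T') Pt) reg <= eps / 8.
Proof.
apply: le_trans m_large; rewrite EEZ.
have := @EE_regret_le R M N T' m hc pc Pt I0 hc01 pc01 Pt_pmf m_gt0 card_I0.
have Mi : 0 <= M%:R^-1 :> R by rewrite invr_ge0.
move=> /(ler_wpM2l Mi) /le_trans; apply.
by rewrite mulKf// pnatr_eq0 -lt0n.
Qed.

(** Mean regret at most [eps / 8] against the threshold [eps / 2]; the other half of [eps] pays for
    the grid. *)
Let mass_good : 3 / 4 <= \sum_(x | good x) pw (dw (T' := T') Pt) x.
Proof.
have wp := @dw_pmf R M N T' Pt Pt_pmf.
have [pw0 pw1] := pw_pmf wp.
have : EE (dw (T' := T') Pt) (fun x => eps / 2 * (~~ good x)%:R) <= eps / 8.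
  apply: le_trans EE_reg; apply: le_EE => // x; rewrite /good /= -ltNge.
  by case: ltP => [/ltW|_]; rewrite ?mulr1 ?mulr0.
rewrite EEZ.
have -> : EE (dw (T' := T') Pt) (fun x => (~~ good x)%:R)
    = 1 - \sum_(x | good x) pw (dw (T' := T') Pt) x.
  rewrite -[X in X - _]pw1 [X in X - _](bigID good)/= [X in X - _]addrC addrK.
  rewrite /EE [RHS]big_mkcond.
  by apply: eq_bigr => x _ /=; case: (reg x <= _); rewrite /= ?mulr0 ?mulr1.
move=> H; rewrite leNgt -subr_gt0; apply/negP => /(mulr_gt0 eps_gt0).
by rewrite mulrBr; lra.
Qed.

Let mD (t : 'I_T) j (B : set RR) : measurable B -> measurable (D t j @^-1` B).
Proof. by move=> mB; rewrite -[X in measurable X]setTI; exact: measurable_funP. Qed.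

Let m_tr a' (d' : 'I_M.+1) : measurable ((fun u => tr a' (cell M u)) @^-1` [set d'] : set RR).
Proof.
apply: (@measurable_fin_preimage _ RR _ (cell M) [set k | tr a' k = d']) => v.
exact: measurable_cell.
Qed.

Let P_tr (t : 'I_T) d' :
  P t ((fun u => tr (cell M a`_t) (cell M u)) @^-1` [set d']) = (Pt t d')%:E.
Proof.
have := @probability_fin _ RR R (P t) _ (cell M)
  (fun k => tr (cell M a`_t) k == d') (measurable_cell M_gt0).
rewrite (_ : _ @^-1` [set v | _] =
  (fun u => tr (cell M a`_t) (cell M u)) @^-1` [set d']); last first.
  by apply/seteqP; split=> u /= /eqP.
move=> ->; rewrite /Pt /trlaw AE -sumEFin; apply: eq_bigr => k _.
by rewrite lawcE.
Qed.

Let m_xs x : measurable (xs @^-1` [set x]).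
Proof.
apply: measurable_ffun => t.
rewrite (_ : _ @^-1` _ = (fun w => xs w t) @^-1` [set x t])//.
apply: (@measurable_ffun _ _ _ _ (fun w => xs w t)) => j.
rewrite (_ : _ @^-1` _ =
  D t j @^-1` ((fun u => tr (cell M a`_t) (cell M u)) @^-1` [set x t j])).
  by apply: mD; exact: m_tr.
by apply/seteqP; split=> w /=; rewrite !ffunE.
Qed.

Let mu_xs x : mu (xs @^-1` [set x]) = (pw (dw (T' := T') Pt) x)%:E.
Proof.
pose B (i : 'I_T * 'I_N) : set RR :=
  (fun u => tr (cell M a`_i.1) (cell M u)) @^-1` [set x i.1 i.2].
have -> : xs @^-1` [set x] = \bigcap_(i in [set` [set: 'I_T * 'I_N]%SET])
    (D i.1 i.2 @^-1` B i).
  apply/seteqP; split=> w /=.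
    by move=> xsw i _; rewrite /B /= -xsw !ffunE.
  move=> H; apply/ffunP => t; apply/ffunP => j; rewrite !ffunE.
  by apply: (H (t, j)); rewrite /= inE.
rewrite (indep [set: 'I_T * 'I_N]%SET (A := B)); last by move=> i; exact: m_tr.
rewrite (eq_bigr (fun i : 'I_T * 'I_N => (Pt i.1 (x i.1 i.2))%:E)); last first.
  by move=> i _; rewrite -P_tr -(law_D _ i.2)//; exact: m_tr.
rewrite prodEFin; congr EFin.
rewrite (eq_bigl xpredT) => [|i]; last by rewrite inE.
by rewrite -(pair_bigA _ (fun (t : 'I_T) (j : 'I_N) => Pt t (x t j))).
Qed.

Variable pi : Om -> decision_rule R.
Hypothesis piE : forall w t (k : hist R t), pi w k =
  (\d_(Num.max k.2 (target m h p (f w) t) : RR) : {measure set RR -> \bar R}).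
Hypothesis pi_f : forall w w', f w = f w' -> eps_optimal h p P eps (pi w) 0 ->
  eps_optimal h p P eps (pi w') 0.

Let good_eps_optimal w : good (xs w) -> eps_optimal h p P eps (pi w) 0.
Proof.
move=> gw; rewrite /eps_optimal /value.
have supp := demand_supp inst.
have up : (cost_to_go h p P (pi w) T [tuple] 0 <=
    (M%:R^-1 * Wv hc pc (lev (xs w)) Pf T 0 0 + M%:R^-1 * T%:R ^+ 2)%:E)%E.
  have := @cost_to_go_le R M T h p P M_gt0 h01 p01 supp (pi w) (flevel m h p (f w))
    _ T 0 [tuple] 0 0 (addn0 T) (lexx 0).
  rewrite flevelE mulr0 subrr normr0 mulr0 addr0 [_ ^+ 2 * _]mulrC; apply.
  by move=> t k; rewrite piE -flevelE.
have low : ((M%:R^-1 * Wv hc pc (level hc pc T Pf) Pf T 0 0 - 2 * T%:R * M%:R^-1)%:E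
    <= opt_value h p P 0)%E.
  apply: le_ereal_inf_tmp => _ [q fq <-].
  apply: le_trans (cost_to_go_ge M_gt0 h01 p01 supp fq [tuple] (addn0 T) (lexx 0)).
  by rewrite mul0r truncn0 lee_fin le_max lexx orbT.
apply: le_trans (leeB up low) _; rewrite -EFinB lee_fin.
have := regret_trlaw hc01 pc01 Pf_pmf A_homo cap_gq (@lev_le_cap w)
  (fun t => level_le hc pc T (Phat R m I0 (xs w)) t).
have Mi : 0 <= M%:R^-1 :> R by rewrite invr_ge0.
move=> /(ler_wpM2l Mi) H; have := le_trans H gw.
by move: M_large; rewrite mulrBr; lra.
Qed.

(** By [pi_f] the success event is a union of feature classes, hence measurable; it contains the
    good samples, whose law is given by [mu_xs]. *)
Lemma success : ((3 / 4)%:E <= mu [set w | eps_optimal h p P eps (pi w) 0])%E.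
Proof.
have mf f0 : measurable (f @^-1` [set f0]).
  apply: measurable_feat => // t j.
  rewrite (_ : (fun w => _) = fun w => (Num.min (D t j w) (b t j) : RR, b t j : RR)).
    apply: measurable_fun_pair; last exact: measurable_cst.
    by apply: measurable_minr; [exact: (measurable_funP (D t j))|exact: measurable_cst].
  by apply/funext => w; rewrite coordsZ.
have mB : measurable [set w | eps_optimal h p P eps (pi w) 0].
  rewrite (_ : [set _ | _] =
    f @^-1` [set f0 | exists2 w, f w = f0 & eps_optimal h p P eps (pi w) 0]).
    exact: measurable_fin_preimage.
  apply/seteqP; split=> w /=; first by exists w.
  by move=> [w' ff'] /(pi_f ff').
apply: (@le_trans _ _ (mu (xs @^-1` [set x | good x]))).
  rewrite (@probability_fin _ Om R mu _ xs good m_xs).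
  rewrite (eq_bigr (fun x => (pw (dw (T' := T') Pt) x)%:E)) => [|x _]; last first.
    exact: mu_xs.
  by rewrite sumEFin lee_fin mass_good.
apply: le_measure; rewrite ?inE//.
  by apply: measurable_fin_preimage => v; exact: m_xs.
Qed.

End Success.

Section UpperRate.
Variable R : realType.
Local Notation RR := (measurableTypeR R).
Implicit Types (r eps : R).

Lemma suffices_large T' N r eps : 0 < r -> 0 < eps ->
  (8 * (432 * 24 ^+ 3 + 9) * T'.+1%:R / eps) ^+ 2 <= r * N%:R ->
  suffices T'.+1 eps r N.
Proof.
set C0 : R := 432 * 24 ^+ 3 + 9; have C0_gt0 : 0 < C0.
  apply: ltr_wpDl; last exact: ltr0Sn.
  by apply: mulr_ge0; [exact: ler0n|apply: exprn_ge0; exact: ler0n].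
move=> r0 eps0 N_large; set T := T'.+1.
have T_gt0 : 0 < T%:R :> R by rewrite ltr0n.
have K0 : 0 < 8 * C0 * T%:R / eps by rewrite divr_gt0 ?mulr_gt0.
have rN0 : 0 < r * N%:R by rewrite (lt_le_trans _ N_large)// exprn_gt0.
have [m mE] : exists m : nat, Num.ceil (r * N%:R) = m%:Z.
  by exists `|Num.ceil (r * N%:R)|%N; rewrite gez0_abs// ceil_ge0 (lt_trans _ rN0).
have rNm : r * N%:R <= m%:R.
  by rewrite -[m%:R]/(m%:Z%:~R) -mE ceil_ge.
have m_gt0 : (0 < m)%N by rewrite -(ltr_nat R) (lt_le_trans rN0).
have [M M_gt0 M_large] : exists2 M, (0 < M)%N &
    M%:R^-1 * (T%:R ^+ 2 + 2 * T%:R) <= eps / 2.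
  pose B : R := 2 * (T%:R ^+ 2 + 2 * T%:R) / eps.
  have B0 : 0 <= B.
    by rewrite divr_ge0 ?(ltW eps0)// mulr_ge0// addr_ge0 ?exprn_ge0 ?mulr_ge0.
  have /andP[_ /ltW MB] := truncn_itv B0.
  exists (Num.truncn B).+1 => //; rewrite mulrC ler_pdivrMr ?ltr0n//.
  by move: MB; rewrite {1}/B ler_pdivrMr//; lra.
have m_large : C0 * T%:R / Num.sqrt m%:R <= eps / 8.
  have s0 : 0 < Num.sqrt m%:R :> R by rewrite sqrtr_gt0 ltr0n.
  have : 8 * C0 * T%:R / eps <= Num.sqrt m%:R.
    rewrite -(ler_pXn2r (n := 2))// ?nnegrE ?(ltW K0) ?(ltW s0)//.
    by rewrite sqr_sqrtr//; exact: (le_trans N_large rNm).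
  by rewrite ler_pdivrMr// => H; rewrite ler_pdivrMr//; lra.
exists _, unit, (\d_tt : probability unit R).
exists (fun h p a t => kdirac (@measurable_target R M N T' m M_gt0 _ unit h p a t)).
split=> [h p a s z t k|h p a b P inst d Om mu D law_D indep].
  by rewrite /= diracE mem_set//= le_max lexx.
rewrite /product_measure1 integral_dirac// diracT mul1e /=.
pose pi w : decision_rule R := fun t k =>
  kdirac (@measurable_target R M N T' m M_gt0 _ unit h p a t)
    (tt, censor b (fun t j => D t j w), k).
rewrite (_ : xsection _ _ = [set w | eps_optimal h p P eps (pi w) 0]); last first.
  by apply/seteqP; split=> w; rewrite /xsection /= inE.
apply: (@success R M N T' m r eps h p a b P inst _ Om mu D law_D indep M_gt0 m_gt0
  mE eps0 M_large m_large pi).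
  by move=> w t k.
move=> w w' ff'; have -> // : pi w = pi w'.
apply: functional_extensionality_dep => t; apply/funext => k.
have piE v : pi v t k = (\d_(Num.max k.2 (target m h p
    (feat M a (coords (censor b (fun t j => D t j v)))) t) : RR)
    : {measure set RR -> \bar R}) by [].
by rewrite !piE ff'.
Qed.

Lemma Mcov_le T' r eps : 0 < r <= 1 -> 0 < eps <= T'.+1%:R / 512 ->
  (Mcov T'.+1 eps r <=
    (2 * (8 * (432 * 24 ^+ 3 + 9)) ^+ 2 * (T'.+1%:R ^+ 3 / (r * eps ^+ 2)))%:E)%E.
Proof.
move=> /andP[r0 r1] /andP[e0 e1]; set C1 : R := 8 * (432 * 24 ^+ 3 + 9).
have C1_ge1 : 1 <= C1.
  have : 0 <= 432 * 24 ^+ 3 :> R.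
    by apply: mulr_ge0; [exact: ler0n|apply: exprn_ge0; exact: ler0n].
  by rewrite /C1; lra.
set T := T'.+1; have T1 : 1 <= T%:R :> R by rewrite ler1n.
pose K : R := (C1 * T%:R / eps) ^+ 2 / r.
have eT : eps <= T%:R by move: e1; rewrite -/T; lra.
have K1 : 1 <= K.
  have q1 : 1 <= C1 * T%:R / eps.
    by rewrite ler_pdivlMr// mul1r (le_trans eT)// ler_peMl//; lra.
  by rewrite /K ler_pdivlMr// mul1r (le_trans r1)// exprn_ege1.
have K0 : 0 <= K by lra.
(* [N <= K + 1 <= 2 * K]; here [K >= 1] uses [eps <= T] and [r <= 1]. *)
pose N := (Num.truncn K).+1.
have /andP[KN1 KN2] := truncn_itv K0.
have sN : suffices T eps r N.
  apply: suffices_large => //; rewrite -/C1.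
  by rewrite [leRHS]mulrC -ler_pdivrMr//; exact: (ltW KN2).
apply: (@le_trans _ _ (T%:R%:E * N%:R%:E)%E).
  rewrite /Mcov; apply: lee_wpmul2l; first by rewrite lee_fin ler0n.
  by apply: ereal_inf_lbound => /=; exists N.
rewrite -EFinM lee_fin.
have -> : 2 * C1 ^+ 2 * (T%:R ^+ 3 / (r * eps ^+ 2)) = T%:R * (2 * K).
  by rewrite /K; field; rewrite !gt_eqF.
by rewrite ler_wpM2l// -(natr1 (Num.truncn K)); lra.
Qed.

End UpperRate.

(** * Expected decisions of a policy *)

Section ExpectedDecision.
Variable R : realType.
Local Notation RR := (measurableTypeR R).
Implicit Types (P : nat -> probability RR R) (pi : decision_rule R)
  (f g : RR -> \bar R).

Definition next_hist t (w : hist R t * RR * RR) : hist R t.+1 :=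
  ([tuple of ((w.1.1.2, w.1.2, Num.min w.2 w.1.2) : RR * RR * RR) :: w.1.1.1],
   Num.max (w.1.2 - w.2) 0).

Lemma measurable_next_hist t : measurable_fun setT (@next_hist t).
Proof.
have m1 : measurable_fun setT (fun w : hist R t * RR * RR => w.1.1.2 : RR).
  by apply: measurableT_comp => //; apply: measurableT_comp.
have m2 : measurable_fun setT (fun w : hist R t * RR * RR => w.1.2 : RR).
  exact: measurableT_comp.
have m3 : measurable_fun setT (fun w : hist R t * RR * RR => w.2 : RR).
  exact: measurable_snd.
apply: measurable_fun_pair; last first.
  apply: measurable_maxr; last exact: measurable_cst.
  exact: measurable_funB.
apply: measurable_cons.
  apply: measurable_fun_pair; first exact: measurable_fun_pair.
  exact: measurable_minr.
exact: (measurableT_comp measurable_fst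
  (measurableT_comp measurable_fst measurable_fst)).
Qed.

Definition measurable_rule pi := forall t (F : hist R t * RR -> \bar R),
  (forall w, 0 <= F w)%E -> measurable_fun setT F ->
  measurable_fun setT (fun k => \int[pi t k]_y F (k, y))%E.

Variable pi : decision_rule R.
Hypothesis m_pi : measurable_rule pi.
Hypothesis pi1 : forall t (k : hist R t), pi k setT = 1%E.

(* Expectation of [f (y_(t + j))] given the history [k] at the start of period
   [t]. *)
Fixpoint Edec P f (j t : nat) (k : hist R t) {struct j} : \bar R :=
  if j is j'.+1 then
    (\int[pi k]_y \int[P t]_u Edec P f j' (next_hist (k, y, u)))%E
  else (\int[pi k]_y f y)%E.

Lemma Edec_ge0 P f j t (k : hist R t) : (forall y, 0 <= f y)%E ->
  (0 <= Edec P f j k)%E.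
Proof.
move=> f0; elim: j t k => [|j IH] t k /=; first exact: integral_ge0.
by apply: integral_ge0 => y _; apply: integral_ge0.
Qed.

Lemma measurable_step P t (G : hist R t.+1 -> \bar R) :
  (forall w, 0 <= G w)%E -> measurable_fun setT G ->
  measurable_fun setT
    (fun w : hist R t * RR => \int[P t]_u G (next_hist (w, u)))%E.
Proof.
move=> G0 mG; pose H (z : hist R t * RR * RR) := G (next_hist z).
have mH : measurable_fun setT H.
  exact: (measurableT_comp mG (@measurable_next_hist t)).
exact: (measurable_fun_fubini_tonelli_F (m2 := P t) H mH (fun _ => G0 _)).
Qed.

Lemma measurable_Edec P f j t : (forall y, 0 <= f y)%E ->
  measurable_fun setT f -> measurable_fun setT (@Edec P f j t).
Proof.
move=> f0 mf; elim: j t => [|j IH] t /=.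
  apply: (m_pi (F := fun w => f w.2)) => //; exact: measurableT_comp.
apply: (m_pi (F := fun w => (\int[P t]_u Edec P f j (next_hist (w, u)))%E)).
  by move=> w; apply: integral_ge0 => u _; exact: Edec_ge0.
by apply: measurable_step; [move=> w; exact: Edec_ge0|exact: IH].
Qed.

Lemma measurable_section t (k : hist R t) (F : hist R t * RR -> \bar R) :
  measurable_fun setT F -> measurable_fun setT (fun y => F (k, y)).
Proof.
move=> mF; apply: (measurableT_comp mF); exact: measurable_fun_pair.
Qed.

Section Linearity.
Variables (P : nat -> probability RR R) (f g : RR -> \bar R).
Hypothesis f0 : forall y, (0 <= f y)%E.
Hypothesis mf : measurable_fun setT f.

Lemma measurable_inner j t (k : hist R t) :
  measurable_fun setT (fun y => \int[P t]_u Edec P f j (next_hist (k, y, u)))%E.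
Proof.
apply: (measurable_section k (F := fun w =>
  (\int[P t]_u Edec P f j (next_hist (w, u)))%E)).
by apply: measurable_step; [move=> w; exact: Edec_ge0|exact: measurable_Edec].
Qed.

Lemma measurable_inner2 j t (k : hist R t) y :
  measurable_fun setT (fun u => Edec P f j (next_hist (k, y, u))).
Proof.
apply: (measurableT_comp (measurable_Edec P j f0 mf)).
apply: (measurableT_comp (@measurable_next_hist t)).
exact: measurable_fun_pair.
Qed.

End Linearity.

Lemma EdecD P f g j t (k : hist R t) :
  (forall y, 0 <= f y)%E -> measurable_fun setT f ->
  (forall y, 0 <= g y)%E -> measurable_fun setT g ->
  Edec P (fun y => f y + g y)%E j k = (Edec P f j k + Edec P g j k)%E.
Proof.
move=> f0 mf g0 mg; elim: j t k => [|j IH] t k /=; first by rewrite ge0_integralD.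
rewrite -ge0_integralD//; last 4 first.
- by move=> y _; apply: integral_ge0 => u _; exact: Edec_ge0.
- exact: measurable_inner.
- by move=> y _; apply: integral_ge0 => u _; exact: Edec_ge0.
- exact: measurable_inner.
apply: eq_integral => y _; rewrite -ge0_integralD//.
- by apply: eq_integral => u _; rewrite IH.
- by move=> u _; exact: Edec_ge0.
- exact: measurable_inner2.
- by move=> u _; exact: Edec_ge0.
- exact: measurable_inner2.
Qed.

Lemma EdecZ P f c j t (k : hist R t) : (0 <= c)%E ->
  (forall y, 0 <= f y)%E -> measurable_fun setT f ->
  Edec P (fun y => c * f y)%E j k = (c * Edec P f j k)%E.
Proof.
move=> c0 f0 mf; elim: j t k => [|j IH] t k /=; first by rewrite ge0_integralZl.
rewrite -ge0_integralZl//; last 2 first.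
- exact: measurable_inner.
- by move=> y _; apply: integral_ge0 => u _; exact: Edec_ge0.
apply: eq_integral => y _; rewrite -ge0_integralZl//.
- by apply: eq_integral => u _; rewrite IH.
- exact: measurable_inner2.
- by move=> u _; exact: Edec_ge0.
Qed.

Lemma Edec_cst P c j t (k : hist R t) : Edec P (fun=> c) j k = c.
Proof.
have Pc s : (\int[P s]_u c = c)%E.
  by rewrite integral_cst// [X in (_ * X)%E](_ : _ = 1%E) ?mule1//; exact: probability_setT.
elim: j t k => [|j IH] t k /=.
  by rewrite integral_cst// pi1 mule1.
under eq_integral => y _.
  under eq_integral do rewrite IH.
  by rewrite Pc; over.
by rewrite integral_cst// pi1 mule1.
Qed.

Lemma le_Edec P f g j t (k : hist R t) :
  (forall y, 0 <= f y)%E -> (forall y, f y <= g y)%E ->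
  (Edec P f j k <= Edec P g j k)%E.
Proof.
move=> f0 fg; elim: j t k => [|j IH] t k /=; first exact: le_ge0_integral.
apply: le_ge0_integral => y; first by apply: integral_ge0 => u _; exact: Edec_ge0.
by apply: le_ge0_integral => u; [exact: Edec_ge0|exact: IH].
Qed.

(* The decision of period [t + j] is taken before the demand of that period. *)
Lemma eq_Edec P P' f j t (k : hist R t) :
  (forall s, (t <= s < t + j)%N -> P s = P' s) -> Edec P f j k = Edec P' f j k.
Proof.
elim: j t k => [//|j IH] t k PP' /=.
have -> : P t = P' t by apply: PP'; rewrite leqnn addnS ltnS leq_addr.
apply: eq_integral => y _; apply: eq_integral => u _; apply: IH => s /andP[ts st].
by apply: PP'; rewrite (ltnW ts)/= -addSnnS.
Qed.

(** Each period cost is replaced by a lower bound given the decision, so that only the law of each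
    single decision matters. The measurable bounds [l] supply the linearity of integrals used
    here. *)
Lemma cost_to_go_ge_Edec (h p : seq R) P (l : nat -> RR -> \bar R) n t
    (k : hist R t) :
  (forall t, 0 <= h`_t) -> (forall t, 0 <= p`_t) ->
  (forall t y, 0 <= l t y)%E -> (forall t, measurable_fun setT (l t)) ->
  (forall s y, (s < t + n)%N ->
    l s y <= \int[P s]_u (period_cost h`_s p`_s y u)%:E)%E ->
  (\sum_(j < n) Edec P (l (t + j)%N) j k <= cost_to_go h p P pi n k.1 k.2)%E.
Proof.
move=> h0 p0 l0 ml; elim: n t k => [|n IH] t [past x] lP.
  by rewrite big_ord0.
rewrite /=.
have pc0 y u : (0 <= (period_cost h`_t p`_t y u)%:E)%E.
  by rewrite lee_fin addr_ge0// mulr_ge0// le_max lexx orbT.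
have mpc y : measurable_fun setT (fun u : RR => (period_cost h`_t p`_t y u)%:E).
  apply/measurable_EFinP; apply: measurable_funD; apply: measurable_funM.
  - exact: measurable_cst.
  - apply: measurable_maxr; last exact: measurable_cst.
    apply: measurable_funB; [exact: measurable_cst|exact: measurable_id].
  - exact: measurable_cst.
  - apply: measurable_maxr; last exact: measurable_cst.
    apply: measurable_funB; [exact: measurable_id|exact: measurable_cst].
have S0 (k' : hist R t.+1) : (0 <= \sum_(j < n) Edec P (l (t.+1 + j)%N) j k')%E.
  by apply: sume_ge0 => j _; exact: Edec_ge0.
have mS y : measurable_fun setT (fun u =>
    \sum_(j < n) Edec P (l (t.+1 + j)%N) j (next_hist ((past, x), y, u)))%E.
  by apply: emeasurable_sum => j; exact: measurable_inner2.
apply: (@le_trans _ _ (\int[pi (past, x)]_y \int[P t]_u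
    ((period_cost h`_t p`_t y u)%:E +
     \sum_(j < n) Edec P (l (t.+1 + j)%N) j (next_hist ((past, x), y, u)))))%E; last first.
  apply: le_ge0_integral => y.
    by apply: integral_ge0 => u _; rewrite adde_ge0.
  apply: le_ge0_integral => u; first by rewrite adde_ge0.
  rewrite leeD2l//; apply: (IH t.+1 (next_hist (past, x, y, u))) => s y' st.
  by apply: lP; rewrite -addSnnS.
apply: (@le_trans _ _ (\int[pi (past, x)]_y (l t y +
    \sum_(j < n) \int[P t]_u Edec P (l (t.+1 + j)%N) j (next_hist ((past, x), y, u)))))%E;
    last first.
  apply: le_ge0_integral => y.
    rewrite adde_ge0// sume_ge0// => j _; apply: integral_ge0 => u _.
    exact: Edec_ge0.
  rewrite ge0_integralD// ge0_integral_sum//; last 2 first.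
  - by move=> j; exact: measurable_inner2.
  - by move=> j u _; exact: Edec_ge0.
  by rewrite leeD2r// lP// addnS ltnS leq_addr.
rewrite ge0_integralD//; last 2 first.
- by move=> y _; apply: sume_ge0 => j _; apply: integral_ge0 => u _; exact: Edec_ge0.
- by apply: emeasurable_sum => j; exact: measurable_inner.
rewrite ge0_integral_sum//; last 2 first.
- by move=> j; exact: measurable_inner.
- by move=> j y _; apply: integral_ge0 => u _; exact: Edec_ge0.
rewrite big_ord_recl /= addn0; apply: leeD2l.
by apply: lee_sum => j _; rewrite addSnnS.
Qed.

End ExpectedDecision.

Lemma measurable_rule_kernel (R : realType) d (Om : measurableType d)
    (L : forall t, R.-pker (Om * hist R t) ~> measurableTypeR R) (w : Om) :
  measurable_rule (fun t k => L t (w, k)).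
Proof.
move=> t F F0 mF.
pose G (z : Om * hist R t * measurableTypeR R) := F (z.1.2, z.2).
have mG : measurable_fun setT G.
  apply: (measurableT_comp mF); apply: measurable_fun_pair => //.
  by apply: measurableT_comp => //.
have := measurable_fun_integral_finite_kernel G (L t) (fun _ => F0 _) mG.
move=> mI; have mw : measurable_fun setT (fun k : hist R t => (w, k)).
  exact: measurable_fun_pair.
exact: (measurableT_comp mI mw).
Qed.

(** * Hard instances *)

Lemma mnormalize1 d (T : measurableType d) (R : realType)
    (mu : {measure set T -> \bar R}) (P : probability T R) A :
  mu setT = 1%E -> mnormalize mu P A = mu A.
Proof. by move=> mu1; rewrite /mnormalize mu1 /= onee_eq0 /= invr1 mule1. Qed.

Section FiniteMixture.
Context d (T : measurableType d) (R : realType) (I : finType).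
Variables (w : I -> R) (x : I -> T) (x0 : T).

Let comp (k : nat) : {measure set T -> \bar R} :=
  if insub k is Some i then
    mscale (NngNum (normr_ge0 (w (enum_val (i : 'I_#|I|))))) \d_(x (enum_val i))
  else mzero.

(** Absolute values and normalization yield a probability for arbitrary weights; for a pmf it is the
    weighted sum of Dirac masses. *)
Definition mixture : probability T R := mnormalize (msum comp #|I|) \d_x0.

Hypothesis wp : pmf w.

Lemma mixtureE (A : set T) : mixture A = (\sum_i w i * (x i \in A)%:R)%:E.
Proof.
have sE (B : set T) : msum comp #|I| B = (\sum_i w i * (x i \in B)%:R)%:E.
  rewrite /msum -sumEFin.
  rewrite (big_enum_val (fun i => (w i * (x i \in B)%:R)%:E)) /=.
  apply: eq_bigr => k _; rewrite /comp valK /= /mscale /= diracE.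
  by rewrite ger0_norm -?EFinM//; case: wp.
have s1 : msum comp #|I| setT = 1%E.
  rewrite sE; congr EFin; rewrite -[RHS](wp.2); apply: eq_bigr => i _.
  by rewrite in_setT mulr1.
rewrite [LHS](mnormalize1 (mu := msum comp #|I|) \d_x0 A s1); exact: sE.
Qed.

End FiniteMixture.

Section TwoPointLaw.
Variables (R : realType) (q : R).
Hypothesis q01 : 0 <= q <= 1.
Local Notation RR := (measurableTypeR R).

Definition bitw (b : bool) : R := if b then q else 1 - q.

Lemma bitw_pmf : pmf bitw.
Proof.
move: q01 => /andP[q0 q1]; split=> [[]|]; rewrite /bitw ?subr_ge0//.
by rewrite big_bool /= addrC subrK.
Qed.

Definition bitd (b : bool) : RR := if b then 0 else 2^-1.

Definition two_point : probability RR R := mixture bitw bitd (0 : RR).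

Lemma two_pointE A : two_point A = (q * (0 \in A)%:R + (1 - q) * (2^-1 \in A)%:R)%:E.
Proof. by rewrite [LHS](mixtureE bitd (0 : RR) bitw_pmf) big_bool. Qed.

Let half_neq0 : (2^-1 : R) != 0. Proof. by rewrite invr_eq0 pnatr_eq0. Qed.

Let E : set RR := [set 0; 2^-1].

Let mE : measurable E.
Proof. by apply: measurableU; exact: measurable_set1. Qed.

Let F (y : RR) : bool := y == 0.

Let FE (b : bool) : F @^-1` [set b] = if b then [set 0] else ~` [set 0].
Proof.
case: b; apply/seteqP; split=> y; rewrite /F /=.
- by move/eqP.
- by move=> ->; exact: eqxx.
- by move=> /negbT/eqP.
- by move=> /eqP/negbTE.
Qed.

Let mF (b : bool) : measurable (F @^-1` [set b]).
Proof.
by rewrite FE; case: b; [|apply: measurableC]; exact: measurable_set1.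
Qed.

Let E0 : two_point (~` E) = 0%E.
Proof.
by rewrite two_pointE !memNset ?mulr0 ?addr0//= => -[]; rewrite /E; [right|left].
Qed.

Let sumE (f : RR -> \bar R) :
  (\sum_(b : bool) f (bitd b) * two_point (F @^-1` [set b]) =
   q%:E * f 0%R + (1 - q)%:E * f (2^-1)%R)%E.
Proof.
rewrite big_bool (FE true) (FE false) !two_pointE /bitd.
rewrite mem_set//= (memNset (u := 2^-1)) /=; last exact/eqP.
rewrite (memNset (u := 0)) /=; last by move/(_ erefl).
rewrite (mem_set (u := 2^-1)) /=; last exact/eqP.
by rewrite !mulr0 !mulr1 addr0 add0r muleC (muleC (1 - q)%:E).
Qed.

Lemma integral_two_point (f : RR -> \bar R) : (forall y, 0 <= f y)%E ->
  (\int[two_point]_y f y = q%:E * f 0%R + (1 - q)%:E * f (2^-1)%R)%E.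
Proof.
move=> f0; rewrite -sumE; apply/eqP; rewrite eq_le; apply/andP.
have fF y : E y -> f y = f (bitd (F y)).
  by case=> ->; rewrite /F ?eqxx//= (negbTE half_neq0).
have p0 b : (0 <= f (bitd b))%E by [].
split.
  apply: (@integral_fin_le _ RR R two_point E mE _ F (fun b => f (bitd b)) mF p0 E0 f f0).
  by move=> y /fF ->.
apply: (@integral_fin_ge _ RR R two_point E mE _ F (fun b => f (bitd b)) mF p0 E0 f f0).
by move=> y /fF ->.
Qed.

End TwoPointLaw.

Section HardInstance.
Variables (R : realType) (n : nat) (delta : R).
Hypothesis delta_ge0 : 0 <= delta.
Hypothesis delta_le : delta <= 16^-1.
Local Notation RR := (measurableTypeR R).
Implicit Types (theta : nat -> bool).

(* Odd periods have demand [1 / 2] for sure and empty the stock, which makes the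
   even periods independent newsvendor problems; [theta] decides whether the
   optimal level of period [2 i] is [0] or [1 / 2]. *)
Definition hard_bias theta (t : nat) : R :=
  if odd t then 0 else 2^-1 + (if theta t./2 then delta else - delta).

Definition hard_law theta (t : nat) : probability RR R := two_point (hard_bias theta t).

Definition hard_cost : n.*2.-tuple R := [tuple of nseq n.*2 1].

Lemma hard_bias01 theta t : 0 <= hard_bias theta t <= 1.
Proof.
rewrite /hard_bias; case: odd; first by rewrite lexx ler01.
have d0 := delta_ge0; have d1 := delta_le.
by case: (theta _); apply/andP; split; lra.
Qed.

Lemma hard_costE t : (t < n.*2)%N -> hard_cost`_t = 1.
Proof. by move=> tn; rewrite nth_nseq tn. Qed.

Lemma hard_cost_ge0 t : 0 <= hard_cost`_t.
Proof. by rewrite nth_nseq; case: ifP. Qed.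

Lemma period_cost11 y u : period_cost 1 1 y u = `|y - u| :> R.
Proof.
rewrite /period_cost !mul1r; have [yu|uy] := leP y u.
  by rewrite max_r ?subr_le0// max_l ?subr_ge0// add0r distrC ger0_norm ?subr_ge0.
by rewrite max_l ?subr_ge0 ?ltW// max_r ?subr_le0 ?ltW// addr0 gtr0_norm ?subr_gt0.
Qed.

(** Least expected cost of an even period: the probability [1 / 2 - delta] of the rarer demand times
    the distance [1 / 2]. *)
Definition vmin : R := 4^-1 - delta / 2.

Section Optimum.
Variable theta : nat -> bool.

Definition opt_target (t : nat) : R :=
  if odd t then 2^-1 else if theta t./2 then 0 else 2^-1.

Lemma measurable_opt_level t :
  measurable_fun setT (fun k : hist R t => Num.max k.2 (opt_target t) : RR).
Proof. by apply: measurable_maxr; [exact: measurable_snd|exact: measurable_cst]. Qed.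

Let pi : forall t, R.-pker (hist R t) ~> RR := fun t => kdirac (@measurable_opt_level t).

Let ctg := cost_to_go hard_cost hard_cost (hard_law theta) (fun t => pi t).

Let ctg_ge0 m t past x : (0 <= ctg m (t := t) past x)%E.
Proof.
elim: m t past x => [//|m IH] t past x; apply: integral_ge0 => y _.
apply: integral_ge0 => u _; rewrite adde_ge0 ?IH// lee_fin addr_ge0//;
  by apply: mulr_ge0; [exact: hard_cost_ge0|rewrite le_max lexx orbT].
Qed.

Let nxt t (past : t.-tuple (RR * RR * RR)) (x y u : RR) :=
  [tuple of ((x, y, Num.min u y) : RR * RR * RR) :: past].

Let ctg_step m t (past : t.-tuple (RR * RR * RR)) x y : (t < n.*2)%N ->
  Num.max x (opt_target t) = y ->
  (ctg m.+1 past x <=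
    (hard_bias theta t)%:E *
      (`|y|%:E + ctg m (nxt past x y 0%R) (Num.max y 0)%R) +
    (1 - hard_bias theta t)%:E *
      (`|y - 2^-1|%:E + ctg m (nxt past x y (2^-1)%R) (Num.max (y - 2^-1) 0)%R))%E.
Proof.
move=> tn yE; rewrite /ctg [cost_to_go _ _ _ _ _ _ _]/= -/ctg hard_costE//.
have F0 z u (past' : t.+1.-tuple (RR * RR * RR)) :
    (0 <= (period_cost 1 1 z u)%:E + ctg m past' (Num.max (z - u) 0)%R)%E.
  by rewrite adde_ge0 ?ctg_ge0// lee_fin period_cost11.
apply: le_trans (integral_dirac_le _ _) _ => [z|]; first exact: integral_ge0.
by rewrite (integral_two_point (hard_bias01 theta t))// !period_cost11 subr0 yE.
Qed.

Let odd_step m i (past : i.*2.+1.-tuple (RR * RR * RR)) x :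
  (i.*2.+1 < n.*2)%N -> 0 <= x <= 2^-1 ->
  exists past', (ctg m.+1 (t := i.*2.+1) past x <= ctg m (t := i.*2.+2) past' 0)%E.
Proof.
move=> tn /andP[x0 x1].
have yE : Num.max x (opt_target i.*2.+1) = 2^-1.
  by rewrite /opt_target /= odd_double /= max_r.
have := @ctg_step m _ past x _ tn yE; rewrite /hard_bias /= odd_double /=.
rewrite mul0e add0e subr0 mul1e subrr normr0 maxxx add0e => H.
by eexists; exact: H.
Qed.

Lemma opt_policy_cost m i past : (m + i <= n)%N ->
  (ctg m.*2 (t := i.*2) past 0 <= (m%:R * vmin)%:E)%E.
Proof.
elim: m i past => [|m IH] i past min; first by rewrite mul0r lee_fin.
have tn : (i.*2 < n.*2)%N by lia.
have tn1 : (i.*2.+1 < n.*2)%N by lia.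
have min1 : (m + i.+1 <= n)%N by lia.
have later past' x : 0 <= x <= 2^-1 ->
    (ctg m.*2.+1 (t := i.*2.+1) past' x <= (m%:R * vmin)%:E)%E.
  by move=> /(@odd_step m.*2 _ past' _ tn1)[past'' /le_trans]; apply; exact: IH min1.
have /andP[q0 q1] := hard_bias01 theta i.*2.
pose y : R := if theta i then 0 else 2^-1.
have yE : y = if theta i then 0 else 2^-1 by [].
apply: (le_trans (@ctg_step m.*2.+1 _ past 0 y tn _)).
  by rewrite /y /opt_target odd_double /= doubleK; case: ifP => _; rewrite ?maxxx ?max_r.
have y01 : 0 <= y <= 2^-1 by rewrite yE; case: ifP => _; apply/andP; split; lra.
apply: (@le_trans _ _ ((hard_bias theta i.*2)%:E * (`|y|%:E + (m%:R * vmin)%:E) +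
   (1 - hard_bias theta i.*2)%:E * (`|y - 2^-1|%:E + (m%:R * vmin)%:E))%E).
  have /andP[y0 y1] := y01.
  apply: leeD; (apply: lee_wpmul2l; first by rewrite lee_fin ?subr_ge0);
    (apply: leeD; first by []); apply: later.
    by rewrite max_l.
  by rewrite max_r ?lexx/= ?subr_le0// invr_ge0.
rewrite -!EFinD lee_fin -(natr1 m).
rewrite yE /hard_bias odd_double /= doubleK /vmin.
have d0 := delta_ge0; move: (m%:R : R) => v; case: (theta i).
  by rewrite normr0 sub0r normrN ger0_norm ?invr_ge0//; lra.
by rewrite subrr normr0 ger0_norm ?invr_ge0//; lra.
Qed.

Lemma opt_value_hard :
  (opt_value hard_cost hard_cost (hard_law theta) 0 <= (n%:R * vmin)%:E)%E.
Proof.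
apply: ge_ereal_inf; exists (value hard_cost hard_cost (hard_law theta) (fun t => pi t) 0).
  exists pi => // t k.
  by rewrite /= diracE mem_set//= le_max lexx.
by apply: (@opt_policy_cost n 0 [tuple]); rewrite addn0.
Qed.

End Optimum.

End HardInstance.

Lemma sum_double_ge (R : realDomainType) n (F : nat -> \bar R) :
  (forall j, 0 <= F j)%E ->
  (\sum_(i < n) F i.*2 <= \sum_(j < n.*2) F j)%E.
Proof.
move=> F0; elim: n => [|n IH]; first by rewrite !big_ord0.
rewrite doubleS !big_ord_recr /= -addeA; apply: leeD => //.
by rewrite leeDl.
Qed.

Section Regret.
Variables (R : realType) (n : nat) (delta : R).
Hypothesis delta_ge0 : 0 <= delta.
Hypothesis delta_le : delta <= 16^-1.
Local Notation RR := (measurableTypeR R).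
Implicit Types (theta : nat -> bool).

Definition clamp (y : RR) : R := Num.min (Num.max y 0) 2^-1.

Lemma clamp01 y : 0 <= clamp y <= 2^-1.
Proof.
rewrite /clamp ge_min lexx orbT andbT le_min le_max lexx orbT/=.
by rewrite invr_ge0.
Qed.

Lemma measurable_clamp : measurable_fun setT (clamp : RR -> RR).
Proof.
apply: measurable_minr; last exact: measurable_cst.
by apply: measurable_maxr; [exact: measurable_id|exact: measurable_cst].
Qed.

Definition side (b : bool) (y : RR) : R := if b then clamp y else 2^-1 - clamp y.

Lemma side_ge0 b y : 0 <= side b y.
Proof. by rewrite /side; have /andP[] := clamp01 y; case: b => // _; rewrite subr_ge0. Qed.

Lemma measurable_side b : measurable_fun setT (side b : RR -> RR).
Proof.
rewrite /side; case: b.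
  exact: measurable_clamp.
by apply: measurable_funB; [exact: measurable_cst|exact: measurable_clamp].
Qed.

Definition loss theta (t : nat) (y : RR) : R :=
  if odd t then 0 else vmin delta + 2 * delta * side (theta t./2) y.

Lemma vmin_ge0 : 0 <= vmin delta. Proof. by have d1 := delta_le; rewrite /vmin; lra. Qed.

Lemma loss_ge0 theta t y : 0 <= loss theta t y.
Proof.
rewrite /loss; case: ifP => // _.
by apply: addr_ge0; [exact: vmin_ge0|rewrite !mulr_ge0// side_ge0].
Qed.

(** Projecting [y] onto $[0,1/2]$ does not increase the expected cost of an even period, which on
    this interval is affine with slope [2 * delta] away from the optimal endpoint. *)
Lemma loss_le theta t (y : RR) :
  ((loss theta t y)%:E <=
    \int[hard_law delta theta t]_u (period_cost 1 1 y u)%:E)%E.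
Proof.
have c0 u : (0 <= (period_cost 1 1 y u)%:E :> \bar R)%E.
  by rewrite lee_fin period_cost11.
have h := hard_bias01 delta_ge0 delta_le theta t.
rewrite (integral_two_point h)// -!EFinM -EFinD lee_fin !period_cost11 subr0.
rewrite /loss; case: ifPn => [_|ot].
  by move: h => /andP[q0 q1]; rewrite addr_ge0// mulr_ge0// subr_ge0.
rewrite /hard_bias (negbTE ot) /side /clamp /vmin.
have d0 := delta_ge0; have d1 := delta_le.
case: (theta _); have [y0|y0] := leP 0 y;
 have [yh|yh] := leP y 2^-1; rewrite ?(ger0_norm y0) ?(ltr0_norm y0);
 (have [z0|z0] := leP 0 (y - 2^-1)); rewrite ?(ger0_norm z0) ?(ltr0_norm z0);
 try (have [v0|v0] := leP 0 (2^-1 : R)); nra.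
Qed.

Variable pi : decision_rule R.
Hypothesis m_pi : measurable_rule pi.
Hypothesis pi1 : forall t (k : hist R t), pi k setT = 1%E.

Definition hist0 : hist R 0 := ([tuple], 0).

Definition mean_clamp (P : nat -> probability RR R) (j : nat) : R :=
  fine (Edec pi P (EFin \o clamp) j hist0).

Let clamp0 y : (0 <= (EFin \o clamp) y)%E.
Proof. by rewrite lee_fin; have /andP[] := clamp01 y. Qed.

Let Edec_clamp_le P j : (Edec pi P (EFin \o clamp) j hist0 <= (2^-1)%:E)%E.
Proof.
rewrite -(Edec_cst pi1 P (2^-1)%:E j hist0).
by apply: le_Edec => // y; rewrite lee_fin; have /andP[] := clamp01 y.
Qed.

Lemma Edec_clamp P j :
  Edec pi P (EFin \o clamp) j hist0 = (mean_clamp P j)%:E.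
Proof.
rewrite /mean_clamp fineK// ge0_fin_numE ?Edec_ge0//.
exact: le_lt_trans (Edec_clamp_le P j) (ltry _).
Qed.

Lemma mean_clamp01 P j : 0 <= mean_clamp P j <= 2^-1.
Proof. by rewrite -!lee_fin -Edec_clamp Edec_ge0//=. Qed.

Lemma Edec_side P b j :
  Edec pi P (EFin \o side b) j hist0 =
  (if b then mean_clamp P j else 2^-1 - mean_clamp P j)%:E.
Proof.
case: b; first exact: Edec_clamp.
have ms : measurable_fun setT (EFin \o (side false : RR -> R)).
  by apply/measurable_EFinP; exact: measurable_side.
have s0 (y : RR) : (0 <= (EFin \o side false) y)%E by rewrite lee_fin side_ge0.
have mc : measurable_fun setT (EFin \o (clamp : RR -> R)).
  by apply/measurable_EFinP; exact: measurable_clamp.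
have := EdecD m_pi P j hist0 s0 ms clamp0 mc.
rewrite (_ : (fun y : RR => ((EFin \o side false) y + (EFin \o clamp) y)%E) =
    fun=> (2^-1)%:E); last first.
  by apply/funext => y /=; rewrite -EFinD /side subrK.
rewrite Edec_cst// Edec_clamp => e.
rewrite EFinB e addeK//.
Qed.

Lemma hard_value_ge theta :
  ((n%:R * vmin delta + 2 * delta * \sum_(i < n)
     (if theta i then mean_clamp (hard_law delta theta) i.*2
      else 2^-1 - mean_clamp (hard_law delta theta) i.*2))%:E <=
   value (hard_cost R n) (hard_cost R n) (hard_law delta theta) pi 0)%E.
Proof.
pose l t : RR -> \bar R := EFin \o loss theta t.
have l0 t y : (0 <= l t y)%E by rewrite lee_fin loss_ge0.
have ms b : measurable_fun setT (fun y : RR => 2 * delta * side b y : RR).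
  by apply: measurable_funM; [exact: measurable_cst|exact: measurable_side].
have ml t : measurable_fun setT (l t).
  apply/measurable_EFinP; rewrite /loss; case: odd; first exact: measurable_cst.
  by apply: measurable_funD; [exact: measurable_cst|exact: ms].
have := @cost_to_go_ge_Edec R pi m_pi (hard_cost R n) (hard_cost R n)
  (hard_law delta theta) l n.*2 0 hist0 (@hard_cost_ge0 R n)
  (@hard_cost_ge0 R n) l0 ml.
move=> H; apply: le_trans (H _); last first.
  by move=> s y sn; rewrite !hard_costE//; exact: loss_le.
under [leRHS]eq_bigr do rewrite add0n.
have F0 j : (0 <= Edec pi (hard_law delta theta) (l j) j hist0)%E.
  exact: Edec_ge0.
apply: le_trans (sum_double_ge n F0).
rewrite EFinD [X in (_ + X)%E]EFinM -sumEFin ge0_sume_distrr; last first.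
  move=> i _; rewrite lee_fin; have /andP[] := mean_clamp01 (hard_law delta theta) i.*2.
  by case: (theta i) => // _ ?; rewrite subr_ge0.
rewrite (_ : (n%:R * vmin delta)%:E = (\sum_(i < n) (vmin delta)%:E)%E); last first.
  by rewrite sumEFin big_const_ord iter_addr_0 mulr_natl.
rewrite -big_split /=; apply: lee_sum => i _.
rewrite -Edec_side.
have s0 b (y : RR) : (0 <= (EFin \o side b) y)%E by rewrite lee_fin side_ge0.
have mse b : measurable_fun setT (EFin \o (side b : RR -> R)).
  by apply/measurable_EFinP; exact: measurable_side.
have c0 : (0 <= (2 * delta)%:E :> \bar R)%E by rewrite lee_fin mulr_ge0.
rewrite -EdecZ//.
rewrite -{1}(Edec_cst pi1 (hard_law delta theta) (vmin delta)%:E i.*2 hist0).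
rewrite -EdecD//; first last.
- exact: measurable_funeM.
- by move=> y; rewrite mule_ge0.
- by move=> _; rewrite lee_fin vmin_ge0.
apply: le_Edec => y; first by rewrite adde_ge0 ?mule_ge0// lee_fin vmin_ge0.
by rewrite /l /= /loss odd_double doubleK.
Qed.

Lemma hard_regret eps theta :
  eps_optimal (hard_cost R n) (hard_cost R n) (hard_law delta theta) eps pi 0 ->
  2 * delta * \sum_(i < n)
     (if theta i then mean_clamp (hard_law delta theta) i.*2
      else 2^-1 - mean_clamp (hard_law delta theta) i.*2) <= eps.
Proof.
rewrite /eps_optimal; set V := value _ _ _ _ _; set o := opt_value _ _ _ _ => Vo.
have oU : (o <= (n%:R * vmin delta)%:E)%E by exact: opt_value_hard.
have VL := hard_value_ge theta; rewrite -/V in VL.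
rewrite -lee_fin; apply: le_trans Vo.
apply: (@le_trans _ _ (V - (n%:R * vmin delta)%:E)%E); last exact: leeB.
by rewrite leeBrDr// -EFinD addrC.
Qed.

End Regret.

(** * The lower bound *)

Section CoinSpace.
Variables (R : realType) (T N : nat).
Local Notation RR := (measurableTypeR R).

Definition coins := {ffun 'I_T * 'I_N -> bool}.

(* The coin flips are coded in [nat], which carries the discrete
   sigma-algebra. *)
Definition coin_dec (k : nat) : coins := nth [ffun=> false] (enum {: coins}) k.

Definition coin_code (x : coins) : nat := index x (enum {: coins}).

Lemma coin_codeK : cancel coin_code coin_dec.
Proof. by move=> x; rewrite /coin_dec nth_index// mem_enum. Qed.

Definition coin_demand (t : 'I_T) (j : 'I_N) : nat -> RR :=
  fun k => bitd R (coin_dec k (t, j)).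

HB.instance Definition _ t j := @isMeasurableFun.Build _ _ nat RR
  (coin_demand t j) (fun _ _ _ => I).

Variable q : nat -> R.
Hypothesis q01 : forall t, 0 <= q t <= 1.

Definition coinw (tj : 'I_T * 'I_N) : bool -> R := bitw (q tj.1).

Lemma coinw_pmf tj : pmf (coinw tj). Proof. exact: bitw_pmf. Qed.

Definition coin_mu : probability nat R := mixture (pw coinw) coin_code 0%N.

Lemma coin_muE (A : set coins) :
  coin_mu (coin_dec @^-1` A) = (EE coinw (fun x => (x \in A)%:R))%:E.
Proof.
rewrite [LHS](mixtureE coin_code 0%N (pw_pmf coinw_pmf)); congr EFin.
apply: eq_bigr => x _; congr (_ * _%:R); congr nat_of_bool.
by apply/idP/idP => /set_mem /= xA; apply/mem_set; rewrite /= ?coin_codeK//;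
  move: xA; rewrite coin_codeK.
Qed.

Definition coin_rv : 'I_T -> 'I_N -> {RV coin_mu >-> RR} := coin_demand.

Let EE_coord (J : {set 'I_T * 'I_N}) (A : 'I_T * 'I_N -> set RR) :
  EE coinw (fun x => \prod_(i in J) (bitd R (x i) \in A i)%:R) =
  \prod_(i in J) \sum_b coinw i b * (bitd R b \in A i)%:R.
Proof.
pose phi i b : R := if i \in J then (bitd R b \in A i)%:R else 1.
transitivity (EE coinw (fun x => \prod_i phi i (x i))).
  by apply: eq_EE => x; rewrite big_mkcond.
rewrite EE_prod [RHS]big_mkcond; apply: eq_bigr => i _; rewrite /phi.
by case: ifP => // _; rewrite -mulr_suml (coinw_pmf i).2 mul1r.
Qed.

Lemma coin_demand_law t j A : measurable A ->
  distribution coin_mu (coin_rv t j) A = two_point (q t) A.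
Proof.
move=> mA; rewrite two_pointE//.
transitivity (coin_mu (coin_dec @^-1` [set x | A (bitd R (x (t, j)))])) => //.
rewrite coin_muE; congr EFin.
have := EE_coord [set (t, j)]%SET (fun=> A); rewrite big_set1 big_bool /= /bitd /bitw.
move=> <-; apply: eq_EE => x; rewrite big_set1; congr (nat_of_bool _)%:R.
Qed.

Lemma coin_demand_indep :
  mutually_independent coin_mu (fun tj : 'I_T * 'I_N => coin_rv tj.1 tj.2).
Proof.
move=> J A mA.
transitivity (EE coinw (fun x => \prod_(i in J) (bitd R (x i) \in A i)%:R))%:E.
  transitivity (coin_mu (coin_dec @^-1`
      [set x | forall i, i \in J -> A i (bitd R (x i))])).
    congr (coin_mu _); apply/seteqP; split=> k /= H i iJ; have := H i iJ;
    by case: i iJ => t j.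
  rewrite coin_muE; congr EFin; apply: eq_EE => x.
  have [xA|xA] := boolP (x \in _).
    rewrite big1// => i iJ; rewrite mem_set//; exact: (set_mem xA).
  have /existsNP[i /not_implyP[iJ xi]] : ~ (forall i, i \in J -> A i (bitd R (x i))).
    by move=> H; move/negP: xA; apply; exact: mem_set.
  by rewrite (bigD1 i)//= (memNset xi) mul0r.
rewrite EE_coord -prodEFin; apply: eq_bigr => -[t j] _.
apply/esym; apply: etrans (coin_demand_law t j (mA (t, j))) _.
by rewrite big_bool two_pointE.
Qed.

End CoinSpace.

Lemma card_ord_lt N m : (m <= N)%N -> #|[set j : 'I_N | (j < m)%N]%SET| = m.
Proof.
move=> mN; have -> : [set j : 'I_N | (j < m)%N]%SET = (widen_ord mN) @: [set: 'I_m]%SET.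
  apply/setP => j; rewrite inE; apply/idP/imsetP => [jm|[k _ ->]]; last exact: (ltn_ord k).
  by exists (Ordinal jm) => //; apply/val_inj.
by rewrite card_imset ?cardsT ?card_ord// => i j /(congr1 val) /= /val_inj.
Qed.

Section FixedSeed.
Variables (R : realType) (n N m : nat) (delta eps : R).
Hypothesis n_gt0 : (0 < n)%N.
Hypothesis mN : (m <= N)%N.
Hypothesis delta_gt0 : 0 < delta.
Hypothesis delta_le : delta <= 16^-1.
Hypothesis epsE : eps = delta * n%:R / 16.
Hypothesis m_small : m%:R * (2 * delta) ^+ 2 <= 18^-1.
Local Notation RR := (measurableTypeR R).
Local Notation T := n.*2.

(** The first [m] logs show the demand itself; the others have boundary 0 and always show zero
    sales. *)
Definition hard_boundary (t : 'I_T) (j : 'I_N) : R := (j < m)%N%:R.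

Definition hard_demand (x : coins T N) (t : 'I_T) (j : 'I_N) : R := bitd R (x (t, j)).

Definition hard_logs (x : coins T N) : logs R T N := censor hard_boundary (hard_demand x).

Lemma hard_logs_upd x (t : 'I_T) (j : 'I_N) v : (m <= j)%N ->
  hard_logs (upd x (t, j) v) = hard_logs x.
Proof.
move=> mj; apply: eq_from_tnth => t'; rewrite !tnth_mktuple.
apply: eq_from_tnth => j'; rewrite !tnth_mktuple /hard_boundary /hard_demand.
have [[-> ->]|ne] := eqVneq (t', j') (t, j); last by rewrite upd_other.
rewrite ltnNge mj /=; have H b : Num.min (bitd R b) 0 = 0.
  by rewrite min_r//; case: b => //=; rewrite invr_ge0.
by rewrite !H.
Qed.

Definition ext (theta : {ffun 'I_n -> bool}) (i : nat) : bool :=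
  if insub i is Some i' then theta i' else false.

Lemma ext_ord theta (i : 'I_n) : ext theta i = theta i.
Proof. by rewrite /ext valK. Qed.

Lemma ext_upd theta (i : 'I_n) b (k : nat) :
  k != i :> nat -> ext (upd theta i b) k = ext theta k.
Proof.
rewrite /ext; case: insubP => // k' _ <- ki.
by rewrite upd_other// -val_eqE.
Qed.

Definition hard_lawf (theta : {ffun 'I_n -> bool}) := hard_law delta (ext theta).

Definition hard_coinw (theta : {ffun 'I_n -> bool}) :=
  @coinw R T N (hard_bias delta (ext theta)).

Lemma hard_coinw_pmf theta tj : pmf (hard_coinw theta tj).
Proof. by apply: coinw_pmf => t; apply: hard_bias01 => //; exact: ltW. Qed.

Lemma hard_law_upd theta (i : 'I_n) b s : (s < i.*2)%N ->
  hard_lawf (upd theta i b) s = hard_lawf theta s.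
Proof.
move=> si; rewrite /hard_lawf /hard_law /hard_bias ext_upd//.
by apply/eqP => e; move: si; rewrite -e; lia.
Qed.

Definition period_coins (i : 'I_n) : {set 'I_T * 'I_N} :=
  [set tj : 'I_T * 'I_N | tj.1 == i.*2 :> nat]%SET.

Definition seen_coins (i : 'I_n) : {set 'I_T * 'I_N} :=
  [set tj : 'I_T * 'I_N | (tj.1 == i.*2 :> nat) && (tj.2 < m)%N]%SET.

Lemma card_seen_coins i : (#|seen_coins i| <= m)%N.
Proof.
have iT : (i.*2 < T)%N by rewrite ltn_double.
rewrite -[leqRHS](card_ord_lt mN) -[leqRHS]mul1n -(cards1 (Ordinal iT)) -cardsX.
apply: subset_leq_card; apply/fintype.subsetP => -[t j]; rewrite !inE /=.
by move=> /andP[ti ->]; rewrite andbT -val_eqE.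
Qed.

Lemma hard_coinw_tilt theta i b :
  hard_coinw (upd theta i b) =
  tilt (period_coins i) (hard_coinw theta) (if b then 2 * delta else - (2 * delta)).
Proof.
apply/funext => -[t j]; apply/funext => c.
rewrite /tilt inE /=; case: eqVneq => [ti|ti].
  rewrite /hard_coinw /coinw /hard_bias /= ti odd_double doubleK ext_ord upd_same.
  by rewrite /bitw /sgnb; case: b; case: c => /=; lra.
rewrite /hard_coinw /coinw /hard_bias /=; congr (bitw _ _).
case: ifPn => // ot; rewrite ext_upd//.
by apply: contra ti => /eqP <-; rewrite -[X in X == _]odd_double_half (negbTE ot).
Qed.

Context dS (S : measurableType dS).
Variable L : forall t, R.-pker (S * logs R T N * hist R t) ~> RR.
Variable s : S.

Definition hard_rule (x : coins T N) : decision_rule R :=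
  fun t k => L t (s, hard_logs x, k).

Definition hard_good theta (x : coins T N) : bool :=
  `[< eps_optimal (hard_cost R n) (hard_cost R n) (hard_lawf theta) eps (hard_rule x) 0 >].

(** Given the logs, the mean clamped decision of period [2 i] involves the laws of earlier periods
    only, hence not [theta i]; it plays the role of [Y]. By [epsE], regret [eps] means a total loss
    of at most [n / 32]. *)
Lemma fixed_seed :
  EE (@fair R 'I_n) (fun theta =>
    EE (hard_coinw theta) (fun x => (hard_good theta x)%:R)) <= 2 / 3.
Proof.
have d0 := ltW delta_gt0.
have mr x : measurable_rule (hard_rule x).
  exact: (@measurable_rule_kernel R _ (S * logs R T N)%type L (s, hard_logs x)).
have r1 x t (k : hist R t) : hard_rule x k setT = 1%E by exact: prob_kernel.
apply: (@assouad R n _ hard_coinw hard_good (fun theta x i =>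
  mean_clamp (hard_rule x) (hard_lawf theta) i.*2)) => //.
- exact: hard_coinw_pmf.
- move=> theta x i b; rewrite /mean_clamp; congr fine; apply: eq_Edec => t.
  by rewrite add0n => /andP[_ ti]; exact: hard_law_upd.
- by move=> theta x i; exact: mean_clamp01.
- move=> theta x /asboolP/(hard_regret d0 delta_le (mr x) (r1 x)) H.
  rewrite -(ler_pM2l (_ : 0 < 2 * delta)) ?mulr_gt0//.
  under eq_bigr do rewrite -ext_ord.
  by apply: le_trans H _; rewrite epsE; lra.
move=> theta i; rewrite !hard_coinw_tilt.
apply: (@tilt_diff R _ (period_coins i) (seen_coins i)).
- exact: hard_coinw_pmf.
- by apply/fintype.subsetP => tj; rewrite !inE => /andP[].
- by have d1 := delta_le; apply/andP; split; lra.
- apply: le_trans m_small; rewrite ler_wpM2r ?sqr_ge0// ler_nat.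
  exact: card_seen_coins.
- move=> [t j] x v; rewrite !inE /= => ->; rewrite -leqNgt => mj.
  by rewrite /hard_rule hard_logs_upd.
- by move=> x; exact: mean_clamp01.
Qed.

End FixedSeed.

Import HBNNSimple.

Section Superadditivity.
Context d (T : measurableType d) (R : realType).
Variable mu : {measure set T -> \bar R}.
Local Open Scope ereal_scope.

(* Simple functions below [f] and [g] add up to one below [f + g], so nothing
   has to be measurable here. *)
Lemma integralD_le (f g : T -> \bar R) :
  (forall x, 0 <= f x) -> (forall x, 0 <= g x) ->
  \int[mu]_x f x + \int[mu]_x g x <= \int[mu]_x (f x + g x).
Proof.
move=> f0 g0; have fg0 x : 0 <= f x + g x by rewrite adde_ge0.
set X := \int[mu]_x (f x + g x).
have [->|Xoo] := eqVneq X +oo; first by rewrite leey.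
have Xfin : X \is a fin_num by rewrite ge0_fin_numE ?integral_ge0// lt_neqAle Xoo leey.
have fX : \int[mu]_x f x <= X by apply: le_ge0_integral => // x; rewrite leeDl.
have gX : \int[mu]_x g x <= X by apply: le_ge0_integral => // x; rewrite leeDr.
have fin I : 0 <= I -> I <= X -> I \is a fin_num.
  by move=> I0 IX; rewrite ge0_fin_numE//; apply: le_lt_trans IX _; rewrite ltey_eq Xfin.
have gfin : \int[mu]_x g x \is a fin_num by apply: fin => //; exact: integral_ge0.
rewrite -leeBrDr// ge0_integralTE//; apply: ge_ereal_sup => _ [s sf <-].
rewrite leeBrDr// addeC -(integralT_nnsfun mu).
have s0 x : 0 <= (s x)%:E by rewrite lee_fin.
have ms : measurable_fun setT (EFin \o s) by apply/measurable_EFinP.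
have sX : \int[mu]_x (s x)%:E <= X.
  by apply: le_trans fX; apply: le_ge0_integral.
have sfin : \int[mu]_x (s x)%:E \is a fin_num.
  by apply: fin => //; exact: integral_ge0.
rewrite -leeBrDr// [leLHS]ge0_integralTE//; apply: ge_ereal_sup => _ [u ug <-].
rewrite leeBrDr// -(integralT_nnsfun mu).
have u0 x : 0 <= (u x)%:E by rewrite lee_fin.
have m_u : measurable_fun setT (EFin \o u) by apply/measurable_EFinP.
rewrite -ge0_integralD//; apply: le_ge0_integral => x; first by rewrite adde_ge0.
by rewrite addeC leeD.
Qed.

Lemma integral_sum_le (I : Type) (r : seq I) (f : I -> T -> \bar R) :
  (forall i x, 0 <= f i x) ->
  \sum_(i <- r) \int[mu]_x f i x <= \int[mu]_x \sum_(i <- r) f i x.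
Proof.
move=> f0; elim: r => [|i r IH].
  by rewrite big_nil; apply: integral_ge0 => x _; rewrite big_nil.
rewrite big_cons; apply: le_trans (leeD (lexx _) IH) _.
under [leRHS]eq_integral do rewrite big_cons.
by apply: integralD_le => // x; apply: sume_ge0.
Qed.

End Superadditivity.

Section NotSufficient.
Variables (R : realType) (n N m : nat) (delta eps r : R).
Hypothesis n_gt0 : (0 < n)%N.
Hypothesis mN : (m <= N)%N.
Hypothesis delta_gt0 : 0 < delta.
Hypothesis delta_le : delta <= 16^-1.
Hypothesis epsE : eps = delta * n%:R / 16.
Hypothesis m_small : m%:R * (2 * delta) ^+ 2 <= 18^-1.
Hypothesis mE : Num.ceil (r * N%:R) = m%:Z.
Local Notation RR := (measurableTypeR R).
Local Notation T := n.*2.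
Let hc := hard_cost R n.

Let bias01 theta t : 0 <= hard_bias delta theta t <= 1.
Proof. by apply: hard_bias01 => //; exact: ltW. Qed.

(** The all-ones vector serves as both costs and as caps: demand is surely below 1, and the critical
    ratio is [1 / 2]. *)
Lemma hard_archive theta :
  archive_instance r hc hc hc (@hard_boundary R n N m) (hard_law delta theta).
Proof.
have h1 (t : 'I_T) : hc`_t = 1 by rewrite hard_costE.
split=> [t||t|t j|s t _|t|t|t].
- by rewrite h1.
- apply/eqP; rewrite eq_le; apply/andP; split.
    by apply: bigmax_le => // t _; rewrite h1 maxxx.
  have T0 : (0 < T)%N by rewrite double_gt0.
  by apply: le_trans (le_bigmax _ _ (Ordinal T0)); rewrite h1 maxxx.
- rewrite [LHS](two_pointE (bias01 theta t)) !mem_set /= ?lexx ?ler01//.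
    by rewrite !mulr1 addrC subrK.
  by rewrite invr_ge0 ler0n/= invf_le1// ler1n.
- by rewrite /hard_boundary.
- by rewrite !h1.
- by rewrite h1 ler01 lexx.
- rewrite [ltRHS](two_pointE (bias01 theta t)) h1 !mem_set /= ?ltr01//.
    by rewrite lte_fin !mulr1 [ltRHS]addrC subrK div1r invf_lt1 ?addr_gt0// ltrDl.
  by rewrite invf_lt1// ltr1n.
rewrite mE h1 (_ : [set j | _]%SET = [set j : 'I_N | (j < m)%N]%SET) ?card_ord_lt//.
by apply/setP => j; rewrite !inE /hard_boundary; case: (j < m)%N; rewrite ?lexx ?ler10.
Qed.

(* The success probability given the seed need not be measurable in the seed;
   superadditivity of the integral suffices to average it over [theta]. *)
Lemma not_suffices : ~ suffices T eps r N.
Proof.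
move=> [dS [S [Q [L [_ H]]]]].
pose Lh := L hc hc hc.
pose F (theta : {ffun 'I_n -> bool}) s : R :=
  EE (hard_coinw delta theta) (fun x => (hard_good m delta eps Lh s theta x)%:R).
have F0 theta s : 0 <= F theta s.
  by apply: sumr_ge0 => x _; rewrite mulr_ge0// pw_ge0// => i; apply: hard_coinw_pmf.
have IF theta : ((3 / 4)%:E <= \int[Q]_s (F theta s)%:E)%E.
  have := H hc hc hc _ _ (hard_archive (ext theta)) _ nat
    (coin_mu T N (hard_bias delta (ext theta)))
    (@coin_rv R T N (hard_bias delta (ext theta))).
  move=> /(_ (coin_demand_law (bias01 _)) (coin_demand_indep (bias01 _))).
  move=> /le_trans; apply; rewrite /product_measure1.
  apply: le_ge0_integral => s; first exact: measure_ge0.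
  rewrite /= (_ : xsection _ _ =
      coin_dec T N @^-1` [set x | hard_good m delta eps Lh s theta x]); last first.
    apply/seteqP; split=> k; rewrite /xsection /= inE => /asboolP //.
  rewrite (coin_muE (bias01 _)) lee_fin; apply: le_EE => [i|x].
    exact: hard_coinw_pmf.
  by rewrite mem_setE.
have FS s : \sum_theta F theta s <= 2 / 3 * 2 ^+ n.
  have := fixed_seed n_gt0 mN delta_gt0 delta_le epsE m_small Lh s.
  rewrite {1}/EE; under eq_bigr => theta _.
    rewrite /pw /fair prodr_const card_ord; over.
  by rewrite -mulr_sumr exprVn mulrC ler_pdivrMr ?exprn_gt0.
have F0E theta s : (0 <= (F theta s)%:E)%E by rewrite lee_fin.
have := @integral_sum_le _ S R Q _ (index_enum {ffun 'I_n -> bool})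
  (fun theta s => (F theta s)%:E) F0E.
apply/negP; rewrite -ltNge.
apply: (@le_lt_trans _ _ (2 / 3 * 2 ^+ n)%:E).
  have Qc c : (\int[Q]_s c = c)%E.
    by rewrite integral_cst// [X in (_ * X)%E](_ : _ = 1%E) ?mule1//; exact: probability_setT.
  rewrite -(Qc (2 / 3 * 2 ^+ n)%:E); apply: le_ge0_integral => s.
    by apply: sume_ge0.
  by rewrite sumEFin lee_fin.
apply: (@lt_le_trans _ _ (\sum_(theta : {ffun 'I_n -> bool}) (3 / 4)%:E)%E); last first.
  exact: lee_sum.
rewrite sumEFin lte_fin sumr_const card_ffun card_bool card_ord -[ltRHS]mulr_natl natrX.
have : 0 < 2 ^+ n :> R by rewrite exprn_gt0.
by move: (2 ^+ n) => z; lra.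
Qed.

End NotSufficient.

Section LowerRate.
Variable R : realType.
Implicit Types (r eps : R).

Lemma suffices_ge n N r eps : (0 < n)%N -> 0 < r <= 1 ->
  0 < eps <= n.*2%:R / 512 -> suffices n.*2 eps r N ->
  (32 * 64 ^+ 2)^-1 * (n.*2%:R ^+ 2 / (r * eps ^+ 2)) <= N%:R.
Proof.
move=> n0 /andP[r0 r1] /andP[e0 e1] suffN; rewrite leNgt; apply/negP => N_small.
have rN0 : 0 <= r * N%:R by rewrite mulr_ge0// ltW.
have [m mE] : exists m : nat, Num.ceil (r * N%:R) = m%:Z.
  by exists `|Num.ceil (r * N%:R)|%N; rewrite gez0_abs// ceil_ge0 (lt_le_trans _ rN0).
have mlt : m%:R - 1 < r * N%:R.
  by have := ceilB1_lt (r * N%:R); rewrite mE rmorphB.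
have mN : (m <= N)%N.
  by rewrite -lez_nat -mE ceil_le_int ler_piMl.
have n0R : 0 < n%:R :> R by rewrite ltr0n.
have TE : n.*2%:R = 2 * n%:R :> R by rewrite -mul2n natrM.
(* [z] is [2 * delta] for [eps = delta * n / 16]; the bound [eps <= T / 512] gives [z <= 1 / 8]. *)
have [z zE] : exists z, z = 32 * eps / n%:R by exists (32 * eps / n%:R).
have z0 : 0 < z by rewrite zE divr_gt0// mulr_gt0.
have zle : z <= 8^-1 by rewrite zE ler_pdivrMr//; rewrite TE in e1; lra.
have rNz : r * N%:R * z ^+ 2 <= 32^-1.
  move: N_small; rewrite TE => /ltW.
  rewrite -(ler_pM2l (_ : 0 < r * z ^+ 2)) ?mulr_gt0 ?exprn_gt0//.
  move=> H; rewrite mulrAC; apply: le_trans H _.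
  rewrite le_eqVlt; apply/orP; left; apply/eqP; rewrite zE.
  by field; rewrite !gt_eqF.
have d0 : 0 < z / 2 by rewrite divr_gt0.
have d1 : z / 2 <= 16^-1 by lra.
have dE : eps = z / 2 * n%:R / 16 by rewrite zE; field; rewrite gt_eqF.
suff dm : m%:R * (2 * (z / 2)) ^+ 2 <= 18^-1.
  exact: (not_suffices n0 mN d0 d1 dE dm mE suffN).
rewrite [2 * _]mulrC divfK ?pnatr_eq0//.
have z2 : z ^+ 2 <= 8^-1 ^+ 2 by rewrite ler_pXn2r// nnegrE ltW.
(* Rounding [r * N] up to [m] costs at most [z ^+ 2 <= 1 / 64], and [1 / 32 + 1 / 64 < 1 / 18]. *)
have mz : m%:R * z ^+ 2 <= (r * N%:R + 1) * z ^+ 2.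
  by apply: ler_wpM2r; [exact: sqr_ge0|lra].
lra.
Qed.

Lemma Mcov_ge n r eps : (0 < n)%N -> 0 < r <= 1 -> 0 < eps <= n.*2%:R / 512 ->
  (((32 * 64 ^+ 2)^-1 * (n.*2%:R ^+ 3 / (r * eps ^+ 2)))%:E <= Mcov n.*2 eps r)%E.
Proof.
move=> n0 r01 e01; rewrite /Mcov.
rewrite (_ : _ * _ =
  n.*2%:R * ((32 * 64 ^+ 2)^-1 * (n.*2%:R ^+ 2 / (r * eps ^+ 2)))); last first.
  by rewrite exprS !mulrA; congr (_ / _); ring.
rewrite EFinM; apply: lee_wpmul2l; first by rewrite lee_fin.
apply: le_ereal_inf_tmp => _ [N [_ suffN] <-].
by rewrite lee_fin; exact: suffices_ge.
Qed.

End LowerRate.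

Theorem corollary3 (R : realType) :
  exists c C : R, [/\ 0 < c, c <= C &
    forall (T : nat) (eps r : R),
      (4 <= T)%N -> ~~ odd T -> 0 < r <= 1 -> 0 < eps <= T%:R / 512 ->
      ((c * (T%:R ^+ 3 / (r * eps ^+ 2)))%:E <= Mcov T eps r)%E /\
      (Mcov T eps r <= (C * (T%:R ^+ 3 / (r * eps ^+ 2)))%:E)%E].
Proof.
exists (32 * 64 ^+ 2)^-1, (2 * (8 * (432 * 24 ^+ 3 + 9)) ^+ 2); split.
- by rewrite invr_gt0 mulr_gt0.
- apply: (@le_trans _ _ 1).
    by rewrite invf_le1 ?mulr_gt0//; lra.
  set C1 : R := 8 * (432 * 24 ^+ 3 + 9).
  have C1_ge1 : 1 <= C1.
    have : 0 <= 432 * 24 ^+ 3 :> R.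
      by apply: mulr_ge0; [exact: ler0n|apply: exprn_ge0; exact: ler0n].
    by rewrite /C1; move: (432 * 24 ^+ 3) => z; lra.
  by move: C1 C1_ge1 => z z1; nra.
move=> T eps r T4 oT r01 e01.
have TE : T = T./2.*2 by rewrite -[LHS]odd_double_half (negbTE oT).
split.
  rewrite TE; apply: Mcov_ge => //; first by lia.
  by rewrite -TE.
by case: T T4 {oT TE} e01 => // T' _ e01; exact: Mcov_le.
Qed.
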